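(* Let $g_1(\mathbf{x})=\sum_{t=1}^n a_tx_t+r_1$, $g_2(\mathbf{x})=\sum_{t=1}^n b_tx_t+r_2$, $g_3(\mathbf{x})=\sum_{t=1}^n c_tx_t+r_3$ be non-constant real affine functions on $\mathbb{R}^n$, $H_i=\{g_i=0\}$ and $H_i^+=\{g_i\ge 0\}$ for $i=1,2,3$, and suppose that the good clipping conditions for $(H_1^+,H_2^+,H_3^+)$ (with $H_3$ as auxiliary hyperplane) hold. Then $$\begin{aligned}\operatorname{vol}([0,1]^n\cap H_1^+\cap H_2^+\cap H_3^+)=&\sum_{\mathbf{v}\in F^0\cap H_1^+\cap H_2^+\cap H_3^+}\frac{(-1)^{|0_{\mathbf{v}}|}g_3(\mathbf{v})^n}{n!\prod_{t\in[n]}c_t}\\ &-\sum_{\mathbf{v}\in F^1\cap H_1\cap H_2^+\cap H_3^+}\frac{(-1)^{|0_{\mathbf{v}}|}\operatorname{sgn}(a_{p})\,a_{p}^{\,n-1}\,g_3(\mathbf{v})^n}{n!\,c_{p}\prod_{t\in\bullet_{\mathbf{v}}}\det\begin{pmatrix}a_{p}&c_{p}\\ a_t&c_t\end{pmatrix}}\\ &-\sum_{\mathbf{v}\in F^1\cap H_1^+\cap H_2\cap H_3^+}\frac{(-1)^{|0_{\mathbf{v}}|}\operatorname{sgn}(b_{p})\,b_{p}^{\,n-1}\,g_3(\mathbf{v})^n}{n!\,c_{p}\prod_{t\in\bullet_{\mathbf{v}}}\det\begin{pmatrix}b_{p}&c_{p}\\ b_t&c_t\end{pmatrix}}\\ &-\sum_{\mathbf{v}\in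 F^2\cap H_1\cap H_2\cap H_3^+}\frac{(-1)^{|0_{\mathbf{v}}|}\operatorname{sgn}(D_{\mathbf{v}})\,D_{\mathbf{v}}^{\,n-1}\,g_3(\mathbf{v})^n}{n!\,\det\begin{pmatrix}a_{p}&c_{p}\\ a_{q}&c_{q}\end{pmatrix}\det\begin{pmatrix}b_{p}&c_{p}\\ b_{q}&c_{q}\end{pmatrix}\prod_{t\in\bullet_{\mathbf{v}}}\det\begin{pmatrix}a_{p}&b_{p}&c_{p}\\ a_{q}&b_{q}&c_{q}\\ a_t&b_t&c_t\end{pmatrix}},\end{aligned}$$ where in the second and third sums $p=*(\mathbf{v})$ is the unique index with $v_p\notin\{0,1\}$; in the fourth sum $p=*_1(\mathbf{v})<q=*_2(\mathbf{v})$ are the two indices with $v_p,v_q\notin\{0,1\}$ and $D_{\mathbf{v}}=\det\begin{pmatrix}a_p&b_p\\ a_q&b_q\end{pmatrix}$; and points $\mathbf{v}$ with $g_3(\mathbf{v})=0$ are omitted from all sums (they contribute $0$).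
   Context: $[k]=\{1,\dots,k\}$. $F^d$ is the set of points of $[0,1]^n$ having exactly $d$ coordinates different from $0$ and $1$ (and $F^{-1}=\varnothing$). For $\mathbf{v}\in\mathbb{R}^n$: $0_{\mathbf{v}}=\{i: v_i=0\}$, $*_{\mathbf{v}}=\{i: v_i\neq 0,1\}$, $\bullet_{\mathbf{v}}=[n]\setminus *_{\mathbf{v}}$. Let $A$ be the $n\times 3$ matrix with columns $(a_t)_t,(b_t)_t,(c_t)_t$. For $J\subset[n]$, $K\subset[3]$ with $|J|=|K|$, $A_J^K$ is the minor of $A$ with rows $J$ and columns $K$ in increasing order, $A_\varnothing^\varnothing=1$. For $I\subset\{1,2\}$ let $H_I=\bigl(\bigcap_{i\in I}H_i\bigr)\cap H_1^+\cap H_2^+\cap H_3^+\setminus H_3$. The good clipping conditions are: (A) for every $I\subset\{1,2\}$, $F^{|I|-1}\cap H_I=\varnothing$; (B) for every $I\subset\{1,2\}$ and every $\mathbf{v}\in F^{|I|}\cap H_I$, $\prod_{t\in I}A_{*_{\mathbf{v}}}^{(I\setminus\{t\})\cup\{3\}}\prod_{t\in\bullet_{\mathbf{v}}}A_{*_{\mathbf{v}}\cup\{t\}}^{I\cup\{3\}}\ne 0$. $\operatorname{sgn}$ is the sign function and $\operatorname{vol}$ is Lebesgue measure. *)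

(* Defs.v *)
From HB Require Import structures.
From mathcomp Require Import all_boot all_order all_algebra.
From mathcomp Require Import all_classical all_reals all_analysis.

Set Implicit Arguments.
Unset Strict Implicit.
Unset Printing Implicit Defensive.
Import Order.TTheory GRing.Theory Num.Theory.

Local Open Scope classical_set_scope.
Local Open Scope ring_scope.

Notation Rn R n := (n.-tuple (measurableTypeR R)).

Definition tcons (R : realType) (n : nat)
  (p : measurableTypeR R * Rn R n) : Rn R n.+1 := [tuple of p.1 :: p.2].

(* The n-dimensional Lebesgue measure on Borel sets, as the n-fold product of
   the one-dimensional one; see vol_box below. *)
Fixpoint vol (R : realType) (n : nat) : set (Rn R n) -> \bar R :=
  match n with
  | 0%N => \d_([tuple] : Rn R 0)
  | m.+1 => pushforward (product_measure1 lebesgue_measure (@vol R m))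
                        (@tcons R m)
  end.

Lemma measurable_tcons (R : realType) (n : nat) :
  measurable_fun setT (@tcons R n).
Proof. by apply: measurable_cons. Qed.

(* The library has this as an instance of product_measure1, but it is shadowed
   by the one for subprobabilities. *)
Lemma product_measure1_sigma_finite d1 d2 (T1 : measurableType d1)
    (T2 : measurableType d2) (R : realType)
    (m1 : {sigma_finite_measure set T1 -> \bar R})
    (m2 : {sigma_finite_measure set T2 -> \bar R}) :
  sigma_finite setT (product_measure1 m1 m2).
Proof.
have /sigma_finiteP[F [TF ndF Foo]] := sigma_finiteT m1.
have /sigma_finiteP[G [TG ndG Goo]] := sigma_finiteT m2.
exists (fun n => F n `*` G n).
  rewrite -setXTT TF TG predeqE => -[x y]; split.
    move=> [/= [n _ Fnx] [k _ Gky]]; exists (maxn n k) => //; split.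
    - by move: x Fnx; exact/subsetPset/ndF/leq_maxl.
    - by move: y Gky; exact/subsetPset/ndG/leq_maxr.
  by move=> [n _ []/= ? ?]; split; exists n.
move=> k; have [? ?] := Foo k; have [? ?] := Goo k.
split; first exact: measurableX.
by rewrite product_measure1E// lte_mul_pinfty// ge0_fin_numE.
Qed.

Section vol_step.
Local Open Scope ereal_scope.
Context {R : realType} (n : nat).
Variable m : {sigma_finite_measure set (Rn R n) -> \bar R}.
Let lm : {sigma_finite_measure set (measurableTypeR R) -> \bar R} :=
  [the sigma_finite_measure _ _ of lebesgue_measure].
Definition vol_step : set (Rn R n.+1) -> \bar R :=
  pushforward (product_measure1 lm m) (@tcons R n).

Let mpre (A : set (Rn R n.+1)) : measurable A ->
  measurable (@tcons R n @^-1` A).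
Proof.
by move=> mA; rewrite -[X in measurable X]setTI; exact: measurable_tcons.
Qed.

Let vol_step0 : vol_step set0 = 0.
Proof. by rewrite /vol_step /pushforward preimage_set0 measure0. Qed.

Let vol_step_ge0 A : 0 <= vol_step A.
Proof. by rewrite /vol_step /pushforward; exact: measure_ge0. Qed.

Let vol_step_sigma_additive : semi_sigma_additive vol_step.
Proof.
move=> F mF tF mUF; rewrite /vol_step /pushforward preimage_bigcup.
apply: measure_semi_sigma_additive.
- by move=> k; exact: mpre.
- apply/trivIsetP => /= i j _ _ ij; rewrite -preimage_setI.
  by move/trivIsetP : tF => /(_ _ _ _ _ ij) ->//; rewrite preimage_set0.
- by rewrite -preimage_bigcup; exact: mpre.
Qed.

HB.instance Definition _ := isMeasure.Build _ _ _ vol_step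
  vol_step0 vol_step_ge0 vol_step_sigma_additive.

Let uncons (x : Rn R n.+1) : measurableTypeR R * Rn R n :=
  (thead x, [tuple of behead x]).

Let unconsK : cancel (@tcons R n) uncons.
Proof.
by case=> x t; apply: injective_projections => //=; exact/val_inj.
Qed.

Let tconsK : cancel uncons (@tcons R n).
Proof. by move=> x; rewrite [RHS]tuple_eta. Qed.

Let measurable_uncons : measurable_fun setT uncons.
Proof.
by apply: measurable_fun_pair; [exact: measurable_tnth|exact: measurable_behead].
Qed.

Let vol_step_sigma_finite : sigma_finite setT vol_step.
Proof.
have [F TF mF] := product_measure1_sigma_finite lm m.
exists (fun k => uncons @^-1` F k).
  by rewrite -preimage_bigcup -TF preimage_setT.
move=> k; have [mFk Fk] := mF k; split.
  by rewrite -[X in measurable X]setTI; exact: measurable_uncons.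
rewrite /vol_step /pushforward.
rewrite (_ : _ @^-1` _ = F k)//; apply/seteqP; split => x /=; by rewrite unconsK.
Qed.

HB.instance Definition _ := Measure_isSigmaFinite.Build _ _ _ vol_step
  vol_step_sigma_finite.

End vol_step.

Section vol_measure.
Local Open Scope ereal_scope.
Context {R : realType}.

Lemma vol_sigma_finite_measure (n : nat) :
  exists m : {sigma_finite_measure set (Rn R n) -> \bar R},
    @vol R n = m :> (set (Rn R n) -> \bar R).
Proof.
elim: n => [|n [m mE]].
  by exists [the sigma_finite_measure _ _ of \d_([tuple] : Rn R 0)].
by exists [the sigma_finite_measure _ _ of vol_step m]; rewrite /= mE.
Qed.

Context (n : nat).

Let vol0 : @vol R n set0 = 0.
Proof. by have [m ->] := vol_sigma_finite_measure n; exact: measure0. Qed.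

Let vol_ge0 A : 0 <= @vol R n A.
Proof. by have [m ->] := vol_sigma_finite_measure n; exact: measure_ge0. Qed.

Let vol_sigma_additive : semi_sigma_additive (@vol R n).
Proof.
by have [m ->] := vol_sigma_finite_measure n; exact: measure_semi_sigma_additive.
Qed.

HB.instance Definition _ := isMeasure.Build _ _ _ (@vol R n)
  vol0 vol_ge0 vol_sigma_additive.

Let vol_sigma_finite : sigma_finite setT (@vol R n).
Proof.
by have [m ->] := vol_sigma_finite_measure n; exact: sigma_finiteT.
Qed.

HB.instance Definition _ := Measure_isSigmaFinite.Build _ _ _ (@vol R n)
  vol_sigma_finite.

End vol_measure.

Lemma vol_box (R : realType) (n : nat) (B : 'I_n -> set (measurableTypeR R)) :
  (forall i, measurable (B i)) ->
  @vol R n [set x : Rn R n | forall i, B i (tnth x i)] =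
  (\prod_(i < n) lebesgue_measure (B i))%E.
Proof.
elim: n B => [|n IH] B mB.
  rewrite big_ord0 /= /dirac (_ : [set _ | _] = setT) ?indicT//.
  by apply/seteqP; split => // x _ [].
rewrite big_ord_recl /= /pushforward.
set C := [set x : Rn R n | forall i, B (lift ord0 i) (tnth x i)].
have mC : measurable C.
  rewrite (_ : C = \bigcap_(i in [set: 'I_n])
    ((@tnth n (measurableTypeR R))^~ i @^-1` (B (lift ord0 i)))).
    apply: fin_bigcap_measurable => [|i _]; first exact: finite_finset.
    by rewrite -[X in measurable X]setTI; exact: measurable_tnth.
  apply/seteqP; split => x /= H i; first by move=> _; exact: H.
  exact: H.
have mB0 := mB ord0.
rewrite (_ : _ @^-1` _ = B ord0 `*` C).
  transitivity (lebesgue_measure (B ord0) * @vol R n C)%E; last first.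
    by congr (_ * _)%E; exact: (IH (fun i => B (lift ord0 i)) (fun i => mB _)).
  exact: (product_measure1E lebesgue_measure
    [the sigma_finite_measure _ _ of @vol R n] mB0 mC).
apply/seteqP; split => -[x t] /=.
  move=> H; split => [|i]; first by have := H ord0; rewrite tnth0.
  by have := H (lift ord0 i); rewrite tnthS /tcons /=;
    congr (B _ (tnth _ _)); exact/val_inj.
move=> [H0 HS] i; have [j ->|->] := unliftP ord0 i; last by rewrite tnth0.
rewrite tnthS; have := HS j; congr (B _ (tnth _ _)); exact/val_inj.
Qed.

Section cube.
Context {R : realType} {n : nat}.
Implicit Types (v : Rn R n) (g : Rn R n -> R) (a : 'I_n -> R).

Definition affine a (r : R) v : R := \sum_(t < n) a t * tnth v t + r.

Definition hyperplane g : set (Rn R n) := [set v | g v = 0].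
Definition halfspace g : set (Rn R n) := [set v | 0 <= g v].

Definition cube : set (Rn R n) := [set v | forall t, 0 <= (tnth v t : R) <= 1].

Definition zeros v : {set 'I_n} := [set t | (tnth v t : R) == 0]%SET.
Definition star v : {set 'I_n} :=
  [set t | ((tnth v t : R) != 0) && ((tnth v t : R) != 1)]%SET.
Definition bullet v : {set 'I_n} := (~: star v)%SET.

(* Indexed by int, so that F (- 1) is empty. *)
Definition F (d : int) : set (Rn R n) :=
  cube `&` [set v | #|star v|%:Z = d].

End cube.

(* enum of a set of ordinals is increasing, so this is the minor with rows J
   and columns K in increasing order; only meaningful when #|J| = #|K|. *)
Definition minor (R : comNzRingType) (n m : nat) (A : 'M[R]_(n, m.+1))
    (J : {set 'I_n}) (K : {set 'I_m.+1}) : R :=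
  \det (\matrix_(i < #|J|, j < #|J|) A (enum_val i) (nth ord0 (enum K) j)).

Definition i1 : 'I_3 := @Ordinal 3 0 isT.
Definition i2 : 'I_3 := @Ordinal 3 1 isT.
Definition i3 : 'I_3 := @Ordinal 3 2 isT.

Section good_clipping.
Context {R : realType} {n : nat}.
Variables (A : 'M[R]_(n, 3)) (r : 'I_3 -> R).

Definition clip_fun (i : 'I_3) : Rn R n -> R := affine (A^~ i) (r i).

Definition HI (I : {set 'I_3}) : set (Rn R n) :=
  ((\bigcap_(i in [set` I]) hyperplane (clip_fun i)) `&`
   halfspace (clip_fun i1) `&` halfspace (clip_fun i2) `&`
   halfspace (clip_fun i3)) `\` hyperplane (clip_fun i3).

Definition good_clipping_A : Prop :=
  forall I : {set 'I_3}, I \subset [set i1; i2]%SET ->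
    F (#|I|%:Z - 1) `&` HI I = set0.

Definition good_clipping_B : Prop :=
  forall I : {set 'I_3}, I \subset [set i1; i2]%SET ->
  forall v : Rn R n, (F #|I|%:Z `&` HI I) v ->
    (\prod_(t in I) minor A (star v) (i3 |: I :\ t)%SET) *
    (\prod_(t in bullet v) minor A (t |: star v)%SET (i3 |: I)%SET) != 0.

Definition good_clipping : Prop := good_clipping_A /\ good_clipping_B.

End good_clipping.

Definition coef_mx (R : realType) (n : nat) (a b c : 'I_n -> R) : 'M[R]_(n, 3) :=
  \matrix_(t, j) tnth [tuple a t; b t; c t] j.

Definition rows_mx (R : realType) (n : nat) (s : seq (seq R)) : 'M[R]_n :=
  \matrix_(i, j) (nth [::] s i)`_j.
Definition det2 (R : realType) (x y z w : R) : R :=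
  \det (rows_mx 2 [:: [:: x; y]; [:: z; w]]).
Definition det3 (R : realType) (x1 y1 z1 x2 y2 z2 x3 y3 z3 : R) : R :=
  \det (rows_mx 3 [:: [:: x1; y1; z1]; [:: x2; y2; z2]; [:: x3; y3; z3]]).

Section terms.
Context {R : realType} {n : nat}.
Implicit Types (a b c : 'I_n -> R) (g : Rn R n -> R) (v : Rn R n).

Definition term0 c g v : R :=
  (-1) ^+ #|zeros v| * g v ^+ n / (n`!%:R * \prod_(t < n) c t).

(* On F 1, enum (star v) is [:: p]. *)
Definition term1 a c g v : R :=
  if enum (star v) is [:: p] then
    (-1) ^+ #|zeros v| * Num.sg (a p) * a p ^+ n.-1 * g v ^+ n /
    (n`!%:R * c p * \prod_(t in bullet v) det2 (a p) (c p) (a t) (c t))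
  else 0.

(* On F 2, enum (star v) is [:: p; q] with p < q. *)
Definition term2 a b c g v : R :=
  if enum (star v) is [:: p; q] then
    let D := det2 (a p) (b p) (a q) (b q) in
    (-1) ^+ #|zeros v| * Num.sg D * D ^+ n.-1 * g v ^+ n /
    (n`!%:R * det2 (a p) (c p) (a q) (c q) * det2 (b p) (c p) (b q) (c q) *
     \prod_(t in bullet v) det3 (a p) (b p) (c p)
                                (a q) (b q) (c q)
                                (a t) (b t) (c t))
  else 0.

End terms.

(* Main.v *)
Require Import Defs.
From mathcomp Require Import all_boot all_order all_algebra.
From mathcomp Require Import all_classical all_reals all_analysis.
From mathcomp Require Import measurable_realfun ring lra.
Import Order.TTheory GRing.Theory Num.Theory.
Import numFieldNormedType.Exports.
Local Open Scope classical_set_scope.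
Local Open Scope ring_scope.

Set Implicit Arguments.
Unset Strict Implicit.
Unset Printing Implicit Defensive.

(** Put g = (g1, g2, g3) and w_t = (a_t, b_t, c_t).  Slicing the cube one
    coordinate after the other, its volume cut by the three half-spaces is an
    n-fold integral, over unit segments in the directions w_1, ..., w_n, of the
    indicator of the positive octant of R^3.  So it is the alternating sum, over
    the vertices of the cube, of T(g(vertex)) for any T obtained from that
    indicator by integrating once along each w_t.

    Such a T can be written down when everything is in general position.  Add
    e1 = (1,0,0) and e2 = (0,1,0) to the w_t; for each pair {u, v} of these n+2
    vectors take the n-th power of the positive part of the height above the
    plane spanned by u and v, restricted to the cone spanned by u, v and the
    vertical line, multiply it by D^n / (n! |D|), where D = [wedge u v], and divide
    it by the product of the determinants of (u, v, t) over the other vectors t.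
    The sum of these pieces is [cone_spline].
    Differentiating it along w kills the pairs containing w, as their height is
    constant along w, and leaves the same expression for the other vectors
    [cone_spline_antiderivative].  What is not formal is that the sum has no jump
    along a line of direction w [cone_spline_continuous]: on the half-plane above
    a vector j all the pairs {u, j} have the same height, and the jump is a
    multiple of the homogeneous form of the identity
    sum_i x_i^k / prod_(t <> i) (x_i - x_t) = 0 [lagrange_sum0, jump_zero].  The
    fundamental theorem of calculus and Fubini then give [vol_slab].

    In the alternating sum over the vertices, the pair {e1, e2} gives the sum
    over F^0.  A pair {w_p, e2} gives the same value at the two ends of an edge
    of direction p unless g1 vanishes inside that edge, which leaves the first
    sum over F^1; the pairs {w_p, e1} leave the second one; and a pair {w_p, w_q}
    cancels over the four corners of a 2-face unless g1 and g2 vanish together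
    inside it, which leaves the sum over F^2 [alternating_sum_index].

    Good clipping is weaker than general position, and the rest is a limit.
    Lowering g3 by a positive constant turns good clipping into closed conditions
    [vertex_stable, edge_stable, face_stable], under which each contributing
    point survives a small perturbation with a nonzero denominator and, by
    compactness, no new one appears: the right-hand side is continuous there
    [index_sum_cvg].  The volume is continuous by dominated convergence, since
    hyperplanes are null [vol_cvg].  A perturbation along the moment curve reaches
    general position [tilt_generic, tilt_vertices], so the formula holds for the
    lowered g3 [stable_volume], and letting the constant tend to 0 gives it for
    g3 [clipped_volume]. *)

(** * The homogeneous Lagrange identity *)

Section lagrange.
Context {R : fieldType} {I : eqType}.
Variables (x : I -> R) (br : I -> I -> R).
Hypothesis brN : forall i j, br j i = - br i j.
Hypothesis plucker : forall i u v,
  x i * br u v + x u * br v i + x v * br i u = 0.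

Definition lagrange_sum (k : nat) (U : seq I) : R :=
  \sum_(i <- U) x i ^+ k / \prod_(t <- U | br i t != 0) br i t.

(** When br i j = x_i y_j - x_j y_i and all y_i are 1 this is the vanishing of the
    divided difference, at k+2 nodes, of a polynomial of degree k.  As there, the
    sum for k+1 is a combination of two sums for k, each omitting one of the
    first two indices; the three-term relation is all that this uses. *)
Lemma lagrange_sum0 k (U : seq I) : size U = k.+2 ->
  pairwise (fun i j => br i j != 0) U -> (forall i, br i i = 0) ->
  lagrange_sum k U = 0.
Proof.
move=> sU pU br0; elim: k U sU pU => [|k IH] [|u [|v U]]//= [sU].
  case: U sU => // _ /= /andP[/andP[uv _] _].
  rewrite /lagrange_sum !big_cons !big_nil !expr0 !br0 eqxx/= (brN u v) oppr_eq0.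
  by rewrite uv /= !mulr1 addr0 invrN mulrN mul1r subrr.
case/andP => /andP[uv aU] /andP[aV pU].
have e1 : lagrange_sum k (u :: U) = 0.
  by apply: IH; rewrite /= ?sU // aU.
have e2 : lagrange_sum k (v :: U) = 0.
  by apply: IH; rewrite /= ?sU // aV.
suff : br u v * lagrange_sum k.+1 [:: u, v & U] =
   x u * lagrange_sum k (u :: U) - x v * lagrange_sum k (v :: U).
  rewrite e1 e2 !mulr0 subr0 => /eqP; rewrite mulf_eq0 (negbTE uv) /=.
  by move/eqP.
rewrite /lagrange_sum !big_cons !br0 eqxx (brN u v) oppr_eq0 uv /=.
set pu := \prod_(j <- U | br u j != 0) _; set pv := \prod_(j <- U | br v j != 0) _.
have pu0 : pu != 0 by rewrite /pu; elim/big_rec: _ => [|? ? ? ?]; rewrite ?oner_neq0 ?mulf_neq0.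
have pv0 : pv != 0 by rewrite /pv; elim/big_rec: _ => [|? ? ? ?]; rewrite ?oner_neq0 ?mulf_neq0.
have -> : \sum_(i <- U) x i ^+ k.+1 / \prod_(t <- [:: u, v & U] | br i t != 0) br i t
  = (x u * (\sum_(i <- U) x i ^+ k / \prod_(t <- u :: U | br i t != 0) br i t)
   - x v * (\sum_(i <- U) x i ^+ k / \prod_(t <- v :: U | br i t != 0) br i t)) / br u v.
  rewrite !mulr_sumr -sumrB mulr_suml; apply: eq_big_seq => i iU.
  have ui : br u i != 0 by exact: (allP aU).
  have vi : br v i != 0 by exact: (allP aV).
  rewrite !big_cons (brN u i) (brN v i). rewrite !oppr_eq0 ui vi /=.
  set p := \prod_(j <- U | _) _.
  have p0 : p != 0 by rewrite /p; elim/big_rec: _ => [|? ? ? ?]; rewrite ?oner_neq0 ?mulf_neq0.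
  have := plucker i u v; rewrite (brN u i) exprS => pl.
  have {}pl : x i = (x u * br v i * -1 + x v * br u i) / br u v.
    apply: (mulIf uv); rewrite mulfVK //; apply/eqP; rewrite -subr_eq0 -pl; apply/eqP.
    ring.
  rewrite {1}pl; field.
  by rewrite ?oppr_eq0 ?p0 ?ui ?vi ?uv.
by rewrite !exprS; field; rewrite ?oppr_eq0 ?pu0 ?pv0 ?uv.
Qed.
End lagrange.

(** * An explicit iterated antiderivative in space *)

Section vectors.
Context {R : realFieldType}.

Definition vec := (R * R * R)%type.
Implicit Types (u v w p : vec) (W : seq vec).

Definition wedge u v : R := u.1.1 * v.1.2 - u.1.2 * v.1.1.
Definition tri u v w : R :=
  u.2 * wedge v w - v.2 * wedge u w + w.2 * wedge u v.
Definition translate p (s : R) w : vec :=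
  (p.1.1 + s * w.1.1, p.1.2 + s * w.1.2, p.2 + s * w.2).

(** If p = alpha u + beta v + h (0,0,1), this is (1 + sgn alpha)(1 + sgn beta),
    that is, four times the indicator of the cone alpha, beta > 0 away from its
    boundary.  Written with signs of wedges, it can be compared along a line for
    different pairs u, v. *)
Definition cone4 u v p : R :=
  1 + Num.sg (wedge u v) * (Num.sg (wedge p v) - Num.sg (wedge p u))
    - Num.sg (wedge p u) * Num.sg (wedge p v).

Definition tpow n (x : R) : R := if 0 <= x then x ^+ n else 0.

(** The coefficient of (0,0,1) in the decomposition of p along u, v, (0,0,1). *)
Definition height u v p : R := tri u v p / wedge u v.

(** For vectors in general position the condition on t excludes t = u and t = v
    only.  Division by 0 makes the weight of a pair of parallel vectors, such as
    u = v, vanish. *)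
Definition weight n W u v : R :=
  wedge u v ^+ n / (`|wedge u v| * \prod_(t <- W | tri u v t != 0) tri u v t).

(** The sum runs over ordered pairs, which counts each pair twice: with the factor
    4 of [cone4] this accounts for the 8. *)
Definition cone_spline n W p : R := (8 * n`!%:R)^-1 *
  \sum_(u <- W) \sum_(v <- W) cone4 u v p * (tpow n (height u v p) * weight n W u v).

Definition generic W := [/\ uniq W,
  {in W &, forall u v, u != v -> wedge u v != 0} &
  {in W & &, forall u v w, u != v -> u != w -> v != w -> tri u v w != 0}].

Lemma wedgeC u v : wedge v u = - wedge u v.
Proof. by rewrite /wedge; ring. Qed.
Lemma wedgexx u : wedge u u = 0.
Proof. by rewrite /wedge; ring. Qed.
Lemma wedge_translate p s w v : wedge (translate p s w) v = wedge p v + s * wedge w v.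
Proof. by rewrite /wedge /=; ring. Qed.
Lemma tri_translate u v p s w : tri u v (translate p s w) = tri u v p + s * tri u v w.
Proof. by rewrite /tri /wedge /=; ring. Qed.
Lemma triC u v w : tri v u w = - tri u v w.
Proof. by rewrite /tri /wedge; ring. Qed.
Lemma tri_C u v w : tri u w v = - tri u v w.
Proof. by rewrite /tri /wedge; ring. Qed.
Lemma tri_xyx u v : tri u v u = 0. Proof. by rewrite /tri /wedge; ring. Qed.
Lemma tri_xyy u v : tri u v v = 0. Proof. by rewrite /tri /wedge; ring. Qed.

Lemma height_xyx u v : height u v u = 0.
Proof. by rewrite /height tri_xyx mul0r. Qed.
Lemma height_xyy u v : height u v v = 0.
Proof. by rewrite /height tri_xyy mul0r. Qed.

Lemma generic_cons w W : generic (w :: W) -> generic W.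
Proof.
case=> /= /andP[_ uW] h2 h3; split => //.
  by move=> u v uW' vW'; apply: h2; rewrite inE ?uW' ?vW' orbT.
by move=> u v t uW' vW' tW'; apply: h3; rewrite inE ?uW' ?vW' ?tW' orbT.
Qed.

Lemma cone4C u v p : cone4 v u p = cone4 u v p.
Proof. by rewrite /cone4 (wedgeC u v) sgrN; ring. Qed.

Lemma heightC u v p : height v u p = height u v p.
Proof. by rewrite /height triC wedgeC invrN mulrNN. Qed.

Lemma height_translate u v p s w :
  height u v (translate p s w) = height u v p + s * height u v w.
Proof. by rewrite /height tri_translate mulrDl mulrA. Qed.

Lemma prod_tri_neq0 W u v : \prod_(t <- W | tri u v t != 0) tri u v t != 0.
Proof. by rewrite prodf_seq_neq0; apply/allP => t _; apply/implyP. Qed.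

(** There are exactly n factors, because u and v are the two entries left out. *)
Lemma prod_tri_count n W u v : generic W -> size W = n.+2 ->
  u \in W -> v \in W -> u != v ->
  \prod_(t <- W | tri u v t != 0) tri v u t =
  (-1) ^+ n * \prod_(t <- W | tri u v t != 0) tri u v t.
Proof.
move=> [uW g2 g3] sW uIW vIW uv.
have -> : (-1 : R) ^+ n = \prod_(t <- W | tri u v t != 0) (-1).
  rewrite -big_filter big_const_seq count_predT iter_mulr_1; congr (_ ^+ _).
  have -> : [seq t <- W | tri u v t != 0] = [seq t <- W | t \notin [:: u; v]].
    apply: eq_in_filter => t tW; rewrite !inE negb_or.
    have [->|tu] := eqVneq t u; first by rewrite tri_xyx eqxx.
    have [->|tv] := eqVneq t v; first by rewrite tri_xyy eqxx.
    by rewrite g3 // eq_sym.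
  have := count_predC (mem [:: u; v]) W; rewrite sW.
  rewrite size_filter.
  have -> : count (mem [:: u; v]) W = 2.
    rewrite -size_filter; have : perm_eq [seq t <- W | t \in [:: u; v]] [:: u; v].
      apply: uniq_perm; [exact: filter_uniq|by rewrite /= inE uv|].
      move=> t; rewrite mem_filter; apply: andb_idr.
      by rewrite !inE => /orP[]/eqP->.
    by move/perm_size.
  by rewrite add2n => -[].
rewrite -big_split /=; apply: eq_bigr => t _.
by rewrite triC; ring.
Qed.

Lemma weightC n W u v : generic W -> size W = n.+2 -> u \in W -> v \in W ->
  weight n W v u = weight n W u v.
Proof.
move=> g sW uW vW; have [->//|uv] := eqVneq u v.
rewrite /weight (wedgeC u v) normrN.
rewrite (eq_bigl (fun t => tri u v t != 0)); last by move=> t; rewrite triC oppr_eq0.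
rewrite exprNn (prod_tri_count g sW) //.
have : wedge u v != 0 by case: g => _ g2 _; exact: g2.
rewrite -normr_eq0; set d := `|_|; set P := (\prod_(_ <- _ | _) _) => d0.
have P0 : P != 0 by exact: prod_tri_neq0.
have := signr_eq0 R n; set e := (-1) ^+ n => /negbT e0.
by field; rewrite d0 P0 e0.
Qed.

Lemma wedge_plucker j i u v : wedge i j * tri u j v + wedge u j * tri v j i + wedge v j * tri i j u = 0.
Proof. by rewrite /tri /wedge; ring. Qed.

Lemma tri_cross u v j p :
  tri u j p * wedge v j - tri v j p * wedge u j = tri u v j * wedge j p.
Proof. by rewrite /tri /wedge; ring. Qed.

Lemma height_eq u v j p : wedge p j = 0 -> wedge u j != 0 -> wedge v j != 0 ->
  height u j p = height v j p.
Proof.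
move=> pj uj vj; apply/eqP; rewrite /height eqr_div // -subr_eq0 tri_cross.
by rewrite wedgeC pj oppr0 mulr0.
Qed.

(** The jump of the antiderivative across the half-plane above j.  There all the
    heights are equal, and D^(n+1) / |D| times the sign of D is D^n, so that the
    sum is a Lagrange sum with x_u = wedge u j and br u t = tri u j t. *)
Lemma jump_zero n W p j : generic W -> size W = n.+3 -> j \in W ->
  wedge p j = 0 ->
  \sum_(u <- W) Num.sg (wedge u j) * (tpow n.+1 (height u j p) * weight n.+1 W u j) = 0.
Proof.
move=> g sW jW pj; have [uW g2 g3] := g.
have pW := perm_to_rem jW; set U := rem j W in pW.
have sU : size U = n.+2 by rewrite /U size_rem // sW.
have jU : j \notin U by rewrite mem_rem_uniqF.
have UW : {subset U <= W} by exact: mem_rem.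
have wU u : u \in U -> wedge u j != 0.
  by move=> uU; apply: g2 => //; [exact: UW|apply: contraNneq jU => <-].
rewrite (perm_big _ pW) big_cons /= {1}wedgexx sgr0 mul0r add0r.
have [u0 u0U] : exists u0, u0 \in U.
  by exists (nth j U 0); rewrite mem_nth // sU.
transitivity (\sum_(u <- U) tpow n.+1 (height u0 j p) *
    (wedge u j ^+ n / \prod_(t <- U | tri u j t != 0) tri u j t)).
  apply: eq_big_seq => u uU; rewrite (height_eq pj (wU _ uU) (wU _ u0U)).
  rewrite mulrCA; congr (_ * _); rewrite /weight (perm_big _ pW) big_cons tri_xyy eqxx /=.
  have w0 := wU _ uU; rewrite normrEsg exprS.
  have : Num.sg (wedge u j) != 0 by rewrite sgr_eq0.
  move: (prod_tri_neq0 U u j); set P := (\prod_(_ <- _ | _) _) => P0 s0.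
  by field; rewrite w0 s0 P0.
rewrite -mulr_sumr.
have := @lagrange_sum0 R vec (wedge^~ j) (fun u t => tri u j t) _ _ n U sU.
rewrite /lagrange_sum => ->; first by rewrite mulr0.
- by move=> u t; rewrite /tri /wedge; ring.
- by move=> i u v; exact: wedge_plucker.
- have uU : uniq U by exact: rem_uniq.
  apply/(pairwiseP j) => i k; rewrite !inE => iU kU ik.
  have e : nth j U i != nth j U k by rewrite nth_uniq // ltn_eqF.
  apply: g3; rewrite ?jW ?e ?UW ?mem_nth //.
    by apply: contraNneq jU => <-; rewrite mem_nth.
  by apply: contraNneq jU => ->; rewrite mem_nth.
- by move=> i; rewrite tri_xyx.
Qed.

Lemma sgr_zero_sum (a b c : R) : a + b + c = 0 -> a != 0 ->
  Num.sg a * Num.sg b + Num.sg b * Num.sg c + Num.sg a * Num.sg c = -1.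
Proof.
by move=> h a0; case: (sgrP a) a0; case: (sgrP b); case: (sgrP c); rewrite ?eqxx => // *; lra.
Qed.

(** Along a line of direction w0 the number wedge p w0 is constant.  If it is not
    zero, the three products of the linear relation between the wedges are not
    all zero, and [sgr_zero_sum] trades the product of the signs of wedge p u and
    wedge p v for a combination of these two signs.  A discontinuity is then
    attached to one vector at a time, as [jump_zero] requires. *)
Lemma cone4_line w0 u v p : wedge p w0 != 0 -> wedge u v != 0 ->
  let e x := Num.sg (wedge w0 x) in let s x := Num.sg (wedge p x) in
  let k x := 1 - s w0 * e x in
  cone4 u v p = 1 - e u * e v + Num.sg (wedge u v) * (k v * s v - k u * s u).
Proof.
move=> pw uv e s k.
(* The Grassmann relation between four vectors of the plane. *)
have key : wedge p w0 * wedge u v + wedge p u * wedge v w0 + wedge p v * wedge w0 u = 0.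
  by rewrite /wedge; ring.
have {key} := sgr_zero_sum key (mulf_neq0 pw uv).
rewrite !sgrM (wedgeC w0 v) sgrN -/(e u) -/(e v) -/(s u) -/(s v) -/(s w0).
rewrite /cone4 -/(s u) -/(s v) => h.
have ss : s w0 * s w0 = 1 by rewrite /s -sgrM sgr_gt0 || (rewrite -expr2 sqr_sg pw).
have dd : Num.sg (wedge u v) * Num.sg (wedge u v) = 1.
  by rewrite -expr2 sqr_sg uv.
rewrite /k; set d := Num.sg (wedge u v) in h dd *.
have sq x : e x = 0 \/ e x * e x = 1.
  have [x0|x0] := eqVneq (wedge w0 x) 0; first by left; rewrite /e x0 sgr0.
  by right; rewrite -expr2 sqr_sg x0.
have sqs x : s x = 0 \/ s x * s x = 1.
  rewrite /s; have [->|x0] := eqVneq (wedge p x) 0; first by left; rewrite sgr0.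
  by right; rewrite -expr2 sqr_sg x0.
have [eu|eu] := sq u; have [ev|ev] := sq v.
- by move: h; rewrite eu ev; lra.
- have h' : s w0 * d * s u * e v = 1.
    by have := h; rewrite eu; lra.
  have [su|su] := sqs u; first by move: h'; rewrite su; lra.
  have hu : s u = s w0 * d * e v.
    by rewrite -[LHS]mul1r -h' -[RHS]mul1r -su; ring.
  rewrite eu {2}hu.
  have -> : s w0 * d * e v * s v = d * (s w0 * e v) * s v by ring.
  by ring.
- have h' : - (s w0 * d * s v * e u) = 1.
    by have := h; rewrite ev; lra.
  have [sv|sv] := sqs v; first by move: h'; rewrite sv; lra.
  have hv : s v = - (s w0 * d * e u).
    by rewrite -[LHS]mul1r -h' -[RHS]mul1r -sv; ring.
  by rewrite ev {2}hv; ring.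
have -> : s u * s v = e u * e v + s w0 * d * (s v * e v - s u * e u); last by ring.
transitivity ((e u * e u) * (e v * e v) * (s u * s v)); first by rewrite eu ev; ring.
transitivity (e u * e v * 1 + s w0 * d * (s v * e v * (e u * e u) - s u * e u * (e v * e v))).
  by rewrite -[1]opprK -h; ring.
by rewrite eu ev; ring.
Qed.
End vectors.

(** * Continuous piecewise polynomials on a line *)

Section piecewise.
Context {R : realType}.
Implicit Types (f l M F : R -> R) (B : seq R).

Lemma continuous_sgM l M : continuous l -> continuous M ->
  (forall s, l s = 0 -> M s = 0) -> continuous (fun s => Num.sg (l s) * M s : R).
Proof.
move=> cl cM lM s; have [ls0|ls0] := eqVneq (l s) 0.
  rewrite /prop_for /continuous_at (lM _ ls0) mulr0; apply/cvgr0Pnorm_lt => e e0.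
  have : M x @[x --> s] --> (0 : R) by rewrite -(lM s ls0); exact: cM.
  move/cvgr0Pnorm_lt => /(_ e e0); apply: filterS => x; apply: le_lt_trans.
  rewrite normrM ler_piMl // normr_sg; by case: (_ != 0); rewrite ?ler01.
apply: (@cvg_trans _ (Num.sg (l s) * M x @[x --> s])); last first.
  exact: (cvgM (cvg_cst (Num.sg (l s))) (cM s)).
apply: near_eq_cvg.
have : \forall x \near s, 0 < l s * l x.
  have : l s * l x @[x --> s] --> l s * l s by exact: (cvgM (cvg_cst (l s)) (cl s)).
  by move/cvgr_gt; apply; rewrite -expr2 exprn_even_gt0.
apply: filterS => x; case: (ltgtP (l s) 0) ls0 => // h _.
- by rewrite nmulr_rgt0 // => h'; rewrite (ltr0_sg h) (ltr0_sg h').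
- by rewrite pmulr_rgt0 // => h'; rewrite (gtr0_sg h) (gtr0_sg h').
Qed.

Lemma continuous_tpow n : continuous (tpow n.+1 : R -> R).
Proof.
have -> : tpow n.+1 = (fun x : R => (Num.max x 0) ^+ n.+1).
  by apply/funext => x; rewrite /tpow; case: leP => // h; rewrite expr0n.
move=> x; apply: (@continuous_comp _ _ _ (fun y : R => Num.max y 0) (fun y => y ^+ n.+1)).
  by apply: (@continuous_max R R id (cst 0)); [exact: cvg_id|exact: cvg_cst].
exact: exprn_continuous.
Qed.

Lemma continuous_affine (u v : R) : continuous (fun s : R => u + s * v).
Proof.
move=> s; apply: cvgD; first exact: cvg_cst.
by apply: cvgM; [exact: cvg_id|exact: cvg_cst].
Qed.

(** Nothing is asked at the points of B: these are the break points, where f may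
    jump and where the continuity of F is established separately. *)
Definition piecewise_antiderivative B f F := forall a b, a < b ->
  (forall s, a < s < b -> s \notin B) ->
  exists P : {poly R}, forall s, a < s < b -> F s = P.[s] /\ f s = P^`().[s].

Lemma piecewise_subset B B' f F : {subset B <= B'} -> piecewise_antiderivative B f F ->
  piecewise_antiderivative B' f F.
Proof.
move=> BB h a b ab nB; apply: h => // s /nB; apply: contra; exact: BB.
Qed.

Lemma piecewiseB B f F g G : piecewise_antiderivative B f F ->
  piecewise_antiderivative B g G ->
  piecewise_antiderivative B (fun s => f s - g s) (fun s => F s - G s).
Proof.
move=> h1 h2 a b ab nB; have [P hP] := h1 a b ab nB; have [Q hQ] := h2 a b ab nB.
exists (P - Q) => s sab; have [-> ->] := hP s sab; have [-> ->] := hQ s sab.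
by rewrite derivB !hornerE.
Qed.

Lemma piecewise_sum (I : eqType) (r : seq I) B (f F : I -> R -> R) :
  (forall i, i \in r -> piecewise_antiderivative B (f i) (F i)) ->
  piecewise_antiderivative B (fun s => \sum_(i <- r) f i s) (fun s => \sum_(i <- r) F i s).
Proof.
move=> h a b ab nB.
have h' i : exists P : {poly R}, i \in r -> forall s, a < s < b -> F i s = P.[s] /\ f i s = P^`().[s].
  have [ir|ir] := boolP (i \in r); last by exists 0.
  by have [P hP] := h i ir a b ab nB; exists P.
have [P hP] := choice h'.
exists (\sum_(i <- r) P i) => s sab; rewrite raddf_sum /= !horner_sum.
by split; apply: eq_big_seq => i ir; have [] := hP i ir s sab.
Qed.

Lemma piecewiseZ B f F k : piecewise_antiderivative B f F ->
  piecewise_antiderivative B (fun s => k * f s) (fun s => k * F s).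
Proof.
move=> h a b ab nB; have [P hP] := h a b ab nB.
by exists (k *: P) => s sab; have [-> ->] := hP s sab; rewrite derivZ !hornerE.
Qed.

Lemma itv_sign a b (u v : R) : a < b ->
  (forall s, a < s < b -> u + s * v != 0) ->
  forall s t, a < s < b -> a < t < b -> 0 < (u + s * v) * (u + t * v).
Proof.
move=> ab n0 s t sab tab; rewrite lt_def; apply/andP; split.
  by rewrite mulf_neq0 // n0.
rewrite leNgt; apply/negP => neg.
have v0 : v != 0.
  by apply/eqP => v0; move: neg; rewrite v0 !mulr0 addr0 -expr2 ltNge sqr_ge0.
have z : u + (- u / v) * v = 0 by rewrite divfK // subrr.
suff : a < - u / v < b by move/n0; rewrite z eqxx.
set c := - u / v in z *.
have e x : u + x * v = (x - c) * v.
  by rewrite mulrBl -[in RHS](addr0 (x * v)) -[0]z; ring.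
move: neg; rewrite !e => neg.
have {}neg : (s - c) * (t - c) < 0.
  have : (s - c) * (t - c) * v ^+ 2 < 0 by move: neg; rewrite expr2; congr (_ < _); ring.
  by rewrite pmulr_llt0 // exprn_even_gt0.
by nra.
Qed.

Lemma itv_sg a b (u v : R) B : a < b ->
  (v != 0 -> - u / v \in B) -> (forall s, a < s < b -> s \notin B) ->
  forall s t, a < s < b -> a < t < b -> Num.sg (u + s * v) = Num.sg (u + t * v).
Proof.
move=> ab uvB nB s t sab tab; have [->|v0] := eqVneq v 0; first by rewrite !mulr0.
have : 0 < (u + s * v) * (u + t * v).
  apply: itv_sign sab tab => // x xab; apply: contraNneq (nB x xab) => e.
  suff -> : x = - u / v by exact: uvB.
  by apply: (mulIf v0); rewrite divfK //; lra.
case: (sgrP (u + s * v)); case: (sgrP (u + t * v)) => // h1 h2; rewrite ?h1 ?h2; nra.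
Qed.

Lemma piecewise_tpow n B (Q : R -> R) (h h0 k : R) :
  (forall a b, a < b -> (forall s, a < s < b -> s \notin B) ->
    forall s t, a < s < b -> a < t < b -> Q s = Q t) ->
  (h0 != 0 -> - h / h0 \in B) ->
  piecewise_antiderivative B
    (fun s => Q s * (n.+1%:R * tpow n (h + s * h0) * h0 * k))
    (fun s => Q s * (tpow n.+1 (h + s * h0) * k)).
Proof.
move=> Qc hB a b ab nB; pose m := (a + b) / 2.
have mab : a < m < b by rewrite /m; apply/andP; split; lra.
have [hm|hm] := leP 0 (h + m * h0); last first.
  exists 0 => s sab; rewrite deriv0 !horner0.
  have : h + s * h0 < 0 by rewrite -sgr_lt0 (itv_sg ab hB nB sab mab) sgr_lt0.
  by rewrite /tpow ltNge => /negbTE ->; rewrite !(mulr0, mul0r).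
exists ((Q m * k) *: (polyC h + h0 *: 'X) ^+ n.+1) => s sab.
have hs : 0 <= h + s * h0 by rewrite -sgr_ge0 (itv_sg ab hB nB sab mab) sgr_ge0.
rewrite (Qc a b ab nB s m sab mab) /tpow hs derivZ deriv_exp derivD derivC derivZ derivX.
rewrite !hornerE /= hornerMn !hornerE /= -mulr_natl.
by split; rewrite (mulrC h0 s); ring.
Qed.
End piecewise.

(** * The antiderivative along a line *)

Section along_a_line.
Context {R : realType}.
Implicit Types (u v w p : @vec R) (W : seq (@vec R)).

(** The parameters at which the line from p in direction w meets the plane above a
    vector, or a plane spanned by two vectors: elsewhere no sign and no positive
    part changes. *)
Definition breaks W w p : seq R := [seq - wedge p v / wedge w v | v <- W] ++
  [seq - height u v p / height u v w | u <- W, v <- W].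

(** Differentiating along w multiplies the term of {u, v} by height u v w, whose
    numerator is the factor of t = w in the product. *)
Lemma weight_cons n W w u v : generic (w :: W) -> u \in W -> v \in W ->
  height u v w * weight n.+1 (w :: W) u v = weight n W u v.
Proof.
move=> [/= /andP[wW _] g2 g3] uW vW; have [->|uv] := eqVneq u v.
  by rewrite /height /weight wedgexx normr0 invr0 mulr0 !mul0r invr0 mulr0.
have uw : u != w by apply: contraNneq wW => <-.
have vw : v != w by apply: contraNneq wW => <-.
have t0 : tri u v w != 0 by apply: g3; rewrite ?inE ?uW ?vW ?eqxx ?orbT.
have w0 : wedge u v != 0 by apply: g2; rewrite ?inE ?uW ?vW ?orbT.
have := w0; rewrite -normr_eq0.
rewrite /height /weight big_cons t0 exprS.
have := prod_tri_neq0 W u v; move: (\prod_(t <- W | _) _) => P P0.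
by move: `|_| => d d0; field; rewrite P0 d0 w0 t0.
Qed.

(** The pairs containing w have constant height along w, hence zero derivative; the
    other ones are handled by [weight_cons]. *)
Lemma cone_spline_antiderivative n W w p : generic (w :: W) ->
  piecewise_antiderivative (breaks W w p)
    (fun s => cone_spline n W (translate p s w)) (fun s => cone_spline n.+1 (w :: W) (translate p s w)).
Proof.
move=> g; pose V := w :: W.
have -> : (fun s => cone_spline n W (translate p s w)) = (fun s => (8 * n.+1`!%:R)^-1 *
   \sum_(u <- V) \sum_(v <- V) cone4 u v (translate p s w) *
     (n.+1%:R * tpow n (height u v p + s * height u v w) * height u v w * weight n.+1 V u v)).
  apply/funext => s; rewrite /V big_cons big1_seq ?add0r; last first.
    by move=> v _; rewrite height_xyx !(mulr0, mul0r).
  have -> : (8 * n.+1`!%:R)^-1 = (8 * n`!%:R)^-1 * n.+1%:R^-1 :> R.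
    by rewrite factS natrM !invfM; ring.
  rewrite -mulrA; congr (_ * _); rewrite mulr_sumr; apply: eq_big_seq => u uW.
  rewrite big_cons height_xyy !(mulr0, mul0r) add0r mulr_sumr.
  apply: eq_big_seq => v vW; rewrite -height_translate -(weight_cons n g uW vW).
  have : n.+1%:R != 0 :> R by rewrite pnatr_eq0.
  by move: (n.+1%:R : R) => N N0; field.
have -> : (fun s => cone_spline n.+1 V (translate p s w)) = (fun s => (8 * n.+1`!%:R)^-1 *
   \sum_(u <- V) \sum_(v <- V) cone4 u v (translate p s w) *
     (tpow n.+1 (height u v p + s * height u v w) * weight n.+1 V u v)).
  apply/funext => s; congr (_ * _); apply: eq_bigr => u _; apply: eq_bigr => v _.
  by rewrite height_translate.
have sgc a b : a < b -> (forall s, a < s < b -> s \notin breaks W w p) ->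
    forall v, v \in V -> forall s t, a < s < b -> a < t < b ->
    Num.sg (wedge (translate p s w) v) = Num.sg (wedge (translate p t w) v).
  move=> ab nB v vV s t sab tab; rewrite !wedge_translate.
  apply: (itv_sg (B := breaks W w p)) ab _ nB _ _ sab tab => wv.
  rewrite /breaks mem_cat; apply/orP; left; apply/mapP; exists v => //.
  by move: vV wv; rewrite inE => /predU1P[->|//]; rewrite wedgexx eqxx.
apply: piecewiseZ; apply: piecewise_sum => u uV; apply: piecewise_sum => v vV; apply: piecewise_tpow.
  by move=> a b ab nB s t sab tab; rewrite /cone4 (sgc a b ab nB _ uV _ _ sab tab) (sgc a b ab nB _ vV _ _ sab tab).
move=> h0; rewrite mem_cat; apply/orP; right; apply/allpairsP; exists (u, v) => /=.
move: uV vV h0; rewrite !inE => /predU1P[->|->]; first by rewrite height_xyx eqxx.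
by move=> /predU1P[->|->] //; rewrite height_xyy eqxx.
Qed.

(** By [cone4_line], the sum is a continuous part plus, for each v, the sign of
    wedge p v times a continuous function that vanishes with it by [jump_zero]. *)
Lemma cone_spline_continuous n W w p : generic (w :: W) -> size W = n.+2 ->
  wedge p w != 0 -> continuous (fun s => cone_spline n.+1 (w :: W) (translate p s w) : R).
Proof.
move=> g sW pw; pose V := w :: W.
pose K u v s := tpow n.+1 (height u v (translate p s w)) * weight n.+1 V u v.
pose e u := Num.sg (wedge w u); pose k u := 1 - Num.sg (wedge p w) * e u.
pose M v s := \sum_(u <- V) Num.sg (wedge u v) * K u v s.
have -> : (fun s => cone_spline n.+1 V (translate p s w)) = (fun s => (8 * n.+1`!%:R)^-1 *
  ((\sum_(u <- V) \sum_(v <- V) (1 - e u * e v) * K u v s) +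
   (\sum_(v <- V) (2 * k v) * (Num.sg (wedge (translate p s w) v) * M v s)))).
  apply/funext => s; congr (_ * _).
  pose S u := Num.sg (wedge (translate p s w) u).
  have S0 : S w = Num.sg (wedge p w) by rewrite /S wedge_translate wedgexx mulr0 addr0.
  transitivity ((\sum_(u <- V) \sum_(v <- V) (1 - e u * e v) * K u v s) +
     ((\sum_(u <- V) \sum_(v <- V) k v * S v * (Num.sg (wedge u v) * K u v s)) -
     (\sum_(u <- V) \sum_(v <- V) k u * S u * (Num.sg (wedge u v) * K u v s)))).
    rewrite -sumrB -big_split /=; apply: eq_bigr => u _.
    rewrite -sumrB -big_split /=; apply: eq_bigr => v _.
    rewrite -/(K u v s); have [uv|uv] := eqVneq (wedge u v) 0.
      have -> : K u v s = 0 by rewrite /K /weight uv exprS !mul0r mulr0.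
      by rewrite !(mulr0, subr0, addr0).
    rewrite (@cone4_line _ w) //; last by rewrite wedge_translate wedgexx mulr0 addr0.
    by rewrite -/(S w) S0 -/(S u) -/(S v) -/(e u) -/(e v) -/(k u) -/(k v); ring.
  congr (_ + _).
  have -> : \sum_(u <- V) \sum_(v <- V) k u * S u * (Num.sg (wedge u v) * K u v s) =
     - \sum_(u <- V) \sum_(v <- V) k v * S v * (Num.sg (wedge u v) * K u v s).
    rewrite exchange_big /= -sumrN; apply: eq_big_seq => u uV; rewrite -sumrN.
    apply: eq_big_seq => v vV; rewrite (wedgeC u v) sgrN.
    have -> : K v u s = K u v s.
      by rewrite /K heightC (weightC g) //= sW.
    by ring.
  rewrite opprK -mulr2n exchange_big /= -sumrMnl; apply: eq_bigr => v _.
  by rewrite -mulr_sumr -/(M v s) -/(S v); ring.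
have ch u v : continuous (fun s => height u v (translate p s w)).
  rewrite (_ : (fun s => _) = (fun s => height u v p + s * height u v w)).
    exact: continuous_affine.
  by apply/funext => s; rewrite height_translate.
have cw v : continuous (fun s => wedge (translate p s w) v).
  rewrite (_ : (fun s => _) = (fun s => wedge p v + s * wedge w v)).
    exact: continuous_affine.
  by apply/funext => s; rewrite wedge_translate.
have cK u v : continuous (K u v).
  move=> s; apply: cvgM; last exact: cvg_cst.
  apply: (@continuous_comp _ _ _ (fun s => height u v (translate p s w)) (tpow n.+1)); last exact: continuous_tpow.
  exact: ch.
have cD : continuous (fun x : R * R => x.1 + x.2) by exact: add_continuous.
have cM v : continuous (M v).
  apply: continuous_big => // u _ s; apply: cvgM; first exact: cvg_cst.
  exact: cK.
move=> s; apply: cvgM; first exact: cvg_cst.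
apply: cvgD.
  apply: continuous_big => // u _; apply: continuous_big => // v _ t.
  by apply: cvgM; [exact: cvg_cst|exact: cK].
rewrite big_seq; under eq_fun do rewrite big_seq.
apply: (@continuous_big _ _ _ _ (fun v => v \in V)) => // v vV t; apply: cvgM; first exact: cvg_cst.
apply: (continuous_sgM (cw v) (cM v)) => x px.
 apply: jump_zero => //=; by rewrite sW.
Qed.
End along_a_line.

(** * Integration of continuous piecewise polynomials *)

Section ftc.
Context {R : realType}.
Let mu := (@lebesgue_measure R).

Lemma continuous_ext_right (F G : R -> R) a b : a < b -> continuous F -> continuous G ->
  (forall s, a < s < b -> F s = G s) -> F a = G a.
Proof.
move=> ab cF cG FG.
apply: (@cvg_unique _ _ (F x @[x --> a^'+])) => //.
  exact: (cvg_at_right_filter (cF a)).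
apply: cvg_trans (cvg_at_right_filter (cG a)).
apply: near_eq_cvg; near=> x; rewrite FG //; apply/andP; split; near: x.
  exact: nbhs_right_gt.
exact: nbhs_right_lt.
Unshelve. all: by end_near. Qed.

Lemma continuous_ext_left (F G : R -> R) a b : a < b -> continuous F -> continuous G ->
  (forall s, a < s < b -> F s = G s) -> F b = G b.
Proof.
move=> ab cF cG FG.
apply: (@cvg_unique _ _ (F x @[x --> b^'-])) => //.
  exact: (cvg_at_left_filter (cF b)).
apply: cvg_trans (cvg_at_left_filter (cG b)).
apply: near_eq_cvg; near=> x; rewrite FG //; apply/andP; split; near: x.
  exact: nbhs_left_gt.
exact: nbhs_left_lt.
Unshelve. all: by end_near. Qed.

(** The break points inside the interval are removed one by one; on an interval
    without break points F is a polynomial up to its ends, by continuity. *)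
Lemma integral_piecewise (g : measurableTypeR R -> \bar R) (f F : R -> R) (B : seq R) :
  measurable_fun setT g -> (forall s, 0 <= g s)%E -> continuous F ->
  piecewise_antiderivative B f F ->
  forall a b, a <= b -> (forall s, a < s < b -> s \notin B -> g s = (f s)%:E) ->
  (\int[mu]_(s in `[a, b]) g s = (F b - F a)%:E)%E.
Proof.
move=> mg g0 cF pF a b ab gf.
suff H (C : seq R) : forall a b, a <= b ->
    (forall s, a < s < b -> s \notin B -> g s = (f s)%:E) ->
    (forall s, a < s < b -> s \in B -> s \in C) ->
  (\int[mu]_(s in `[a, b]) g s = (F b - F a)%:E)%E by exact: (H B).
elim: C => [|c C IH] {}a {}b {}ab {}gf BC.
  move: ab; rewrite le_eqVlt => /predU1P[<-|ab].
    by rewrite set_itv1 integral_set1 subrr.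
  have nB s : a < s < b -> s \notin B by move=> sab; apply/negP => /(BC s sab).
  have [P hP] := pF a b ab nB.
  rewrite (@integral_itv_bndoo _ a b g); last exact: measurable_funS mg.
  transitivity (\int[mu]_(s in `]a, b[) (P^`().[s])%:E)%E.
    apply: eq_integral => s; rewrite inE /= in_itv /= => sab.
    by rewrite gf ?nB //; have [_ ->] := hP s sab.
  rewrite -(@integral_itv_bndoo _ a b _ true false); last first.
    apply/measurable_EFinP; apply: measurable_funTS; apply: continuous_measurable_fun.
    exact: continuous_horner.
  rewrite (@continuous_FTC2 _ _ (horner P)) //.
  - rewrite (@continuous_ext_right F (horner P) a b) //; last 2 first.
      exact: continuous_horner.
      by move=> s /hP[].
    rewrite (@continuous_ext_left F (horner P) a b) //.
      exact: continuous_horner.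
    by move=> s /hP[].
  - by apply: continuous_subspaceT; exact: continuous_horner.
  - split => [s _||]; first exact: derivable_horner.
      by apply: cvg_at_right_filter; exact: continuous_horner.
    by apply: cvg_at_left_filter; exact: continuous_horner.
  - by move=> s _; rewrite -derivE.
have [cab|cab] := boolP (a < c < b); last first.
  apply: IH => // s sab /(BC s sab); rewrite inE => /predU1P[e|//].
  by rewrite -e sab in cab.
have /andP[ac cb] := cab.
rewrite (@itv_bndbnd_setU _ _ _ (BLeft c)) ?bnd_simp ?ltW //.
rewrite ge0_integral_setU //=; last 2 first.
- exact: measurable_funTS.
- apply/disj_setPS => s /=; rewrite !in_itv /= => -[/andP[_ sc] /andP[cs _]].
  by move: (lt_le_trans sc cs); rewrite ltxx.
rewrite integral_itv_bndo_bndc; last exact: measurable_funTS.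
rewrite (IH a c (ltW ac)) ?(IH c b (ltW cb)).
- by rewrite -EFinD; congr EFin; ring.
- by move=> s /andP[h1 h2]; apply: gf; rewrite (lt_trans ac h1).
- move=> s /andP[h1 h2] sB; have := BC s; rewrite (lt_trans ac h1) h2 inE => /(_ isT sB).
  by rewrite (gt_eqF h1).
- by move=> s /andP[h1 h2]; apply: gf; rewrite h1 (lt_trans h2).
- move=> s /andP[h1 h2] sB; have := BC s; rewrite h1 (lt_trans h2 cb) inE => /(_ isT sB).
  by rewrite (lt_eqF h2).
Qed.
End ftc.

(** * Alternating sums over the corners of a parallelotope *)

Section vertices.
Context {R : realType}.
Implicit Types (u v w p : @vec R) (W : seq (@vec R)) (f : @vec R -> R).

(** The sum of f over p + sum of the vectors of a subsequence of W, with sign -1 for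
    each omitted vector: this is what integrating once along each vector of W
    makes of an iterated antiderivative. *)
Fixpoint alternate W f p : R :=
  if W is w :: W' then alternate W' f (translate p 1 w) - alternate W' f p else f p.

Fixpoint corners W p : seq vec :=
  if W is w :: W' then corners W' (translate p 1 w) ++ corners W' p else [:: p].

Lemma translate_comm p s u t v : translate (translate p s u) t v = translate (translate p t v) s u.
Proof. by rewrite /translate /=; congr (_, _, _); ring. Qed.

Lemma corners_translate W p s w : corners W (translate p s w) = [seq translate q s w | q <- corners W p].
Proof.
elim: W p => [|u W IH] p //=.
by rewrite map_cat -!IH translate_comm.
Qed.

Lemma alternate_piecewise W p w B (f F : vec -> R) :
  (forall q, q \in corners W p ->
    piecewise_antiderivative B (fun s => f (translate q s w)) (fun s => F (translate q s w))) ->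
  piecewise_antiderivative B (fun s => alternate W f (translate p s w)) (fun s => alternate W F (translate p s w)).
Proof.
elim: W p => [|u W IH] p /= h; first by apply: h; rewrite inE.
have e g : (fun s => alternate W g (translate (translate p s w) 1 u) - alternate W g (translate p s w)) =
       (fun s => alternate W g (translate (translate p 1 u) s w) - alternate W g (translate p s w)).
  by apply/funext => s; rewrite translate_comm.
rewrite !e; apply: piecewiseB; apply: IH => q qW; apply: h; rewrite mem_cat qW ?orbT //.
Qed.

Lemma alternate_continuous W p w (F : vec -> R) :
  (forall q, q \in corners W p -> continuous (fun s => F (translate q s w) : R)) ->
  continuous (fun s => alternate W F (translate p s w) : R).
Proof.
elim: W p => [|u W IH] p /= h; first by apply: h; rewrite inE.
rewrite (_ : (fun s => _) =
       (fun s => alternate W F (translate (translate p 1 u) s w) - alternate W F (translate p s w))).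
  move=> s; apply: cvgB; apply: IH => q qW; apply: h; rewrite mem_cat qW ?orbT //.
by apply/funext => s; rewrite translate_comm.
Qed.

Fixpoint push p W (x : seq R) : vec :=
  if W is w :: W' then if x is s :: x' then push (translate p s w) W' x' else p else p.

Definition octant p := [/\ 0 <= p.1.1, 0 <= p.1.2 & 0 <= p.2].

Definition e1 : vec := (1, 0, 0) : R * R * R.
Definition e2 : vec := (0, 1, 0) : R * R * R.

(** The antiderivatives start from the indicator of the octant, off its vertical faces. *)
Lemma cone_spline0 p : wedge p e1 != 0 -> wedge p e2 != 0 ->
  cone_spline 0 [:: e1; e2] p = if (0 <= p.1.1) && (0 <= p.1.2) && (0 <= p.2) then 1 else 0.
Proof.
case: p => [[x y] z]; rewrite /cone_spline !big_cons !big_nil.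
have w11 : weight 0 [:: e1; e2] e1 e1 = 0 by rewrite /weight wedgexx normr0 mul0r invr0 mulr0.
have w22 : weight 0 [:: e1; e2] e2 e2 = 0 by rewrite /weight wedgexx normr0 mul0r invr0 mulr0.
have D : wedge e1 e2 = 1 by rewrite /wedge /=; ring.
have w12 : weight 0 [:: e1; e2] e1 e2 = 1.
  by rewrite /weight D !big_cons big_nil tri_xyx tri_xyy eqxx /= expr0 normr1 mulr1 invr1 mulr1.
have w21 : weight 0 [:: e1; e2] e2 e1 = 1.
  by rewrite /weight wedgeC D !big_cons big_nil tri_xyx tri_xyy eqxx /= expr0 normrN1 mulr1 invr1 mulr1.
rewrite w11 w22 w12 w21 !(cone4C e1 e2) !(heightC e1 e2) !(mulr0, addr0, add0r, mulr1).
have -> : height e1 e2 (x, y, z) = z by rewrite /height D /tri /wedge /=; field.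
rewrite /cone4 D sgr1 mul1r /wedge /= !(mulr0, mulr1, subr0, sub0r, sgrN).
rewrite oppr_eq0 => y0 x0; rewrite /tpow expr0.
by case: (sgrP x) x0; case: (sgrP y) y0; case: leP; rewrite ?eqxx //= => *; field.
Qed.
End vertices.

(** * The volume as an alternating sum *)

Section core.
Context {R : realType}.
Implicit Types (u v w p : @vec R) (W : seq (@vec R)) (n : nat).
Let mu := (@lebesgue_measure R).

(** Used for the three coordinate functionals i. *)
Lemma push_coord (i : vec -> R) p W (x : seq R) :
  (forall p s w, i (translate p s w) = i p + s * i w) -> size W = size x ->
  i (push p W x) = i p + \sum_(t < size x) nth 0 x t * i (nth p W t).
Proof.
move=> iM; elim: W p x => [|w W IH] p [|s x] //=; first by rewrite big_ord0 addr0.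
move=> [sx]; rewrite big_ord_recl /= IH // iM addrA; congr (_ + _).
by apply: eq_bigr => t _; congr (_ * i _); apply: set_nth_default; rewrite sx.
Qed.

Lemma measurable_ge0 n (f : Rn R n -> R) : measurable_fun [set: Rn R n] (f : _ -> measurableTypeR R) ->
  measurable [set x | 0 <= f x].
Proof.
move=> mf; have := mf measurableT [set` `[0, +oo[] (measurable_itv _); rewrite setTI.
congr measurable; apply/seteqP; split => x /=; by rewrite in_itv /= andbT.
Qed.

Lemma measurable_affine n (a : 'I_n -> R) r :
  measurable_fun [set: Rn R n] (affine a r : _ -> measurableTypeR R).
Proof.
apply: measurable_funD => //; apply: measurable_sum => t.
by apply: measurable_funM => //; exact: measurable_tnth.
Qed.

Lemma measurable_cube n : measurable (@cube R n).
Proof.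
rewrite (_ : cube = \bigcap_(t in [set: 'I_n]) ((fun x : Rn R n => tnth x t) @^-1` `[0, 1])).
  apply: fin_bigcap_measurable => [|t _]; first exact: finite_finset.
  by rewrite -[X in measurable X]setTI; exact: measurable_tnth.
by apply/seteqP; split => x /= H t; [move=> _|]; have := H t; rewrite /= in_itv /=; [|apply].
Qed.

Definition slab n W p : set (Rn R n) := cube `&` [set x | octant (push p W x)].

Arguments slab n W p : clear implicits.

Lemma measurable_slab n W p : size W = n -> measurable (slab n W p).
Proof.
move=> sW.
have mi (i : vec -> R) : (forall p s w, i (translate p s w) = i p + s * i w) ->
    measurable [set x : Rn R n | 0 <= i (push p W x)].
  move=> iM; apply: measurable_ge0.
  rewrite (_ : (fun x => _) = (fun x : Rn R n => \sum_(t < n) i (nth p W t) * tnth x t + i p)).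
    exact: measurable_affine (fun t => i (nth p W t)) (i p).
  apply/funext => x; rewrite push_coord ?size_tuple // addrC; congr (_ + _).
  by apply: eq_bigr => t _; rewrite mulrC (tnth_nth 0).
have -> : slab n W p = cube `&` ([set x : Rn R n | 0 <= (push p W x).1.1] `&`
   [set x | 0 <= (push p W x).1.2] `&` [set x | 0 <= (push p W x).2]).
  by apply/seteqP; split => x /= [cx]; [case|case; case]; split.
apply: measurableI; first exact: measurable_cube.
by apply: measurableI; [apply: measurableI|]; [exact: (mi (fun p => p.1.1))|
  exact: (mi (fun p => p.1.2))|exact: (mi (fun p => p.2))].
Qed.

Lemma vol_slice n (A : set (Rn R n.+1)) :
  vol A = (\int[mu]_s vol (xsection (@tcons R n @^-1` A) s))%E.
Proof. by []. Qed.

Lemma measurable_slice n (A : set (Rn R n.+1)) : measurable A ->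
  measurable_fun [set: measurableTypeR R] (fun s => vol (xsection (@tcons R n @^-1` A) s)).
Proof.
move=> mA; apply: (measurable_fun_xsection [the sigma_finite_measure _ _ of @vol R n]).
by rewrite -[X in measurable X]setTI; exact: measurable_tcons.
Qed.

Lemma slice_slab n W w p s : 0 <= s <= 1 ->
  xsection (@tcons R n @^-1` slab n.+1 (w :: W) p) s = slab n W (translate p s w).
Proof.
move=> s01; rewrite /xsection; apply/seteqP; split => x /=; rewrite inE /= => -[c o]; split => //.
  by move=> t; have := c (lift ord0 t); rewrite tnthS.
move=> t; have [j ->|->] := unliftP ord0 t; last by rewrite tnth0.
by rewrite tnthS.
Qed.

Lemma slice_slab0 n W w p s : ~~ (0 <= s <= 1) ->
  xsection (@tcons R n @^-1` slab n.+1 (w :: W) p) s = set0.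
Proof.
move=> s01; rewrite /xsection; apply/seteqP; split => x //=; rewrite inE /= => -[c _].
by have := c ord0; rewrite tnth0 /= (negbTE s01).
Qed.

(** The slice of a slab at a value s of the first coordinate is the slab of the other
    vectors from the point translated by s, so the induction hypothesis makes the
    volume of a slice piecewise polynomial in s. *)
Lemma vol_slab n W p : size W = n -> generic (W ++ [:: e1; e2]) ->
  (forall q, q \in corners W p -> forall j, j \in W ++ [:: e1; e2] -> wedge q j != 0) ->
  vol (slab n W p) = (alternate W (cone_spline n (W ++ [:: e1; e2])) p)%:E.
Proof.
elim: n W p => [|n IH] [|w W] p //=.
  move=> _ _ /(_ p); rewrite inE eqxx => /(_ isT) h.
  rewrite cone_spline0 ?h ?inE ?eqxx ?orbT // /dirac indicE.
  case: ifPn => [/andP[/andP[x0 y0] z0]|h'].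
    by rewrite mem_set //; split => // t; case: t.
  by rewrite memNset // => -[_ [x0 y0 z0]]; move: h'; rewrite x0 y0 z0.
move=> [sW] g ok.
pose f s := alternate W (cone_spline n (W ++ [:: e1; e2])) (translate p s w).
pose F s := alternate W (cone_spline n.+1 (w :: W ++ [:: e1; e2])) (translate p s w).
pose B := flatten [seq breaks (W ++ [:: e1; e2]) w q | q <- corners W p].
have inB q : q \in corners W p -> {subset breaks (W ++ [:: e1; e2]) w q <= B}.
  by move=> qW s sq; apply/flatten_mapP; exists q.
have [/= /andP[wW _] g2 _] := g.
transitivity (\int[mu]_s vol (xsection (@tcons R n @^-1` slab n.+1 (w :: W) p) s))%E.
  exact: vol_slice.
have mg := @measurable_slice n _ (@measurable_slab n.+1 (w :: W) p (congr1 S sW)).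
set gg := (fun s => vol (xsection _ s)) in mg *.
have -> : (\int[mu]_s gg s = \int[mu]_(s in `[0%R, 1%R]) gg s)%E.
  rewrite [RHS]integral_mkcond; apply: eq_integral => s _; rewrite patchE.
  case: ifPn => //; rewrite notin_setE /= in_itv /= => s01.
  by rewrite /gg slice_slab0 ?measure0 //; exact/negP.
rewrite (@integral_piecewise R gg f F B) //.
- congr EFin; rewrite /F; congr (_ - alternate _ _ _).
  by case: (p) => [[x y] z]; rewrite /translate /= !mul0r !addr0.
- apply: alternate_continuous => q qW; apply: cone_spline_continuous => //.
    by rewrite size_cat sW addn2.
  by apply: ok; rewrite ?mem_cat ?qW ?orbT // inE eqxx.
- apply: alternate_piecewise => q qW; apply: piecewise_subset (inB q qW) _.
  exact: cone_spline_antiderivative.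
move=> s /andP[s0 s1] sB; rewrite /gg slice_slab ?ltW // IH //; first exact: generic_cons g.
move=> q; rewrite corners_translate => /mapP[q0 q0W ->] j jW; rewrite wedge_translate.
apply: contraNneq sB => e; apply: (inB q0 q0W); rewrite mem_cat; apply/orP; left.
apply/mapP; exists j => //.
have wj : wedge w j != 0.
  apply: g2; rewrite ?inE ?eqxx ?jW ?orbT //; by apply: contraNneq wW => ->.
by apply: (mulIf wj); rewrite divfK //; lra.
Qed.
End core.

(** * Alternating sums over the vertices of the cube *)

Section vertex_sums.
Context {R : realType}.

Definition vtx n (B : n.-tuple bool) : Rn R n := [tuple ((tnth B t)%:R : R) | t < n].

Definition altsign n (B : n.-tuple bool) : R := (-1) ^+ #|[set t | ~~ tnth B t]%SET|.

Definition corner_values n (a b c : 'I_n -> R) (p : @vec R) (B : n.-tuple bool) : @vec R :=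
  (affine a p.1.1 (vtx B), affine b p.1.2 (vtx B), affine c p.2 (vtx B)).

Definition coefrow n (a b c : 'I_n -> R) (t : 'I_n) : @vec R := (a t, b t, c t).
Definition coefrows n (a b c : 'I_n -> R) : seq (@vec R) := [seq coefrow a b c t | t <- enum 'I_n].

Lemma altsign_cons n x (B : n.-tuple bool) :
  altsign [tuple of x :: B] = (if x then 1 else -1) * altsign B.
Proof.
have cE m (D : m.-tuple bool) : #|[set t | ~~ tnth D t]%SET| = (\sum_(t < m) ~~ tnth D t)%N.
  by rewrite -sum1_card big_mkcond /=; apply: eq_bigr => t _; rewrite inE; case: (tnth D t).
rewrite /altsign !cE big_ord_recl tnth0 exprD; congr (_ * _); first by case: x.
by congr (_ ^+ _); apply: eq_bigr => t _; rewrite tnthS.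
Qed.

Lemma affine_cons n (a : 'I_n.+1 -> R) (r : R) x (B : n.-tuple bool) :
  affine a r (vtx [tuple of x :: B]) =
  affine (a \o lift ord0) (r + x%:R * a ord0) (vtx B).
Proof.
rewrite /affine big_ord_recl !tnth_mktuple tnth0.
rewrite (eq_bigr (fun t => (a \o lift ord0) t * tnth (vtx B) t)); first by ring.
by move=> t _; rewrite !tnth_mktuple tnthS.
Qed.

Lemma corner_values_cons n (a b c : 'I_n.+1 -> R) p x (B : n.-tuple bool) :
  corner_values a b c p [tuple of x :: B] =
  corner_values (a \o lift ord0) (b \o lift ord0) (c \o lift ord0) (translate p x%:R (coefrow a b c ord0)) B.
Proof. by rewrite /corner_values !affine_cons. Qed.

Lemma coefrowsS n (a b c : 'I_n.+1 -> R) : coefrows a b c =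
  coefrow a b c ord0 :: coefrows (a \o lift ord0) (b \o lift ord0) (c \o lift ord0).
Proof. by rewrite /coefrows enum_ordSl /= -map_comp. Qed.

Lemma sum_tuple_cons n (f : n.+1.-tuple bool -> R) :
  \sum_B f B = \sum_(B : n.-tuple bool) (f [tuple of true :: B] + f [tuple of false :: B]).
Proof.
rewrite big_split /=.
rewrite -(big_bool _ (fun x => \sum_(B : n.-tuple bool) f [tuple of x :: B])) pair_bigA /=.
rewrite (reindex (fun q : bool * n.-tuple bool => [tuple of q.1 :: q.2])) //=.
exists (fun B : n.+1.-tuple bool => (thead B, [tuple of behead B])) => [[x B] _|B _] /=.
  by congr (_, _); exact/val_inj.
by rewrite [RHS]tuple_eta.
Qed.

Lemma alternate_sum n (a b c : 'I_n -> R) p f :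
  alternate (coefrows a b c) f p = \sum_B altsign B * f (corner_values a b c p B).
Proof.
elim: n a b c p => [|n IH] a b c p.
  rewrite /coefrows enum_ord0 /= (big_pred1 [tuple]) /=; last by move=> B; rewrite [B]tuple0; exact/esym/eqP.
  rewrite /altsign /corner_values /affine !big_ord0 !add0r.
  rewrite eq_card0 ?mul1r; last by case.
  by case: p => [[]].
rewrite coefrowsS /= !IH sum_tuple_cons -sumrB; apply: eq_bigr => B _.
rewrite !altsign_cons !corner_values_cons mul1r mulN1r mulNr; congr (_ - _ * f (corner_values _ _ _ _ _)).
by case: p => [[x y] z]; rewrite /translate /= !mul0r !addr0.
Qed.

Lemma cornersP n (a b c : 'I_n -> R) p q : q \in corners (coefrows a b c) p ->
  exists B, q = corner_values a b c p B.
Proof.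
elim: n a b c p => [|n IH] a b c p.
  rewrite /coefrows enum_ord0 /= inE => /eqP ->; exists [tuple].
  by rewrite /corner_values /affine !big_ord0 !add0r; case: p => [[]].
rewrite coefrowsS /= mem_cat => /orP[] /IH[B ->].
  by exists [tuple of true :: B]; rewrite corner_values_cons.
exists [tuple of false :: B]; rewrite corner_values_cons; congr (corner_values _ _ _ _ _).
by case: p => [[x y] z]; rewrite /translate /= !mul0r !addr0.
Qed.

Lemma push_coefrows n (a b c : 'I_n -> R) p (x : Rn R n) :
  push p (coefrows a b c) x = (affine a p.1.1 x, affine b p.1.2 x, affine c p.2 x).
Proof.
have sr : size (coefrows a b c) = size x by rewrite size_map size_enum_ord size_tuple.
have key (i : vec -> R) (d : 'I_n -> R) : (forall p s w, i (translate p s w) = i p + s * i w) ->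
    (forall t, i (coefrow a b c t) = d t) -> i (push p (coefrows a b c) x) = affine d (i p) x.
  move=> iM id; rewrite push_coord // addrC /affine; congr (_ + _).
  move: sr; rewrite size_tuple => sr.
  apply: eq_bigr => t _; rewrite (nth_map t) ?size_enum_ord // nth_ord_enum id mulrC.
  by rewrite (tnth_nth 0).
by rewrite -(key (fun p => p.1.1) a) // -(key (fun p => p.1.2) b) // -(key (fun p => p.2) c) //;
  case: (push _ _ _) => [[]].
Qed.

Lemma vol_coefrows n (a b c : 'I_n -> R) p :
  generic (coefrows a b c ++ [:: e1; e2]) ->
  (forall B j, j \in coefrows a b c ++ [:: e1; e2] -> wedge (corner_values a b c p B) j != 0) ->
  vol (cube `&` halfspace (affine a p.1.1) `&` halfspace (affine b p.1.2)
        `&` halfspace (affine c p.2)) =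
  (\sum_B altsign B * cone_spline n (coefrows a b c ++ [:: e1; e2]) (corner_values a b c p B))%:E.
Proof.
move=> g ok; rewrite -alternate_sum -vol_slab //; last 2 first.
- by rewrite size_map size_enum_ord.
- by move=> q /cornersP[B ->] j; exact: ok.
congr (vol _); rewrite -!setIA; congr (_ `&` _); apply/seteqP; split => x /=;
  rewrite push_coefrows /octant /halfspace /=; [by case=> ? []|by case].
Qed.

Definition clear_bit n (p : 'I_n) (B : n.-tuple bool) : n.-tuple bool :=
  [tuple tnth B t && (t != p) | t < n].

Lemma tnth_clear n (p t : 'I_n) (B : n.-tuple bool) : tnth (clear_bit p B) t = tnth B t && (t != p).
Proof. by rewrite tnth_mktuple. Qed.

Lemma altsign_clear n p (B : n.-tuple bool) : tnth B p -> altsign (clear_bit p B) = - altsign B.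
Proof.
move=> Bp; rewrite /altsign.
have -> : [set t | ~~ tnth (clear_bit p B) t]%SET = (p |: [set t | ~~ tnth B t])%SET.
  by apply/setP => t; rewrite !inE tnth_clear; case: eqVneq => [->|_]; rewrite ?andbF ?andbT.
by rewrite cardsU1 inE Bp /= exprS mulN1r.
Qed.

(** Each vertex with B_p = 1 is paired with the other end of its edge of direction p. *)
Lemma sum_pair n (p : 'I_n) (f : n.-tuple bool -> R) :
  \sum_B altsign B * f B = \sum_(B | tnth B p) altsign B * (f B - f (clear_bit p B)).
Proof.
rewrite (bigID (fun B : n.-tuple bool => tnth B p)) /=.
rewrite [X in _ + X](reindex_onto (clear_bit p) (fun B => [tuple tnth B t || (t == p) | t < n])) /=; last first.
  move=> B Bp; apply: eq_from_tnth => t; rewrite tnth_clear tnth_mktuple.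
  by case: eqVneq => [->|_]; rewrite ?andbF ?orbF ?andbT // (negbTE Bp).
rewrite [X in _ + X](eq_bigl (fun B : n.-tuple bool => tnth B p)); last first.
  move=> B; rewrite tnth_clear eqxx andbF /=.
  apply/eqP/idP => [<-|Bp]; first by rewrite tnth_mktuple eqxx orbT.
  apply: eq_from_tnth => t; rewrite tnth_mktuple tnth_clear.
  by case: eqVneq => [->|_]; rewrite ?Bp ?orbT ?orbF ?andbT.
rewrite -big_split /=; apply: eq_bigr => B Bp; rewrite altsign_clear //; ring.
Qed.

Lemma affine_clear n (a : 'I_n -> R) r (p : 'I_n) (B : n.-tuple bool) : tnth B p ->
  affine a r (vtx (clear_bit p B)) = affine a r (vtx B) - a p.
Proof.
move=> Bp; rewrite /affine (bigD1 p) //= [in RHS](bigD1 p) //= !tnth_mktuple Bp eqxx /=.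
rewrite (eq_bigr (fun t => a t * tnth (vtx B) t)); first by ring.
by move=> t tp; rewrite !tnth_mktuple tp andbT.
Qed.

Lemma corner_values_clear n (a b c : 'I_n -> R) q (p : 'I_n) (B : n.-tuple bool) : tnth B p ->
  corner_values a b c q (clear_bit p B) = translate (corner_values a b c q B) (-1) (coefrow a b c p).
Proof. by move=> Bp; rewrite /corner_values !affine_clear // /translate /= !mulN1r. Qed.

End vertex_sums.

Section dets.
Context {R : realType}.

Lemma det2E (x y z w : R) : det2 x y z w = x * w - y * z.
Proof.
rewrite /det2 (expand_det_row _ ord0) !big_ord_recl big_ord0 /cofactor !det_mx11.
by rewrite !mxE /= expr0 expr1; ring.
Qed.

Lemma det3E (u v w : @vec R) :
  det3 u.1.1 u.1.2 u.2 v.1.1 v.1.2 v.2 w.1.1 w.1.2 w.2 = tri u v w.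
Proof.
rewrite /det3 (expand_det_row _ ord0) !big_ord_recl big_ord0 /cofactor.
rewrite !(expand_det_row _ ord0) !big_ord_recl !big_ord0 /cofactor !det_mx11.
by rewrite !mxE /= /tri /wedge; ring.
Qed.
End dets.

(** * The alternating sum by vertices, edges and faces *)

Section index_formula.
Context {R : realType} {n : nat}.
Variables (a b c : 'I_n -> R).
Implicit Types (p q t : 'I_n) (u v w P : @vec R).
Local Notation coefrow := (coefrow a b c).
Local Notation W := (coefrows a b c ++ [:: e1; e2]).

Definition index_generic :=
  [/\ forall p, [&& a p != 0, b p != 0 & c p != 0],
      forall p q, p != q -> [&& wedge (coefrow p) (coefrow q) != 0,
        det2 (a p) (c p) (a q) (c q) != 0 & det2 (b p) (c p) (b q) (c q) != 0] &
      forall p q t, p != q -> p != t -> q != t -> tri (coefrow p) (coefrow q) (coefrow t) != 0].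

Definition vertex_coef : R := (n`!%:R * \prod_(t < n) c t)^-1.
Definition edge_coef (d : 'I_n -> R) p : R := Num.sg (d p) * d p ^+ n.-1 /
  (n`!%:R * c p * \prod_(t in ~: [set p]%SET) det2 (d p) (c p) (d t) (c t)).
Definition face_coef p q : R :=
  let D := det2 (a p) (b p) (a q) (b q) in
  Num.sg D * D ^+ n.-1 /
    (n`!%:R * det2 (a p) (c p) (a q) (c q) * det2 (b p) (c p) (b q) (c q) *
     \prod_(t in ~: [set p; q]%SET) det3 (a p) (b p) (c p) (a q) (b q) (c q) (a t) (b t) (c t)).

Definition vertex_term P : R :=
  if (0 <= P.1.1) && (0 <= P.1.2) then tpow n P.2 * vertex_coef else 0.
Definition edge_term (d e : 'I_n -> R) p (x y z : R) : R :=
  let l := x / d p in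
  if (0 < l < 1) && (0 <= y - l * e p) then tpow n (z - l * c p) * edge_coef d p else 0.
Definition face_term p q P : R :=
  let l := wedge P (coefrow q) / wedge (coefrow p) (coefrow q) in
  let m := wedge (coefrow p) P / wedge (coefrow p) (coefrow q) in
  if (0 < l < 1) && (0 < m < 1) then tpow n (P.2 - l * c p - m * c q) * face_coef p q else 0.

(** An edge is given by its direction p and its end B with B_p = 1, and a face by
    p < q and its corner B with B_p = B_q = 1; the point of the edge or face where
    the functions vanish is at distance l (and m) below that corner.  The terms are
    0 when there is no such point. *)
Definition index_sum (r : @vec R) : R :=
  let g := corner_values a b c r in
  \sum_B altsign B * vertex_term (g B)
  - \sum_(p < n) \sum_(B : n.-tuple bool | tnth B p) altsign B * edge_term a b p (g B).1.1 (g B).1.2 (g B).2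
  - \sum_(p < n) \sum_(B : n.-tuple bool | tnth B p) altsign B * edge_term b a p (g B).1.2 (g B).1.1 (g B).2
  - \sum_(p < n) \sum_(q < n | (p < q)%N) \sum_(B : n.-tuple bool | tnth B p && tnth B q)
      altsign B * face_term p q (g B).

Hypothesis gen : index_generic.

Lemma size_ext : size W = n.+2.
Proof. by rewrite size_cat size_map size_enum_ord addn2. Qed.

Lemma ext_cases u : u \in W -> [\/ exists p, u = coefrow p, u = e1 | u = e2].
Proof.
rewrite mem_cat !inE => /or3P[/mapP[p _ ->]|/eqP->|/eqP->].
- by apply: Or31; exists p.
- exact: Or32.
- exact: Or33.
Qed.

Lemma row_inj : injective coefrow.
Proof.
move=> p q e; apply/eqP; apply: contraT => pq; have [_ /(_ p q pq)/and3P[]] := gen.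
by rewrite e wedgexx eqxx.
Qed.

Lemma wedge_e1 u : wedge u e1 = - u.1.2. Proof. by rewrite /wedge /=; ring. Qed.
Lemma wedge_e2 u : wedge u e2 = u.1.1. Proof. by rewrite /wedge /=; ring. Qed.

Lemma tri_e1 u v : tri u v e1 = u.1.2 * v.2 - u.2 * v.1.2.
Proof. by rewrite /tri /wedge /=; ring. Qed.
Lemma tri_e2 u v : tri u v e2 = - (u.1.1 * v.2 - u.2 * v.1.1).
Proof. by rewrite /tri /wedge /=; ring. Qed.
Lemma tri_e1_e2 u : tri u e1 e2 = u.2.
Proof. by rewrite /tri /wedge /=; ring. Qed.

Lemma generic_ext : generic W.
Proof.
have [g1 g2 g3] := gen.
have wne u v : wedge u v != 0 -> u != v by apply: contraNneq => ->; rewrite wedgexx.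
have h2 : {in W &, forall u v, u != v -> wedge u v != 0}.
  have aux u v : u \in W -> v = e1 \/ v = e2 -> u != v -> wedge u v != 0.
    move=> /ext_cases[[p ->]|->|->] [->|->]; rewrite ?eqxx // ?wedge_e1 ?wedge_e2 ?oppr_eq0 //= => _;
      rewrite ?oner_eq0 //; by have /and3P[] := g1 p.
  move=> u v uW vW uv; have [[q vE]|vE|vE] := ext_cases vW; last 2 first.
  - by apply: aux => //; left.
  - by apply: aux => //; right.
  have [[p uE]|uE|uE] := ext_cases uW; last 2 first.
  - by rewrite wedgeC oppr_eq0; apply: aux; [|left|rewrite eq_sym].
  - by rewrite wedgeC oppr_eq0; apply: aux; [|right|rewrite eq_sym].
  rewrite uE vE; have /g2/and3P[] // : p != q.
  by apply: contraNneq uv => pq; rewrite uE vE pq.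
split => //.
  rewrite cat_uniq map_inj_uniq ?enum_uniq; last exact: row_inj.
  rewrite /= !inE andbT negb_or orbF; apply/andP; split.
    apply/andP; split; apply/mapP => -[p _ e].
      by have /and3P[_ + _] := g1 p; rewrite -oppr_eq0 -[b p]/(coefrow p).1.2 -wedge_e1 -e wedgexx eqxx.
    by have /and3P[+ _ _] := g1 p; rewrite -[a p]/(coefrow p).1.1 -wedge_e2 -e wedgexx eqxx.
  by apply: wne; rewrite wedge_e2 /= oner_eq0.
have aux2 u v : u \in W -> v \in W -> forall w, w = e1 \/ w = e2 ->
    u != v -> u != w -> v != w -> tri u v w != 0.
  have det_ac p q : coefrow p != coefrow q -> (a p * c q - c p * a q != 0) && (b p * c q - c p * b q != 0).
    move=> pq; rewrite -!det2E; have /g2/and3P[] : p != q by apply: contraNneq pq => ->.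
    by move=> _ -> ->.
  move=> /ext_cases[[p ->]|->|->] /ext_cases[[q ->]|->|->] w [->|->]; rewrite ?eqxx //;
    rewrite /tri /wedge /e1 /e2 /= ?mulr0 ?mul0r ?mulr1 ?subr0 ?sub0r ?oppr0 ?addr0 ?add0r => uv uw vw.
  all: try (by have /andP[h1 h2'] := det_ac _ _ uv; apply: contraNneq h1 => h; apply/eqP; lra).
  all: try (by have /andP[h1 h2'] := det_ac _ _ uv; apply: contraNneq h2' => h; apply/eqP; lra).
  all: try (by have /and3P[_ _ h] := g1 p; apply: contraNneq h => h; apply/eqP; lra).
  all: try (by have /and3P[_ _ h] := g1 q; apply: contraNneq h => h; apply/eqP; lra).
move=> u v w uW vW wW uv uw vw.
have [[t wE]|wE|wE] := ext_cases wW; last 2 first.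
- by apply: aux2 => //; left.
- by apply: aux2 => //; right.
have [[q vE]|vE|vE] := ext_cases vW; last 2 first.
- by rewrite tri_C oppr_eq0; apply: aux2 => //; [left|rewrite eq_sym].
- by rewrite tri_C oppr_eq0; apply: aux2 => //; [right|rewrite eq_sym].
have [[p uE]|uE|uE] := ext_cases uW; last 2 first.
- by rewrite triC tri_C opprK; apply: aux2 => //; [left|rewrite eq_sym|rewrite eq_sym].
- by rewrite triC tri_C opprK; apply: aux2 => //; [right|rewrite eq_sym|rewrite eq_sym].
rewrite uE vE wE; apply: g3; [move: uv|move: uw|move: vw]; rewrite ?uE ?vE ?wE; by apply: contraNneq => ->.
Qed.

Let h u v P := cone4 u v P * (tpow n (height u v P) * weight n W u v).

(** The pairs are grouped by how many of the two auxiliary vectors they contain. *)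
Lemma cone_spline_pairs P : cone_spline n W P = (4 * n`!%:R)^-1 *
  (h e1 e2 P + \sum_(p < n) h (coefrow p) e2 P + \sum_(p < n) h (coefrow p) e1 P +
   \sum_(p < n) \sum_(q < n | (p < q)%N) h (coefrow p) (coefrow q) P).
Proof.
have hC u v : u \in W -> v \in W -> h v u P = h u v P.
  by move=> uW vW; rewrite /h cone4C heightC (weightC generic_ext size_ext).
have h0 u : h u u P = 0.
  by rewrite /h /weight wedgexx normr0 mul0r invr0 !mulr0.
have e1W : e1 \in W by rewrite mem_cat inE eqxx orbT.
have e2W : e2 \in W by rewrite mem_cat !inE eqxx !orbT.
have rW p : coefrow p \in W by rewrite mem_cat map_f // mem_enum.
have sE (f : vec -> R) : \sum_(u <- W) f u = \sum_(p < n) f (coefrow p) + f e1 + f e2.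
  by rewrite big_cat /= big_map big_enum /= !big_cons big_nil addr0 addrA.
have -> : (4 * n`!%:R)^-1 = (8 * n`!%:R)^-1 * 2 :> R.
  by have : n`!%:R != 0 :> R; [rewrite pnatr_eq0 -lt0n fact_gt0|move=> ?; field].
rewrite /cone_spline -mulrA; congr (_ * _); rewrite sE !sE.
rewrite (eq_bigr (fun p => \sum_(q < n) h (coefrow p) (coefrow q) P + h (coefrow p) e1 P + h (coefrow p) e2 P)); last first.
  by move=> p _; rewrite sE.
rewrite !big_split /= -!/(h _ _ P) !h0 (hC e1 e2) //.
have -> : \sum_(p < n) h e1 (coefrow p) P = \sum_(p < n) h (coefrow p) e1 P by apply: eq_bigr => p _; rewrite hC.
have -> : \sum_(p < n) h e2 (coefrow p) P = \sum_(p < n) h (coefrow p) e2 P by apply: eq_bigr => p _; rewrite hC.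
have -> : \sum_(p < n) \sum_(q < n) h (coefrow p) (coefrow q) P = 2 * \sum_(p < n) \sum_(q < n | (p < q)%N) h (coefrow p) (coefrow q) P.
  rewrite mulr_natl mulr2n.
  have {2}-> : \sum_(p < n) \sum_(q < n | (p < q)%N) h (coefrow p) (coefrow q) P =
    \sum_(p < n) \sum_(q < n | (q < p)%N) h (coefrow p) (coefrow q) P.
    rewrite (exchange_big_dep xpredT) //=; apply: eq_bigr => p _; apply: eq_bigr => q _.
    by rewrite hC.
  rewrite -big_split /=; apply: eq_bigr => p _.
  rewrite (bigID (fun q => (p < q)%N)) /=; congr (_ + _).
  rewrite (bigID (fun q => q == p)) /= big1 ?add0r; last by move=> q /andP[_ /eqP->].
  by apply: eq_bigl => q; rewrite -leqNgt ltn_neqAle andbC.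
by ring.
Qed.

Lemma cone4_pos u v P : wedge u v != 0 -> wedge P u != 0 -> wedge P v != 0 ->
  cone4 u v P = if (0 < wedge P v / wedge u v) && (0 < wedge u P / wedge u v) then 4 else 0.
Proof.
move=> D0 u0 v0; rewrite /cone4 (wedgeC P u).
rewrite -(sgr_gt0 (_ / wedge u v)) -[X in _ && X]sgr_gt0 !sgrM !sgrV sgrN.
case: (sgrP (wedge u v)) D0; case: (sgrP (wedge P u)) u0; case: (sgrP (wedge P v)) v0;
  rewrite ?eqxx // => _ _ _ _ _ _; rewrite ?(mulN1r, mulrN1, mul1r, mulr1, opprK, ltr01, ltrN10, oppr_gt0, ltr10) /=; lra.
Qed.

Lemma prod_ext u v : \prod_(t <- W | tri u v t != 0) tri u v t =
  \prod_(t < n | tri u v (coefrow t) != 0) tri u v (coefrow t) *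
  ((if tri u v e1 != 0 then tri u v e1 else 1) * (if tri u v e2 != 0 then tri u v e2 else 1)).
Proof.
rewrite big_cat /= big_map big_enum_cond /= !big_cons big_nil.
by congr (_ * _); case: ifP; case: ifP; rewrite ?mulr1 ?mul1r.
Qed.

Lemma fact_neq0 m : (m`!%:R : R) != 0.
Proof. by rewrite pnatr_eq0 -lt0n fact_gt0. Qed.

Lemma sgr_expr (d : R) m : d != 0 -> (0 < m)%N -> d ^+ m / `|d| = Num.sg d * d ^+ m.-1.
Proof.
case: m => // m d0 _; rewrite exprS /= normrEsg.
have s0 : Num.sg d != 0 by rewrite sgr_eq0.
have ss : Num.sg d * Num.sg d = 1 by rewrite -expr2 sqr_sg d0.
have si : (Num.sg d)^-1 = Num.sg d by apply: (mulIf s0); rewrite mulVf.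
by rewrite invfM si; field.
Qed.

Lemma weight0 : weight n W e1 e2 / n`!%:R = vertex_coef.
Proof.
have [g1 _ _] := gen.
rewrite /weight prod_ext tri_xyx tri_xyy eqxx /= !mulr1 wedge_e2 /= expr1n normr1 !mul1r.
rewrite /vertex_coef invfM mulrC; congr (_ / _).
have e t : tri e1 e2 (coefrow t) = c t by rewrite /tri /wedge /=; ring.
apply: eq_big => [t|t _]; last exact: e.
by rewrite e; have /and3P[_ _ ->] := g1 t.
Qed.

Lemma prod_except1 (f : 'I_n -> R) p : f p = 0 -> (forall t, t != p -> f t != 0) ->
  \prod_(t < n | f t != 0) f t = \prod_(t in ~: [set p]%SET) f t.
Proof.
move=> fp fn; apply: eq_bigl => t; rewrite !inE; have [->|/fn//] := eqVneq t p.
by rewrite fp eqxx.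
Qed.

Lemma weight1a p : (0 < n)%N -> weight n W (coefrow p) e2 / n`!%:R = - edge_coef a p.
Proof.
move=> n0; have [g1 g2 _] := gen; have /and3P[a0 b0 c0] := g1 p.
have e t : tri (coefrow p) e2 (coefrow t) = det2 (a p) (c p) (a t) (c t).
  by rewrite tri_C tri_e2 opprK det2E.
rewrite /weight wedge_e2 prod_ext.
rewrite tri_xyy eqxx /= tri_C tri_e1_e2 oppr_eq0 c0 mulr1.
rewrite (eq_bigl (fun t => det2 (a p) (c p) (a t) (c t) != 0)); last by move=> t; rewrite e.
rewrite (eq_bigr _ (fun t _ => e t)) (@prod_except1 _ p); last 2 first.
- by rewrite det2E; ring.
- by move=> t tp; have /g2/and3P[] : p != t by rewrite eq_sym.
rewrite /edge_coef -sgr_expr //.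
have : \prod_(t in ~: [set p]%SET) det2 (a p) (c p) (a t) (c t) != 0.
  apply/prodf_neq0 => t; rewrite !inE => tp; have /g2/and3P[] // : p != t by rewrite eq_sym.
move: (\prod_(t in _) _) => Q Q0; have := fact_neq0 n; have : `|a p| != 0 by rewrite normr_eq0.
move: (n`!%:R) `|a p| => F A A0 F0.
by rewrite /=; field; rewrite A0 F0 Q0 c0.
Qed.

Lemma weight1b p : (0 < n)%N -> weight n W (coefrow p) e1 / n`!%:R = - edge_coef b p.
Proof.
move=> n0; have [g1 g2 _] := gen; have /and3P[a0 b0 c0] := g1 p.
have e t : tri (coefrow p) e1 (coefrow t) = - det2 (b p) (c p) (b t) (c t).
  by rewrite tri_C tri_e1 det2E.
rewrite /weight wedge_e1 prod_ext.
rewrite tri_xyy eqxx /= tri_e1_e2 c0 mul1r.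
rewrite (eq_bigl (fun t => det2 (b p) (c p) (b t) (c t) != 0)); last first.
  by move=> t; rewrite e oppr_eq0.
rewrite (eq_bigr _ (fun t _ => e t)).
have -> : \prod_(t < n | det2 (b p) (c p) (b t) (c t) != 0) - det2 (b p) (c p) (b t) (c t) =
    (-1) ^+ n.-1 * \prod_(t in ~: [set p]%SET) det2 (b p) (c p) (b t) (c t).
  rewrite (eq_bigl (fun t => t \in ~: [set p]%SET)); last first.
    move=> t; rewrite !inE; have [->|tp] := eqVneq t p; first by rewrite det2E mulrC subrr eqxx.
    by have /g2/and3P[] : p != t by rewrite eq_sym.
  by rewrite prodrN cardsC1 card_ord.
rewrite /edge_coef -sgr_expr // normrN /= [(- b p) ^+ n]exprNn.
have : \prod_(t in ~: [set p]%SET) det2 (b p) (c p) (b t) (c t) != 0.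
  apply/prodf_neq0 => t; rewrite !inE => tp; have /g2/and3P[] // : p != t by rewrite eq_sym.
move: (\prod_(t in _) _) => Q Q0; have := fact_neq0 n; have : `|b p| != 0 by rewrite normr_eq0.
move: (n`!%:R) `|b p| => F A A0 F0.
have -> : (-1) ^+ n = - (-1) ^+ n.-1 :> R by rewrite -{1}(prednK n0) exprS mulN1r.
have := signr_eq0 R n.-1; move: ((-1) ^+ n.-1) => S /negbT S0.
by rewrite /=; field; rewrite A0 F0 Q0 c0 S0.
Qed.

Lemma det3_row p q t : det3 (a p) (b p) (c p) (a q) (b q) (c q) (a t) (b t) (c t) =
  tri (coefrow p) (coefrow q) (coefrow t).
Proof. by rewrite -det3E. Qed.

Lemma det2_row p q : det2 (a p) (b p) (a q) (b q) = wedge (coefrow p) (coefrow q).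
Proof. by rewrite det2E. Qed.

Lemma weight2 p q : (0 < n)%N -> p != q ->
  weight n W (coefrow p) (coefrow q) / n`!%:R = - face_coef p q.
Proof.
move=> n0 pq; have [g1 g2 g3] := gen; have /and3P[D0 ac0 bc0] := g2 p q pq.
rewrite /weight prod_ext tri_e1 tri_e2 /= -!det2E bc0 oppr_eq0 ac0.
rewrite (eq_bigl (fun t => t \in ~: [set p; q]%SET)); last first.
  move=> t; rewrite !inE negb_or.
  have [->|tp] := eqVneq t p; first by rewrite tri_xyx eqxx.
  have [->|tq] := eqVneq t q; first by rewrite tri_xyy eqxx.
  by rewrite g3 // eq_sym.
rewrite /face_coef /= det2_row -sgr_expr // (eq_bigr _ (fun t _ => det3_row p q t)).
have : \prod_(t in ~: [set p; q]%SET) tri (coefrow p) (coefrow q) (coefrow t) != 0.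
  apply/prodf_neq0 => t; rewrite !inE negb_or => /andP[tp tq]; rewrite g3 // eq_sym //.
move: (\prod_(t in _) _) => Q Q0; have := fact_neq0 n.
have : `|wedge (coefrow p) (coefrow q)| != 0 by rewrite normr_eq0.
move: (n`!%:R) `|_| => F A A0 F0.
by field; rewrite A0 F0 Q0 ac0 bc0.
Qed.

Lemma height_split u v P : wedge u v != 0 ->
  height u v P = P.2 - wedge P v / wedge u v * u.2 - wedge u P / wedge u v * v.2.
Proof. by move=> D0; rewrite /height /tri /wedge; field. Qed.

(** The indicator of l > 0 changes between the ends of an edge exactly when the
    function vanishes strictly between them. *)
Lemma pos_shift (l : R) : l != 1 -> (0 < l)%R%:R - (0 < l - 1)%R%:R = (0 < l < 1)%R%:R :> R.
Proof.
move=> l1; rewrite subr_gt0; case: (ltrP 0 l) => l0 /=; last first.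
  by rewrite ltNge (le_trans l0) ?ler01 // subrr.
by case: ltgtP l1 => //= _ _; rewrite ?subr0 ?subrr.
Qed.

Let piece u v P : R := (0 < wedge P v / wedge u v)%R%:R * (0 < wedge u P / wedge u v)%R%:R *
  (tpow n (height u v P) * (weight n W u v / n`!%:R)).

Lemma cone4_piece u v P : u \in W -> v \in W -> u != v -> wedge P u != 0 -> wedge P v != 0 ->
  (4 * n`!%:R)^-1 * h u v P = piece u v P.
Proof.
move=> uW vW uv u0 v0; rewrite /h cone4_pos //; last by case: generic_ext => _ g2 _; apply: g2.
rewrite /piece invfM; case: ifPn => [/andP[-> ->]|/nandP[]/negbTE->].
- by have := fact_neq0 n; move: (n`!%:R) => F F0 /=; field.
- by rewrite !mul0r mulr0.
- by rewrite !(mulr0, mul0r).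
Qed.

Lemma piece_translate u v P : wedge u v != 0 -> wedge P v != wedge u v ->
  piece u v P - piece u v (translate P (-1) u) =
  (0 < wedge P v / wedge u v < 1)%R%:R * (0 < wedge u P / wedge u v)%R%:R *
  (tpow n (height u v P) * (weight n W u v / n`!%:R)).
Proof.
move=> D0 ne; rewrite /piece wedge_translate (wedgeC (translate _ _ _) u) wedge_translate wedgexx.
rewrite mulr0 addr0 -wedgeC height_translate height_xyx mulr0 addr0.
have -> : (wedge P v + -1 * wedge u v) / wedge u v = wedge P v / wedge u v - 1 by field.
rewrite -!mulrBl pos_shift //; apply: contraNneq ne => e.
by rewrite -(divfK D0 (wedge P v)) e mul1r.
Qed.

Lemma piece_translate2 u v P : wedge u v != 0 -> wedge P v != wedge u v -> wedge u P != wedge u v ->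
  piece u v P - piece u v (translate P (-1) u) -
  (piece u v (translate P (-1) v) - piece u v (translate (translate P (-1) v) (-1) u)) =
  (0 < wedge P v / wedge u v < 1)%R%:R * (0 < wedge u P / wedge u v < 1)%R%:R *
  (tpow n (height u v P) * (weight n W u v / n`!%:R)).
Proof.
move=> D0 ne ne'; rewrite !piece_translate //; last by rewrite wedge_translate wedgexx mulr0 addr0.
rewrite wedge_translate wedgexx mulr0 addr0 height_translate height_xyy mulr0 addr0.
rewrite (wedgeC (translate _ _ _) u) wedge_translate.
have -> : - (wedge P u + -1 * wedge v u) / wedge u v = wedge u P / wedge u v - 1.
  by rewrite (wedgeC u P) (wedgeC u v) -[wedge u P]opprK; field.
rewrite -mulrBl -mulrBr pos_shift //; apply: contraNneq ne' => e.
by rewrite -(divfK D0 (wedge u P)) e mul1r.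
Qed.

(** A pair containing w_p has the same height at both ends of an edge of direction p,
    and only one of its two cone coordinates changes, by 1.  Taking differences
    over the edges, or twice for a pair {w_p, w_q}, therefore turns the conditions
    alpha > 0 into 0 < alpha < 1. *)
Lemma alternating_sum_index (r : @vec R) : (0 < n)%N ->
  (forall B j, j \in W -> wedge (corner_values a b c r B) j != 0) ->
  \sum_B altsign B * cone_spline n W (corner_values a b c r B) = index_sum r.
Proof.
move=> n0 ok; pose g := corner_values a b c r; have [g1 g2 g3] := gen.
have rW p : coefrow p \in W by rewrite mem_cat map_f // mem_enum.
have e1W : e1 \in W by rewrite mem_cat inE eqxx orbT.
have e2W : e2 \in W by rewrite mem_cat !inE eqxx !orbT.
have [uW _ _] := generic_ext.
have re p e : e \in [:: e1; e2] -> coefrow p != e.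
  move=> eE; move: uW; rewrite cat_uniq => /and3P[_ /hasPn/(_ e eE) /= + _].
  by apply: contraNneq => <-; rewrite map_f // mem_enum.
rewrite (eq_bigr (fun B => altsign B * piece e1 e2 (g B) +
   \sum_(p < n) altsign B * piece (coefrow p) e2 (g B) +
   \sum_(p < n) altsign B * piece (coefrow p) e1 (g B) +
   \sum_(p < n) \sum_(q < n | (p < q)%N) altsign B * piece (coefrow p) (coefrow q) (g B))); last first.
  move=> B _; rewrite cone_spline_pairs !mulrDr !mulr_sumr.
  rewrite cone4_piece ?ok //; last first.
    by apply/eqP => /(congr1 (fun u : vec => u.1.1)) /= /eqP; rewrite oner_eq0.
  congr (_ + _ + _ + _).
  - by apply: eq_bigr => p _; rewrite cone4_piece ?ok // re // !inE eqxx orbT.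
  - by apply: eq_bigr => p _; rewrite cone4_piece ?ok // re // !inE eqxx.
  - apply: eq_bigr => p _; rewrite !mulr_sumr; apply: eq_bigr => q pq; rewrite cone4_piece ?ok //.
    by rewrite (inj_eq row_inj) -val_eqE /= ltn_eqF.
rewrite !big_split /= /index_sum -!sumrN; congr (_ + _ + _ + _).
- apply: eq_bigr => B _; congr (_ * _); rewrite /piece /vertex_term weight0.
  rewrite height_split ?wedge_e2 ?oner_eq0 //= (wedgeC (g B) e1) wedge_e1 opprK !divr1 /=.
  have x0 := ok B _ e2W; have y0 := ok B _ e1W.
  rewrite wedge_e2 in x0; rewrite wedge_e1 oppr_eq0 in y0.
  rewrite !lt_def x0 y0 /= !mulr0 !subr0.
  by case: (0 <= _); case: (0 <= _); rewrite /= ?(mul0r, mul1r).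
- rewrite exchange_big /=; apply: eq_bigr => p _.
  rewrite (sum_pair p) -sumrN; apply: eq_bigr => B Bp; rewrite /g corner_values_clear // -/(g B) -[RHS]mulrN; congr (_ * _).
  have /and3P[a0 b0 c0] := g1 p.
  have D0 : wedge (coefrow p) e2 != 0 by rewrite wedge_e2.
  rewrite piece_translate //; last first.
    have := ok (clear_bit p B) _ e2W; rewrite corner_values_clear // wedge_translate mulN1r subr_eq0 //.
  (* Of the two cone coordinates of {w_p, e2}, the one along w_p is l = g1 / a_p,
     and the one along e2 is g2 - l b_p. *)
  have l1 := ok B _ (rW p).
  rewrite weight1a // height_split // !wedge_e2 /= mulr0 subr0 /edge_term.
  have -> : (g B).1.2 - (g B).1.1 / a p * b p = wedge (coefrow p) (g B) / a p.
    by rewrite /wedge /=; field.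
  rewrite le_eqVlt eq_sym mulf_eq0 invr_eq0 (negbTE a0) orbF wedgeC oppr_eq0 (negbTE l1) /=.
  by case: (_ < _ < _); case: (_ < _); rewrite /= ?mul0r ?mul1r ?oppr0 // ?mulrN ?mul0r ?oppr0.
- rewrite exchange_big /=; apply: eq_bigr => p _.
  rewrite (sum_pair p) -sumrN; apply: eq_bigr => B Bp; rewrite /g corner_values_clear // -/(g B) -[RHS]mulrN; congr (_ * _).
  have /and3P[a0 b0 c0] := g1 p.
  have D0 : wedge (coefrow p) e1 != 0 by rewrite wedge_e1 oppr_eq0.
  rewrite piece_translate //; last first.
    have := ok (clear_bit p B) _ e1W; rewrite corner_values_clear // wedge_translate mulN1r subr_eq0 //.
  have l1 := ok B _ (rW p).
  rewrite weight1b // height_split // !wedge_e1 /= mulr0 subr0 invrN mulrNN /edge_term.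
  have -> : (g B).1.1 - (g B).1.2 / b p * a p = wedge (coefrow p) (g B) / - b p.
    by rewrite /wedge /=; field.
  rewrite le_eqVlt eq_sym mulf_eq0 invr_eq0 oppr_eq0 (negbTE b0) orbF wedgeC oppr_eq0 (negbTE l1) /=.
  by rewrite invrN; case: (_ < _ < _); case: (_ < _); rewrite /= ?mul0r ?mul1r ?oppr0 // ?mulrN ?mul0r ?oppr0.
- rewrite exchange_big /=; apply: eq_bigr => p _.
  rewrite exchange_big /= -sumrN; apply: eq_bigr => q pq.
  have pnq : p != q by rewrite -val_eqE /= ltn_eqF.
  have /and3P[D0 ac0 bc0] := g2 p q pnq.
  pose f B := if tnth B p then piece (coefrow p) (coefrow q) (g B) -
     piece (coefrow p) (coefrow q) (g (clear_bit p B)) else 0.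
  (* First difference along p; as f vanishes on the vertices with B_p = 0, the
     second one, along q, keeps only the corners with B_p = B_q = 1. *)
  rewrite (sum_pair p) big_mkcond /= (eq_bigr (fun B => altsign B * f B)); last first.
    by move=> B _; rewrite /f; case: ifP; rewrite ?mulr0.
  rewrite (sum_pair q) big_mkcond [in RHS]big_mkcond /= -sumrN; apply: eq_bigr => B _.
  case: ifPn => Bq; rewrite ?andbF ?oppr0 // andbT /f tnth_clear pnq andbT.
  case: ifPn => Bp; rewrite ?subrr ?mulr0 ?oppr0 // -[RHS]mulrN; congr (_ * _).
  have Bp' : tnth (clear_bit q B) p by rewrite tnth_clear Bp.
  rewrite /g !corner_values_clear // -/(g B) piece_translate2 //; last 2 first.
  + have := ok (clear_bit p B) _ (rW q); rewrite corner_values_clear // wedge_translate mulN1r subr_eq0 //.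
  + have := ok (clear_bit q B) _ (rW p); rewrite corner_values_clear // wedge_translate mulN1r subr_eq0.
    by rewrite (wedgeC _ (g B)) (wedgeC _ (coefrow q)) eqr_opp.
  rewrite weight2 // height_split // /face_term -/(g B) /=.
  by case: (_ < _ < _); case: (_ < _ < _); rewrite /= ?mul0r ?mul1r ?oppr0 // ?mulrN ?mul0r ?oppr0.
Qed.

End index_formula.

(** * Sums over the points of F^0, F^1 and F^2 *)

(** The support of f is contained in a finite family parametrised by J.  The points
    of S that are not recovered from their key contribute 0; they may be infinitely
    many, as when a whole edge lies in a hyperplane. *)
Lemma fsbig_key (R : realType) (T : choiceType) (J : finType) (S : set T) (f : T -> R)
    (key : T -> J) (pt : J -> T) :
  (forall v, S v -> f v != 0 -> pt (key v) = v) ->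
  \sum_(v \in S) f v = \sum_(j | `[< S (pt j) >] && (key (pt j) == j)) f (pt j).
Proof.
move=> kS; pose r := [seq pt j | j <- enum J & `[< S (pt j) >] && (key (pt j) == j)].
rewrite (@fsbigE _ _ _ _ S r).
- rewrite big_map big_filter_cond big_enum_cond /=; apply: eq_bigl => j.
  case: asboolP => [h|]; rewrite ?andbF //=.
  by rewrite mem_set ?andbT.
- rewrite map_inj_in_uniq; first by apply: filter_uniq; exact: enum_uniq.
  move=> i j; by rewrite !mem_filter => /andP[/andP[_ /eqP ei] _] /andP[/andP[_ /eqP ej] _] e; rewrite -ei e ej.
- by move=> v /= /mapP[j]; rewrite mem_filter => /andP[/andP[/asboolP Sj _] _] ->.
- move=> v Sv vr; apply/eqP; apply: contraNT vr => fv; apply/mapP; exists (key v); last by rewrite kS.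
  by rewrite mem_filter mem_enum kS // eqxx !andbT; exact/asboolP.
Qed.

Lemma enum_sorted m (A : {set 'I_m}) (s : seq 'I_m) :
  sorted (fun i j : 'I_m => (i < j)%N) s -> A =i s -> enum A = s.
Proof.
move=> ss As; apply: (@irr_sorted_eq _ (fun i j : 'I_m => (i < j)%N)) => //.
- by move=> i j k; exact: ltn_trans.
- by move=> i; rewrite ltnn.
- rewrite {1}/(enum _) /= /enum_mem; apply: sorted_filter; first by move=> i j k; exact: ltn_trans.
  by rewrite -enumT; have := iota_ltn_sorted 0 m; rewrite -val_enum_ord sorted_map.
- by move=> t; rewrite mem_enum.
Qed.

Section points.
Context {R : realType} {n : nat}.
Implicit Types (B : n.-tuple bool) (d : 'I_n -> R) (v : Rn R n).

(** Every point of the cube is B - d for a unique vertex B and a unique d that is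
    nonzero only on its fractional coordinates, where B is 1.  The zero coordinates
    of the point are then those of B, so that both carry the same sign. *)
Definition offset B d : Rn R n := [tuple ((tnth B t)%:R - d t : R) | t < n].
Definition round v : n.-tuple bool := [tuple (tnth v t : R) != 0 | t < n].

Lemma tnth_offset B d t : tnth (offset B d) t = (tnth B t)%:R - d t.
Proof. by rewrite tnth_mktuple. Qed.

Lemma affine_offset (a : 'I_n -> R) r B d :
  affine a r (offset B d) = affine a r (vtx B) - \sum_(t < n) a t * d t.
Proof.
rewrite /affine addrAC -sumrB; congr (_ + _); apply: eq_bigr => t _.
by rewrite tnth_offset tnth_mktuple mulrBr.
Qed.

Definition proper_offset B d := forall t, d t = 0 \/ tnth B t /\ 0 < d t < 1.

Lemma offset_cube B d : proper_offset B d -> cube (offset B d).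
Proof.
move=> sd t; rewrite tnth_offset; case: (sd t) => [->|[-> /andP[d0 d1]]].
  by rewrite subr0; case: (tnth B t); rewrite ?lexx ?ler01.
by apply/andP; split; rewrite /=; lra.
Qed.

Lemma offset_star B d : proper_offset B d -> star (offset B d) = [set t | d t != 0]%SET.
Proof.
move=> sd; apply/setP => t; rewrite !inE tnth_offset; case: (sd t) => [->|[-> /andP[d0 d1]]].
  by rewrite subr0 eqxx; case: (tnth B t); rewrite ?eqxx ?andbF.
rewrite (gt_eqF d0) /=; apply/andP; split; apply/eqP => /= h; lra.
Qed.

Lemma offset_round B d : proper_offset B d -> round (offset B d) = B.
Proof.
move=> sd; apply: eq_from_tnth => t; rewrite tnth_mktuple tnth_offset.
case: (sd t) => [->|[-> /andP[d0 d1]]].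
  by rewrite subr0; case: (tnth B t); rewrite ?eqxx ?oner_eq0.
by apply/eqP => /= h; lra.
Qed.

Lemma zeros_round v : zeros v = [set t | ~~ tnth (round v) t]%SET.
Proof. by apply/setP => t; rewrite !inE tnth_mktuple negbK. Qed.

Lemma offset_roundK v : cube v -> proper_offset (round v) (fun t => (tnth (round v) t)%:R - tnth v t) /\
  offset (round v) (fun t => (tnth (round v) t)%:R - tnth v t) = v.
Proof.
move=> cv; split; last by apply: eq_from_tnth => t; rewrite tnth_offset subKr.
move=> t; have /andP[v0 v1] := cv t; rewrite tnth_mktuple.
have [->|n0] := eqVneq (tnth v t : R) 0; first by left; rewrite subr0.
have [->|n1] := eqVneq (tnth v t : R) 1; first by left; rewrite subrr.
right; split => //; rewrite subr_gt0 lt_def eq_sym n1 v1 /=.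
by rewrite ltrBlDr ltrDl lt_def n0.
Qed.

Lemma star_round v : cube v ->
  star v = [set t | (tnth (round v) t)%:R - tnth v t != 0 :> R]%SET.
Proof. by move=> /offset_roundK[sd e]; rewrite -[in LHS]e offset_star. Qed.

Lemma F_star (d : nat) v : F d%:Z v <-> cube v /\ #|star v| = d.
Proof.
split => [[cv /= e]|[cv e]]; split => //; last by rewrite /= e.
by case: e.
Qed.

Lemma enum2 (p q : 'I_n) : (p < q)%N -> enum [set p; q]%SET = [:: p; q].
Proof. by move=> pq; apply: enum_sorted => [|t]; rewrite /= ?pq // !inE. Qed.

End points.

Section face_sums.
Context {R : realType} {n : nat}.
Hypothesis n0 : (0 < n)%N.
Implicit Types (B : n.-tuple bool) (v : Rn R n).

Let p0 : 'I_n := Ordinal n0.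

Lemma tpow_pos (z : R) : tpow n z = if 0 < z then z ^+ n else 0.
Proof.
rewrite /tpow le_eqVlt; case: eqVneq => [<-|//]; rewrite ltxx /=.
by rewrite expr0n eqn0Ngt n0.
Qed.

Lemma altsignE v : (-1) ^+ #|zeros v| = altsign (round v) :> R.
Proof. by rewrite zeros_round. Qed.

Lemma vtx_offset B : vtx B = offset B (fun=> 0) :> Rn R n.
Proof. by apply: eq_from_tnth => t; rewrite tnth_offset subr0 tnth_mktuple. Qed.

Lemma vtx_proper B : proper_offset B (fun=> 0 : R). Proof. by left. Qed.

Lemma vertex_sum (a b c : 'I_n -> R) (r : @vec R) :
  \sum_(v \in (F 0 `&` halfspace (affine a r.1.1) `&` halfspace (affine b r.1.2)
      `&` halfspace (affine c r.2)) `\` hyperplane (affine c r.2)) term0 c (affine c r.2) v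
  = \sum_B altsign B * vertex_term c (corner_values a b c r B).
Proof.
rewrite (fsbig_key (key := round) (pt := @vtx R n)); last first.
  move=> v [[[[/F_star[cv sv] _] _] _] _] _.
  have [sd e] := offset_roundK cv; apply: etrans (vtx_offset _) (etrans _ e); congr offset.
  apply/funext => t; apply/esym/eqP; have := star_round cv.
  by move/eqP: sv; rewrite cards_eq0 => /eqP -> /setP/(_ t); rewrite !inE => /esym/negbFE.
rewrite big_mkcond; apply: eq_bigr => B _.
have rB : round (vtx B : Rn R n) = B by rewrite vtx_offset offset_round //; exact: vtx_proper.
rewrite rB eqxx andbT /vertex_term /=.
case: asboolP => [[[[[_ x0] y0] z0] /= z0']|nS].
  rewrite x0 y0 /= tpow_pos lt_def z0 andbT; case: eqP => // _.
  by rewrite /term0 altsignE rB /vertex_coef !mulrA.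
case: ifP => [/andP[x0 y0]|]; last by rewrite mulr0.
rewrite tpow_pos; case: ifP => [z0|]; last by rewrite mul0r mulr0.
exfalso; apply: nS; split; last by move=> /= e; rewrite e ltxx in z0.
split; last exact: ltW; split; last by []; split; last by [].
apply/F_star; rewrite vtx_offset; split; first exact: offset_cube (vtx_proper B).
rewrite offset_star; last exact: vtx_proper.
by apply/eqP; rewrite cards_eq0; apply/eqP/setP => t; rewrite !inE eqxx.
Qed.

Lemma star1_enum v p : star v = [set p]%SET -> enum (star v) = [:: p].
Proof. by move=> ->; rewrite enum_set1. Qed.

(** The position l on an edge is determined by the equation of the hyperplane when
    d_p is not zero, and sgn(d_p) = 0 kills the term otherwise. *)
Lemma edge_sum (d e c : 'I_n -> R) (rd re rc : R) :
  let x B := affine d rd (vtx B) in let y B := affine e re (vtx B) in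
  let z B := affine c rc (vtx B) in
  \sum_(v \in (F 1 `&` hyperplane (affine d rd) `&` halfspace (affine e re)
      `&` halfspace (affine c rc)) `\` hyperplane (affine c rc)) term1 d c (affine c rc) v
  = \sum_(p < n) \sum_(B : n.-tuple bool | tnth B p) altsign B * edge_term c d e p (x B) (y B) (z B).
Proof.
move=> x y z; set S := _ `\` _; pose lam (j : 'I_n * n.-tuple bool) := x j.2 / d j.1.
pose dl (j : 'I_n * n.-tuple bool) t := (t == j.1)%:R * lam j.
have sum1 (f : 'I_n -> R) (p : 'I_n) l : \sum_(t < n) f t * ((t == p)%:R * l) = f p * l.
  rewrite (bigD1 p) //= eqxx mul1r big1 ?addr0 // => t /negbTE ->.
  by rewrite mul0r mulr0.
rewrite (fsbig_key (key := fun v => (nth p0 (enum (star v)) 0, round v))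
    (pt := fun j => offset j.2 (dl j))); last first.
  move=> v [[[[/F_star[cv /eqP/cards1P[p sv]] xv] _] _] _] tv /=.
  move: tv; rewrite /term1 (star1_enum sv) /= => tv.
  have dp : d p != 0 by apply: contraNneq tv => ->; rewrite sgr0 mulr0 !mul0r.
  have [sd e'] := offset_roundK cv; apply: (etrans _ e'); congr offset.
  have z' t : t != p -> (tnth (round v) t)%:R - tnth v t = 0 :> R.
    move=> tp; apply/eqP; have := star_round cv; rewrite sv => /setP/(_ t); rewrite !inE.
    by rewrite (negbTE tp) => /esym/negbFE.
  apply/funext => t; rewrite /dl /=; have [->|tp] := eqVneq t p; last by rewrite mul0r z'.
  rewrite mul1r; apply: (mulIf dp); rewrite divfK //.
  move: xv; rewrite /hyperplane /= -[in affine _ _ v]e' affine_offset.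
  rewrite (eq_bigr (fun t => d t * ((t == p)%:R * ((tnth (round v) p)%:R - tnth v p)))).
    by rewrite sum1 => /eqP; rewrite subr_eq0 mulrC => /eqP.
  by move=> s _; have [->|sp] := eqVneq s p; [rewrite mul1r|rewrite (z' _ sp) mul0r].
rewrite [RHS]pair_big_dep /= big_mkcond [RHS]big_mkcond /=; apply: eq_bigr => -[p B] _ /=.
have aE (f : 'I_n -> R) rf : affine f rf (offset B (dl (p, B))) = affine f rf (vtx B) - lam (p, B) * f p.
  by rewrite affine_offset sum1 mulrC.
set v := offset _ _ in aE *.
have condE : (`[< S v >] && ((nth p0 (enum (star v)) 0, round v) == (p, B))) =
    tnth B p && (0 < x B / d p < 1) && (0 <= y B - x B / d p * e p) &&
    (0 < z B - x B / d p * c p).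
  apply/andP/idP.
    move=> [/asboolP[[[[/F_star[cv /eqP/cards1P[q sv]] xv] hv] kv] kv'] /eqP[e1 e2]].
    move: e1; rewrite (star1_enum sv) /= => qp; subst q.
    have [sd _] := offset_roundK cv; have := star_round cv; rewrite sv => /setP/(_ p).
    rewrite !inE eqxx => /esym; have := sd p; rewrite e2 /v tnth_offset /dl /= eqxx mul1r subKr.
    move=> [->|[-> ->]]; rewrite ?eqxx // => _ /=; rewrite lt_def.
    by move: hv kv kv'; rewrite /halfspace /hyperplane /= !aE => -> -> /eqP ->.
  move=> /andP[/andP[/andP[Bp l01] y0] z1].
  have dp : d p != 0.
    by apply: contraTneq l01 => ->; rewrite invr0 mulr0 ltxx.
  have sd : proper_offset B (dl (p, B)).
    move=> t; rewrite /dl /=; have [->|_] := eqVneq t p; last by left; rewrite mul0r.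
    by right; rewrite mul1r.
  have sv : star v = [set p]%SET.
    rewrite offset_star //; apply/setP => t; rewrite !inE /dl /=; have [_|_] := eqVneq t p.
      by rewrite mul1r /lam /=; move: l01 => /andP[/gt_eqF ->].
    by rewrite mul0r eqxx.
  split; last by rewrite (star1_enum sv) /= offset_round.
  apply/asboolP; split; last by rewrite /hyperplane /= aE => /eqP; rewrite gt_eqF.
  split; last by rewrite /halfspace /= aE ltW.
  split; last by rewrite /halfspace /= aE.
  split; last by rewrite /hyperplane /= aE /lam /= divfK // subrr.
  by apply/F_star; split; [exact: offset_cube|rewrite sv cards1].
rewrite condE; case: ifP => [|nc]; last first.
  case: ifP => // Bp; move: nc; rewrite Bp /edge_term tpow_pos /=.
  case: ifP => [/andP[l01 y1] nc|_ _]; last by rewrite mulr0.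
  by move: nc => /= ->; rewrite mul0r mulr0.
move=> h; have := h; rewrite -condE => /andP[/asboolP[[[[/F_star[cv /eqP/cards1P[q sv]] _] _] _] _] /eqP[e1 e2]].
move: e1; rewrite (star1_enum sv) /= => qp; subst q.
move: h => /andP[/andP[/andP[-> l01] y0] z1].
rewrite /edge_term l01 y0 /= tpow_pos z1 /term1 (star1_enum sv) /bullet sv altsignE e2 aE /edge_coef.
by rewrite !mulrA /lam /=; ring.
Qed.

Lemma star2_enum v (p q : 'I_n) : (p < q)%N -> star v = [set p; q]%SET -> enum (star v) = [:: p; q].
Proof. by move=> pq ->; rewrite enum2. Qed.

Lemma card2_sorted (A : {set 'I_n}) : #|A| = 2 ->
  exists p q : 'I_n, (p < q)%N /\ A = [set p; q]%SET.
Proof.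
move=> /eqP/cards2P[p [q [pq ->]]]; case: (ltngtP p q) => h.
- by exists p, q.
- by exists q, p; rewrite finset.setUC.
- by move: pq; rewrite -val_eqE /= h eqxx.
Qed.

(** Cramer's rule determines the position (l, m) in the face when D is not zero, and
    sgn(D) = 0 kills the term otherwise. *)
Lemma face_sum (a b c : 'I_n -> R) (r : @vec R) :
  \sum_(v \in (F 2 `&` hyperplane (affine a r.1.1) `&` hyperplane (affine b r.1.2)
      `&` halfspace (affine c r.2)) `\` hyperplane (affine c r.2)) term2 a b c (affine c r.2) v
  = \sum_(p < n) \sum_(q < n | (p < q)%N) \sum_(B : n.-tuple bool | tnth B p && tnth B q)
      altsign B * face_term a b c p q (corner_values a b c r B).
Proof.
set S := _ `\` _; pose w := coefrow a b c; pose g := corner_values a b c r.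
pose J := ('I_n * 'I_n * n.-tuple bool)%type.
pose D (j : J) := wedge (w j.1.1) (w j.1.2).
pose lam (j : J) := wedge (g j.2) (w j.1.2) / D j.
pose mu (j : J) := wedge (w j.1.1) (g j.2) / D j.
pose dl (j : J) t := (t == j.1.1)%:R * lam j + (t == j.1.2)%:R * mu j.
have sum2 (f : 'I_n -> R) (p q : 'I_n) l m : \sum_(t < n) f t * ((t == p)%:R * l + (t == q)%:R * m) =
    f p * l + f q * m.
  have s1 (k : 'I_n) x : \sum_(t < n) f t * ((t == k)%:R * x) = f k * x.
    rewrite (bigD1 k) //= eqxx mul1r big1 ?addr0 // => t /negbTE ->.
    by rewrite mul0r mulr0.
  by rewrite -!s1 -big_split /=; apply: eq_bigr => t _; rewrite mulrDr.
rewrite (fsbig_key (key := fun v => (nth p0 (enum (star v)) 0, nth p0 (enum (star v)) 1, round v))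
    (pt := fun j => offset j.2 (dl j))); last first.
  move=> v [[[[/F_star[cv /card2_sorted[p [q [pq sv]]]] av] bv] _] _] tv /=.
  have pnq : p != q by rewrite -val_eqE /= ltn_eqF.
  move: tv; rewrite /term2 (star2_enum pq sv) /= => tv.
  have dp : wedge (w p) (w q) != 0.
    by rewrite /w -det2_row; apply: contraNneq tv => ->; rewrite sgr0 mulr0 !mul0r.
  have [sd e'] := offset_roundK cv; apply: (etrans _ e'); congr offset.
  set dv := (fun t => _ - _ : R) in e' *.
  have z' t : t != p -> t != q -> dv t = 0.
    move=> tp tq; apply/eqP; have := star_round cv; rewrite sv => /setP/(_ t); rewrite !inE.
    by rewrite (negbTE tp) (negbTE tq) => /esym/negbFE.
  have dvE t : dv t = (t == p)%:R * dv p + (t == q)%:R * dv q.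
    have [->|tp] := eqVneq t p; first by rewrite (negbTE pnq) mul0r addr0 mul1r.
    have [->|tq] := eqVneq t q; first by rewrite mul0r add0r mul1r.
    by rewrite z' // !mul0r addr0.
  have eq0 (f : 'I_n -> R) rf : affine f rf v = 0 ->
      affine f rf (vtx (round v)) = f p * dv p + f q * dv q.
    rewrite -[in affine _ _ v]e' affine_offset (eq_bigr _ (fun t _ => congr1 ( *%R (f t)) (dvE t))).
    by rewrite sum2 => /eqP; rewrite subr_eq0 => /eqP.
  have xa := eq0 _ _ av; have yb := eq0 _ _ bv.
  apply/funext => t; rewrite dvE /dl /=; congr (_ * _ + _ * _).
    apply: (mulIf dp); rewrite /lam /D /= divfK // [in LHS]/wedge /= xa yb /w /wedge /=; ring.
  apply: (mulIf dp); rewrite /mu /D /= divfK // [in LHS]/wedge /= xa yb /w /wedge /=; ring.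
transitivity (\sum_(j : J | (j.1.1 < j.1.2)%N && (tnth j.2 j.1.1 && tnth j.2 j.1.2))
    altsign j.2 * face_term a b c j.1.1 j.1.2 (g j.2)); last first.
  rewrite [RHS](eq_bigr (fun p : 'I_n => \sum_(q : 'I_n * n.-tuple bool |
      (p < q.1)%N && (tnth q.2 p && tnth q.2 q.1))
      altsign q.2 * face_term a b c p q.1 (g q.2))); last by move=> p _; rewrite pair_big_dep.
  rewrite [RHS]pair_big_dep /= (reindex (fun j : 'I_n * ('I_n * n.-tuple bool) => (j.1, j.2.1, j.2.2))) //=.
  by exists (fun j : J => (j.1.1, (j.1.2, j.2))) => [[p [q B]] _|[[p q] B] _].
rewrite big_mkcond [RHS]big_mkcond /=; apply: eq_bigr => -[[p q] B] _ /=.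
have aE (f : 'I_n -> R) rf : affine f rf (offset B (dl (p, q, B))) =
    affine f rf (vtx B) - lam (p, q, B) * f p - mu (p, q, B) * f q.
  by rewrite affine_offset sum2; ring.
set v := offset _ _ in aE *.
set l := lam (p, q, B) in aE *; set m := mu (p, q, B) in aE *.
have lE : l = wedge (g B) (w q) / wedge (w p) (w q) by [].
have mE : m = wedge (w p) (g B) / wedge (w p) (w q) by [].
have condE : (`[< S v >] &&
    ((nth p0 (enum (star v)) 0, nth p0 (enum (star v)) 1, round v) == (p, q, B))) =
    [&& (p < q)%N, tnth B p && tnth B q, 0 < l < 1, 0 < m < 1 &
    (0 < (g B).2 - l * c p - m * c q)].
  apply/andP/idP.
    move=> [/asboolP[[[[/F_star[cv /card2_sorted[p' [q' [pq sv]]]] xv] hv] kv] kv'] /eqP[e1 e2 e3]].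
    move: e1 e2; rewrite (star2_enum pq sv) /= => pp qq; subst p' q'.
    have pnq : p != q by rewrite -val_eqE /= ltn_eqF.
    have [sd _] := offset_roundK cv; have := star_round cv; rewrite sv => /setP sE.
    have := sE q; have := sE p; rewrite !inE !eqxx orbT /= => /esym hp /esym hq.
    have := sd p; have := sd q; move: hp hq; rewrite e3 /v !tnth_offset /dl /= !eqxx (negbTE pnq).
    rewrite (eq_sym q p) (negbTE pnq) !mul1r !mul0r addr0 add0r !subKr -/l -/m.
    move=> l0 m0 [|[-> ->]] => [m00|]; first by rewrite m00 eqxx in m0.
    move=> [l00|[-> ->]]; first by rewrite l00 eqxx in l0.
    rewrite pq /= lt_def.
    by move: kv kv'; rewrite /halfspace /hyperplane /= !aE => -> /eqP ->.
  move=> /and5P[pq /andP[Bp Bq] l01 m01 z1].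
  have pnq : p != q by rewrite -val_eqE /= ltn_eqF.
  have dp : wedge (w p) (w q) != 0.
    by apply: contraTneq l01 => D0; rewrite lE D0 invr0 mulr0 ltxx.
  have dlE t : dl (p, q, B) t = if t == p then l else if t == q then m else 0.
    rewrite /dl /= -/l -/m; have [->|_] := eqVneq t p.
      by rewrite (negbTE pnq) mul1r mul0r addr0.
    by have [_|_] := eqVneq t q; rewrite ?mul1r ?mul0r ?addr0 ?add0r.
  have sd : proper_offset B (dl (p, q, B)).
    move=> t; rewrite dlE; have [->|_] := eqVneq t p; first by right.
    by have [->|_] := eqVneq t q; [right|left].
  have sv : star v = [set p; q]%SET.
    rewrite offset_star //; apply/setP => t; rewrite !inE dlE; have [_|_] := eqVneq t p.
      by move: l01 => /andP[/gt_eqF ->].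
    have [_|_] := eqVneq t q; first by move: m01 => /andP[/gt_eqF ->].
    by rewrite eqxx.
  split; last by rewrite (star2_enum pq sv) /= offset_round.
  apply/asboolP; split; last by rewrite /hyperplane /= aE => /eqP; rewrite gt_eqF.
  split; last by rewrite /halfspace /= aE ltW.
  split; last first.
    rewrite /hyperplane /= aE lE mE; apply: (mulIf dp); rewrite mul0r.
    rewrite -[affine b _ _]/(g B).1.2 /wedge /= in dp *; field; exact: dp.
  split; last first.
    rewrite /hyperplane /= aE lE mE; apply: (mulIf dp); rewrite mul0r.
    rewrite -[affine a _ _]/(g B).1.1 /wedge /= in dp *; field; exact: dp.
  by apply/F_star; split; [exact: offset_cube|rewrite sv cards2 pnq].
rewrite condE; case: ifP => [|nc]; last first.
  case: ifP => // /andP[pq /andP[Bp Bq]]; move: nc; rewrite pq Bp Bq /face_term tpow_pos /=.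
  rewrite -/w -lE -mE; case: ifP => [/andP[l01 m01] nc|_ _]; last by rewrite mulr0.
  by move: nc; rewrite l01 m01 /= => ->; rewrite mul0r mulr0.
move=> h; have := h; rewrite -condE.
move=> /andP[/asboolP[[[[/F_star[cv /card2_sorted[p' [q' [pq sv]]]] _] _] _] _] /eqP[e1 e2 e3]].
move: e1 e2; rewrite (star2_enum pq sv) /= => pp qq; subst p' q'.
move: h => /and5P[_ -> l01 m01 z1]; rewrite pq /=.
rewrite /face_term -/w -lE -mE l01 m01 /= tpow_pos z1 /term2 (star2_enum pq sv) /bullet sv altsignE e3 aE /face_coef.
by rewrite /g /= !mulrA; ring.
Qed.

End face_sums.

(** * Continuity of the volume *)

Section volume_limit.
Context {R : realType}.

Lemma measurable_halfspace n (a : 'I_n -> R) r : measurable (halfspace (affine a r)).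
Proof. by apply: measurable_ge0; exact: measurable_affine. Qed.

Lemma measurable_hyperplane n (a : 'I_n -> R) r : measurable (hyperplane (affine a r)).
Proof.
rewrite -[X in measurable X]setTI; have := @measurable_affine R n a r measurableT [set 0] (measurable_set1 _).
by [].
Qed.

Lemma slice_hyperplane n (a : 'I_n.+1 -> R) r (s : R) :
  xsection (@tcons R n @^-1` hyperplane (affine a r)) s =
  hyperplane (affine (a \o lift ord0) (a ord0 * s + r)).
Proof.
have e x : affine a r (tcons (s, x)) = affine (a \o lift ord0) (a ord0 * s + r) x.
  rewrite /affine big_ord_recl tnth0 (eq_bigr (fun t => (a \o lift ord0) t * tnth x t)).
    by rewrite /=; ring.
  by move=> t _; rewrite tnthS.
by rewrite /xsection; apply/seteqP; split => x /=; rewrite inE /hyperplane /= e.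
Qed.

(** If some later coefficient is nonzero every slice is a hyperplane of lower
    dimension; otherwise only one slice is nonempty. *)
Lemma vol_hyperplane n (a : 'I_n -> R) r : (exists t, a t != 0) -> vol (hyperplane (affine a r)) = 0%E.
Proof.
elim: n a r => [|n IH] a r [t at0]; first by case: t at0.
rewrite vol_slice.
have [[u u0]|none] := pselect (exists u, (a \o lift ord0) u != 0).
  rewrite (eq_integral (cst 0%E)) ?integral0 // => s _ /=.
  by rewrite slice_hyperplane; apply: IH; exists u.
have az u : (a \o lift ord0) u = 0 by apply/eqP; apply: contra_notT none => h; exists u.
have a0 : a ord0 != 0.
  have [j tj|e] := unliftP ord0 t; last by rewrite -e.
  by move: at0; rewrite tj -[a _]/((a \o lift ord0) j) az eqxx.
rewrite (ae_eq_integral (cst 0%E)) ?integral0 //.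
- by apply: measurable_slice; exact: measurable_hyperplane.
- exists [set - r / a ord0]; split => //; first exact: lebesgue_measure_set1.
  move=> s /=; apply: contra_notP => sn _; rewrite slice_hyperplane.
  rewrite (_ : hyperplane _ = set0) ?measure0 //; apply/seteqP; split => // x /=.
  rewrite /hyperplane /affine /= big1 ?add0r; last by move=> u _; rewrite [a _]az mul0r.
  by move=> e; apply: sn; apply: (mulfI a0); rewrite mulrC [RHS]mulrC divfK //; lra.
Qed.

Lemma vol_cube n : @vol R n cube = 1%E.
Proof.
have := @vol_box R n (fun=> [set` `[0, 1]]) (fun=> measurable_itv _).
rewrite big1; last by move=> i _; rewrite lebesgue_measure_itv /= lte_fin ltr01 oppr0 adde0.
move=> <-; congr (vol _); apply/seteqP; split => x /= H i; have := H i; by rewrite in_itv.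
Qed.

Lemma cvg_affine n (a_ : nat -> 'I_n -> R) (a : 'I_n -> R) (r_ : nat -> R) (r : R) (x : Rn R n) :
  (forall t, a_ k t @[k --> \oo] --> a t) -> r_ @ \oo --> r ->
  affine (a_ k) (r_ k) x @[k --> \oo] --> affine a r x.
Proof.
move=> ca cr; apply: cvgD => //.
apply: cvg_big => [|t _]; first exact: add_continuous.
by apply: cvgM; [exact: ca|exact: cvg_cst].
Qed.

Lemma near_sign (u_ : nat -> R) (u : R) : u_ @ \oo --> u -> u != 0 ->
  \forall k \near \oo, (0 <= u_ k) = (0 <= u).
Proof.
move=> cu; case: (ltgtP u 0) => // u0 _.
- by apply: filterS (cvgr_lt _ cu _ u0) => k; rewrite ltNge => /negbTE.
- by apply: filterS (cvgr_gt _ cu _ u0) => k /ltW ->.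
Qed.

(** Off the three limit hyperplanes the indicators are eventually constant, and they
    are dominated by that of the cube. *)
Lemma vol_cvg n (a_ b_ c_ : nat -> 'I_n -> R) (a b c : 'I_n -> R) (ra_ rb_ rc_ : nat -> R) (ra rb rc : R) :
  (forall t, a_ k t @[k --> \oo] --> a t) -> (forall t, b_ k t @[k --> \oo] --> b t) ->
  (forall t, c_ k t @[k --> \oo] --> c t) ->
  ra_ @ \oo --> ra -> rb_ @ \oo --> rb -> rc_ @ \oo --> rc ->
  (exists t, a t != 0) -> (exists t, b t != 0) -> (exists t, c t != 0) ->
  vol (cube `&` halfspace (affine (a_ k) (ra_ k)) `&` halfspace (affine (b_ k) (rb_ k))
     `&` halfspace (affine (c_ k) (rc_ k))) @[k --> \oo] -->
  vol (cube `&` halfspace (affine a ra) `&` halfspace (affine b rb) `&` halfspace (affine c rc)).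
Proof.
move=> ca cb cc cra crb crc a0 b0 c0.
pose V_ k := cube `&` halfspace (affine (a_ k) (ra_ k)) `&` halfspace (affine (b_ k) (rb_ k))
     `&` halfspace (affine (c_ k) (rc_ k)).
pose V := cube `&` halfspace (affine a ra) `&` halfspace (affine b rb) `&` halfspace (affine c rc).
have mV (a' b' c' : 'I_n -> R) r1 r2 r3 : measurable (cube `&` halfspace (affine a' r1)
   `&` halfspace (affine b' r2) `&` halfspace (affine c' r3)).
  by do 3 (apply: measurableI; last exact: measurable_halfspace); exact: measurable_cube.
have vI (A : set (Rn R n)) : measurable A -> vol A = (\int[@vol R n]_x (\1_A x)%:E)%E.
  by move=> mA; rewrite integral_indic // setIT.
rewrite -/V (vI V); last exact: mV.
rewrite (_ : (fun k => _) = (fun k => \int[@vol R n]_x (\1_(V_ k) x)%:E)%E); last first.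
  by apply/funext => k; rewrite -vI //; exact: mV.
have mi (A : set (Rn R n)) : measurable A -> measurable_fun setT (fun x => (\1_A x)%:E : \bar R).
  by move=> mA; apply/measurable_EFinP; exact: measurable_indic.
have [] // := @dominated_convergence _ _ R (@vol R n) setT measurableT
  (fun k x => (\1_(V_ k) x)%:E) (fun x => (\1_V x)%:E) (fun x => (\1_cube x)%:E).
- by move=> k; apply: mi; exact: mV.
- by apply: mi; exact: mV.
- have nul d rd : (exists t, d t != 0) -> (@vol R n).-negligible (hyperplane (affine d rd)).
    move=> d0; apply/negligibleP; [exact: measurable_hyperplane|exact: vol_hyperplane].
  apply: negligibleS (negligibleU (negligibleU (nul a ra a0) (nul b rb b0)) (nul c rc c0)).
  move=> x /=; apply: contra_notP => /not_orP[/not_orP[/eqP xa /eqP xb] /eqP xc] _.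
  apply: cvg_near_cst.
  (* Off its limit hyperplane, each affine function has eventually its limit sign. *)
  have na := near_sign (cvg_affine (x := x) ca cra) xa.
  have nb := near_sign (cvg_affine (x := x) cb crb) xb.
  have nc := near_sign (cvg_affine (x := x) cc crc) xc.
  apply: filterS3 na nb nc => k ea eb ec; congr (_%:E); rewrite !indicE; congr (_%:R : R).
  by congr nat_of_bool; apply/idP/idP => /set_mem [[[xv +] +] +]; rewrite /halfspace /= => h1 h2 h3;
    apply/mem_set; rewrite /V_ /V /halfspace /= in h1 h2 h3 *;
    rewrite ?ea ?eb ?ec in h1 h2 h3 *; split => //; split.
- apply/integrableP; split; first by apply: mi; exact: measurable_cube.
  under eq_integral do rewrite gee0_abs ?lee_fin ?indicE ?ler0n //.
  rewrite (_ : integral _ _ _ = (\int[@vol R n]_x (\1_cube x)%:E)%E); last first.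
    by apply: eq_integral => x _; rewrite indicE.
  by rewrite -vI ?vol_cube ?ltry //; exact: measurable_cube.
- apply: aeW => x k _; rewrite gee0_abs ?lee_fin ?indicE ?ler0n // ler_nat.
  by case: (boolP (x \in V_ k)) => // /set_mem[[[xc _] _] _]; rewrite mem_set.
Qed.

End volume_limit.

(** * Closed conditions implied by good clipping *)

Section stability.
Context {R : realType} {n : nat}.
Implicit Types (B : n.-tuple bool) (v : Rn R n) (a b c d e : 'I_n -> R) (p q t : 'I_n).

(** The hypotheses of the three stability conditions are weak inequalities, so that
    their failure persists under perturbation, and the conclusions are strict, so
    that they persist as well. *)
Definition vertex_stable a b c (r : @vec R) := forall B, let P := corner_values a b c r B in
  0 <= P.1.1 -> 0 <= P.1.2 -> 0 <= P.2 ->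
  [/\ 0 < P.1.1, 0 < P.1.2 & forall t, c t != 0].

Definition edge_stable d e c (rd re rc : R) := forall p B (l : R), tnth B p -> 0 <= l <= 1 ->
  affine d rd (vtx B) = l * d p -> 0 <= affine e re (vtx B) - l * e p ->
  0 <= affine c rc (vtx B) - l * c p ->
  [/\ 0 < l < 1, d p != 0, 0 < affine e re (vtx B) - l * e p, c p != 0 &
    forall t, t != p -> det2 (d p) (c p) (d t) (c t) != 0].

Definition face_stable a b c (r : @vec R) := forall p q B (l m : R), let P := corner_values a b c r B in
  (p < q)%N -> tnth B p -> tnth B q -> 0 <= l <= 1 -> 0 <= m <= 1 ->
  P.1.1 = l * a p + m * a q -> P.1.2 = l * b p + m * b q ->
  0 <= P.2 - l * c p - m * c q ->
  [/\ 0 < l < 1, 0 < m < 1, det2 (a p) (b p) (a q) (b q) != 0 &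
   [/\ det2 (a p) (c p) (a q) (c q) != 0, det2 (b p) (c p) (b q) (c q) != 0 &
    forall t, t != p -> t != q ->
     det3 (a p) (b p) (c p) (a q) (b q) (c q) (a t) (b t) (c t) != 0]].

Lemma offset_closed B d : (forall t, d t = 0 \/ tnth B t /\ 0 <= d t <= 1) ->
  cube (offset B d) /\ star (offset B d) = [set t | 0 < d t < 1]%SET.
Proof.
move=> sd; split.
  move=> t; rewrite tnth_offset; case: (sd t) => [->|[-> /andP[d0 d1]]].
    by rewrite subr0; case: (tnth B t); rewrite ?lexx ?ler01.
  by apply/andP; split; rewrite /=; lra.
apply/setP => t; rewrite !inE tnth_offset; case: (sd t) => [->|[-> /andP[d0 d1]]].
  by rewrite subr0 ltxx /=; case: (tnth B t); rewrite ?eqxx ?andbF.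
rewrite !lt_def d0 d1 !andbT /= andbC; congr (~~ _ && ~~ _); apply/eqP/eqP => h; lra.
Qed.

Definition edge_pt B p (l : R) := offset B (fun t => (t == p)%:R * l).
Definition face_pt B p q (l m : R) := offset B (fun t => (t == p)%:R * l + (t == q)%:R * m).

Lemma affine_edge d r B p l : affine d r (edge_pt B p l) = affine d r (vtx B) - l * d p.
Proof.
rewrite affine_offset (bigD1 p) //= eqxx mul1r big1 ?addr0 1?mulrC // => t /negbTE ->.
by rewrite mul0r mulr0.
Qed.

Lemma affine_face d r B p q l m : p != q ->
  affine d r (face_pt B p q l m) = affine d r (vtx B) - l * d p - m * d q.
Proof.
move=> pq; have qp : q != p by rewrite eq_sym.
rewrite affine_offset (bigD1 p) //= (bigD1 q) //= !eqxx (negbTE pq) (negbTE qp).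
rewrite big1; first by rewrite /=; ring.
by move=> t /andP[/negbTE -> /negbTE ->]; rewrite !mul0r addr0 mulr0.
Qed.

Lemma edge_ptP B p l : tnth B p -> 0 <= l <= 1 -> cube (edge_pt B p l) /\
  star (edge_pt B p l) = [set t | (t == p) && (0 < l < 1)]%SET.
Proof.
move=> Bp l01; have [t|cv sv] := @offset_closed B (fun t => (t == p)%:R * l).
  by have [->|_] := eqVneq t p; [right; rewrite mul1r|left; rewrite mul0r].
split => //; rewrite [LHS]sv; apply/setP => t; rewrite !inE.
by have [_|_] := eqVneq t p; rewrite ?mul1r ?mul0r ?ltxx.
Qed.

Lemma face_ptP B p q l m : p != q -> tnth B p -> tnth B q -> 0 <= l <= 1 -> 0 <= m <= 1 ->
  cube (face_pt B p q l m) /\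
  star (face_pt B p q l m) = [set t | (t == p) && (0 < l < 1) || (t == q) && (0 < m < 1)]%SET.
Proof.
move=> pq Bp Bq l01 m01; have [t|cv sv] := @offset_closed B (fun t => (t == p)%:R * l + (t == q)%:R * m).
  have [->|_] := eqVneq t p; first by right; rewrite (negbTE pq) mul1r mul0r addr0.
  by have [->|_] := eqVneq t q; [right; rewrite mul1r mul0r add0r|left; rewrite !mul0r addr0].
split => //; rewrite [LHS]sv; apply/setP => t; rewrite !inE.
have [->|_] := eqVneq t p; first by rewrite (negbTE pq) mul1r mul0r addr0 orbF.
by have [_|_] := eqVneq t q; rewrite ?mul1r ?mul0r ?add0r ?ltxx.
Qed.

Definition no_vertex d e c (rd re rc : R) := forall v, F 0 v -> affine d rd v = 0 ->
  0 <= affine e re v -> 0 < affine c rc v -> False.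
Definition no_edge d e c (rd re rc : R) := forall v, F 1 v -> affine d rd v = 0 ->
  affine e re v = 0 -> 0 < affine c rc v -> False.

(** Since g3 - eps >= 0 implies g3 > 0, the conditions of good clipping apply to the
    point.  It is interior to its edge, for there is no such vertex on the
    hyperplane, and off the second hyperplane, for there is no such edge point on
    both. *)
Lemma edge_clip d e c rd re rc : no_vertex d e c rd re rc -> no_edge d e c rd re rc ->
  (forall v p, cube v -> star v = [set p]%SET -> affine d rd v = 0 -> 0 <= affine e re v ->
     0 < affine c rc v -> c p != 0 /\ forall t, t != p -> det2 (d p) (c p) (d t) (c t) != 0) ->
  forall eps, 0 < eps -> edge_stable d e c rd re (rc - eps).
Proof.
move=> A1 A12 B1 eps eps0 p B l Bp l01 x0 y0 z0.
have {}z0 : 0 < affine c rc (vtx B) - l * c p.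
  by move: z0; rewrite /affine; lra.
set y := affine e re _ in y0 *; set z := affine c rc _ in z0.
have inner k : 0 <= k <= 1 -> affine d rd (vtx B) = k * d p -> 0 <= y - k * e p ->
    0 < z - k * c p -> 0 < k < 1.
  move=> k01 xk yk zk; apply: contraT => nk.
  have [cv sv] := edge_ptP Bp k01.
  exfalso; apply: (A1 (edge_pt B p k)); rewrite ?affine_edge ?xk ?subrr //.
  apply/F_star; split => //; rewrite sv; apply/eqP; rewrite cards_eq0; apply/eqP/setP => t.
  by rewrite !inE (negbTE nk) andbF.
have starp k : 0 < k < 1 -> cube (edge_pt B p k) /\ star (edge_pt B p k) = [set p]%SET.
  move=> k01; have [|cv ->] := @edge_ptP B p k Bp; first by move: k01 => /andP[? ?]; rewrite !ltW.
  by split => //; apply/setP => t; rewrite !inE k01 andbT.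
have yne k : 0 < k < 1 -> affine d rd (vtx B) = k * d p -> 0 < z - k * c p -> y - k * e p != 0.
  move=> k01 xk zk; apply/eqP => yk; have [cv sv] := starp k k01.
  apply: (A12 (edge_pt B p k)); rewrite ?affine_edge ?xk ?subrr //.
  by apply/F_star; rewrite sv cards1.
have l01' := inner l l01 x0 y0 z0.
have y1 : 0 < y - l * e p by rewrite lt_def yne.
have [cv sv] := starp l l01'.
have [c0 dets] : c p != 0 /\ forall t, t != p -> det2 (d p) (c p) (d t) (c t) != 0.
  by apply: (B1 (edge_pt B p l)); rewrite ?affine_edge ?x0 ?subrr.
split => //; apply/eqP => d0.
have x00 k : affine d rd (vtx B) = k * d p by rewrite x0 d0 !mulr0.
(* The whole edge lies in the first hyperplane: walk along it to its end f on
   the side where the third function does not decrease. *)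
pose f : R := (c p < 0)%R%:R.
have f01 : 0 <= f <= 1 by rewrite /f; case: (c p < 0); rewrite ?lexx ?ler01.
have nf : ~~ (0 < f < 1) by rewrite /f; case: (c p < 0); rewrite /= ?ltxx ?andbF.
have zk k : (k - l) * c p <= 0 -> 0 < z - k * c p.
  by move=> h; have := z0; lra.
have fl : (f - l) * c p <= 0.
  move: l01' => /andP[l1 l2]; rewrite /f; case: ltP => c1 /=; nra.
case: (leP 0 (y - f * e p)) => yf.
  by move: nf; rewrite (inner f) // zk.
(* On the way the second function vanishes, at a point of both hyperplanes. *)
pose s := (y - l * e p) / (f * e p - l * e p).
have den : 0 < f * e p - l * e p by lra.
have s01 : 0 < s < 1.
  by rewrite /s divr_gt0 //= ltr_pdivrMr // mul1r; lra.
have ys : y - (l + s * (f - l)) * e p = 0.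
  have : s * (f * e p - l * e p) = y - l * e p by rewrite /s divfK // gt_eqF.
  by lra.
have k01 : 0 < l + s * (f - l) < 1.
  by move: l01' s01 f01 => /andP[? ?] /andP[? ?] /andP[? ?]; apply/andP; split; nra.
have := yne _ k01 (x00 _); rewrite ys eqxx => /(_ _)/negP; apply => //.
apply: zk; rewrite addrAC subrr add0r -mulrA.
by move: s01 => /andP[? ?]; rewrite pmulr_rle0.
Qed.

Lemma segment_exit (l u : R) : 0 < l < 1 -> u != 0 -> exists2 s, 0 < s &
  (l + s * u = 0 \/ l + s * u = 1) /\ forall s', 0 <= s' <= s -> 0 <= l + s' * u <= 1.
Proof.
move=> /andP[l0 l1] u0; case: (ltgtP u 0) u0 => // hu _.
  exists (l / - u); first by rewrite divr_gt0 // oppr_gt0.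
  have e : l / - u * u = - l by field; rewrite lt_eqF.
  split; first by left; rewrite e subrr.
  by move=> s' /andP[s0 s1]; apply/andP; split; nra.
exists ((1 - l) / u); first by rewrite divr_gt0 // subr_gt0.
have e : (1 - l) / u * u = 1 - l by rewrite divfK // gt_eqF.
split; first by right; rewrite e; ring.
by move=> s' /andP[s0 s1]; apply/andP; split; nra.
Qed.

(** Of the exit times given by [segment_exit] for the two coordinates that move, the
    smaller one is taken. *)
Lemma square_exit (l m u w : R) : 0 < l < 1 -> 0 < m < 1 -> (u != 0) || (w != 0) ->
  exists s, [/\ 0 <= s, 0 <= l + s * u <= 1, 0 <= m + s * w <= 1 &
    ~~ ((0 < l + s * u < 1) && (0 < m + s * w < 1))].
Proof.
move=> l01 m01 uw.
have bd (x : R) : x = 0 \/ x = 1 -> ~~ (0 < x < 1).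
  by case=> ->; rewrite ltxx ?andbF.
have [u0|u0] := eqVneq u 0.
  have w0 : w != 0 by move: uw; rewrite u0 eqxx.
  have [s s0 [e h]] := segment_exit m01 w0; exists s; split; first exact: ltW.
  - by rewrite u0 mulr0 addr0; move: l01 => /andP[? ?]; rewrite !ltW.
  - by apply: h; rewrite lexx ltW.
  - by rewrite negb_and (bd _ e) orbT.
have [s s0 [e h]] := segment_exit l01 u0.
have [w0|w0] := eqVneq w 0.
  exists s; split; first exact: ltW.
  - by apply: h; rewrite lexx ltW.
  - by rewrite w0 mulr0 addr0; move: m01 => /andP[? ?]; rewrite !ltW.
  - by rewrite negb_and (bd _ e).
have [s' s'0 [e' h']] := segment_exit m01 w0.
have [ss|ss] := leP s s'.
  exists s; split; first exact: ltW.
  - by apply: h; rewrite lexx ltW.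
  - by apply: h'; rewrite ss ltW.
  - by rewrite negb_and (bd _ e).
exists s'; split; first exact: ltW.
- by apply: h; rewrite !ltW.
- by apply: h'; rewrite lexx ltW.
- by rewrite negb_and (bd _ e') orbT.
Qed.

Lemma face_clip a b c (r : @vec R) : no_vertex a b c r.1.1 r.1.2 r.2 ->
  no_edge a b c r.1.1 r.1.2 r.2 ->
  (forall v p q, (p < q)%N -> cube v -> star v = [set p; q]%SET -> affine a r.1.1 v = 0 ->
     affine b r.1.2 v = 0 -> 0 < affine c r.2 v ->
   [/\ det2 (a p) (c p) (a q) (c q) != 0, det2 (b p) (c p) (b q) (c q) != 0 &
    forall t, t != p -> t != q ->
     det3 (a p) (b p) (c p) (a q) (b q) (c q) (a t) (b t) (c t) != 0]) ->
  forall eps, 0 < eps -> face_stable a b c (r.1, r.2 - eps).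
Proof.
move=> A1 A12 B12 eps eps0 p q B l m P pq Bp Bq l01 m01 x0 y0 z0.
have pnq : p != q by rewrite -val_eqE /= ltn_eqF.
set x := P.1.1 in x0; set y := P.1.2 in y0; pose z := affine c r.2 (vtx B).
have {}z0 : 0 < z - l * c p - m * c q.
  by move: z0; rewrite /z /P /= /affine; lra.
have inner k j : 0 <= k <= 1 -> 0 <= j <= 1 -> x = k * a p + j * a q -> y = k * b p + j * b q ->
    0 < z - k * c p - j * c q -> (0 < k < 1) && (0 < j < 1).
  move=> k01 j01 xk yk zk; have [cv sv] := face_ptP pnq Bp Bq k01 j01.
  have xa : affine a r.1.1 (face_pt B p q k j) = 0.
    by rewrite affine_face // -[affine _ _ _]/x xk; ring.
  have yb : affine b r.1.2 (face_pt B p q k j) = 0.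
    by rewrite affine_face // -[affine _ _ _]/y yk; ring.
  have zc : 0 < affine c r.2 (face_pt B p q k j) by rewrite affine_face.
  apply: contraT; rewrite negb_and => kj; exfalso.
  have none A : A = [set t | (t == p) && (0 < k < 1) || (t == q) && (0 < j < 1)]%SET ->
      #|A| = 0%N \/ #|A| = 1%N.
    move=> ->; case: (boolP (0 < k < 1)) kj => hk; case: (boolP (0 < j < 1)) => hj // _.
    - right; apply/eqP/cards1P; exists p; apply/setP => t; by rewrite !inE andbT andbF orbF.
    - right; apply/eqP/cards1P; exists q; apply/setP => t; by rewrite !inE andbT andbF.
    - by left; apply/eqP; rewrite cards_eq0; apply/eqP/setP => t; rewrite !inE !andbF.
  case: (none _ sv) => h.
    by apply: (A1 (face_pt B p q k j)) => //; [exact/F_star|rewrite yb].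
  by apply: (A12 (face_pt B p q k j)) => //; exact/F_star.
have /andP[l01' m01'] := inner l m l01 m01 x0 y0 z0.
have [cv sv] := face_ptP pnq Bp Bq l01 m01.
have [ac0 bc0 dets] : [/\ det2 (a p) (c p) (a q) (c q) != 0, det2 (b p) (c p) (b q) (c q) != 0 &
    forall t, t != p -> t != q ->
     det3 (a p) (b p) (c p) (a q) (b q) (c q) (a t) (b t) (c t) != 0].
  apply: (B12 (face_pt B p q l m)) => //.
  - by rewrite sv; apply/setP => t; rewrite !inE l01' m01' !andbT.
  - by rewrite affine_face // -[affine _ _ _]/x x0; ring.
  - by rewrite affine_face // -[affine _ _ _]/y y0; ring.
  - by rewrite affine_face.
split => //; apply/eqP; rewrite det2E => D0.
(* Walk along the common kernel of a and b, in the direction where the third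
   function increases, until the boundary of the face is reached. *)
pose sd := Num.sg (a p * c q - c p * a q).
have sd0 : 0 < sd * (a p * c q - c p * a q).
  by rewrite -normrEsg normr_gt0 -det2E.
have [|s [s0 ls ms]] := @square_exit l m (sd * a q) (- sd * a p) l01' m01'.
  rewrite -negb_and; apply/negP => /andP[/eqP u0 /eqP w0].
  have : sd * (a p * c q - c p * a q) = 0.
    transitivity (- (- sd * a p) * c q - sd * a q * c p); first by ring.
    by rewrite u0 w0; ring.
  by move=> e; rewrite e ltxx in sd0.
apply/negP; rewrite negbK; apply: inner => //.
- by rewrite x0; ring.
- rewrite y0; apply/eqP; rewrite -subr_eq0; apply/eqP.
  transitivity (s * sd * (a p * b q - b p * a q)); first by ring.
  by rewrite D0 mulr0.
- have := mulr_ge0 s0 (ltW sd0); have := z0; lra.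
Qed.
End stability.

(** * Minors as determinants of rows *)

Section minors.
Context {R : realType} {n : nat}.

Lemma minorE m k (A : 'M[R]_(n, m.+1)) (J : {set 'I_n}) (K : {set 'I_m.+1}) (s : seq 'I_n) u x0 :
  enum J = s -> enum K = u -> size s = k ->
  minor A J K = \det (\matrix_(i < k, j < k) A (nth x0 s i) (nth ord0 u j)).
Proof.
move=> <- <- sk; rewrite /minor.
have -> : \matrix_(i < #|J|, j < #|J|) A (enum_val i) (nth ord0 (enum K) j) =
          \matrix_(i < #|J|, j < #|J|) A (nth x0 (enum J) i) (nth ord0 (enum K) j).
  by apply/matrixP => i j; rewrite !mxE (enum_val_nth x0).
by rewrite -cardE in sk; rewrite sk.
Qed.

Lemma minor1 m (A : 'M[R]_(n, m.+1)) (K : {set 'I_m.+1}) p k :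
  enum K = [:: k] -> minor A [set p]%SET K = A p k.
Proof. by move=> eK; rewrite (@minorE _ 1 _ _ _ [:: p] _ p _ eK) ?enum_set1 // det_mx11 mxE. Qed.

Lemma minor2 m (A : 'M[R]_(n, m.+1)) (K : {set 'I_m.+1}) p q j k :
  enum K = [:: j; k] -> q != p -> minor A (q |: [set p])%SET K != 0 ->
  det2 (A p j) (A p k) (A q j) (A q k) != 0.
Proof.
move=> eK qp; apply: contra_neq; rewrite det2E => D0.
have e (x y : 'I_n) : enum (q |: [set p])%SET = [:: x; y] -> minor A (q |: [set p])%SET K =
   A x j * A y k - A x k * A y j.
  move=> eJ; rewrite (@minorE _ 2 _ _ _ _ _ p eJ eK) // -det2E /det2; congr (\det _).
  by apply/matrixP => -[[|[|//]] ?] [[|[|//]] ?]; rewrite !mxE.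
case: (ltngtP p q) => h.
- rewrite (e p q) //; apply: enum_sorted; rewrite /= ?h // => t; rewrite !inE orbC //.
- rewrite (e q p); first by rewrite -[RHS]oppr0 -D0; ring.
  by apply: enum_sorted; rewrite /= ?h // => t; rewrite !inE.
- by move/val_inj: h qp => ->; rewrite eqxx.
Qed.

Lemma minor3 m (A : 'M[R]_(n, m.+1)) (K : {set 'I_m.+1}) (p q t : 'I_n) i j k :
  enum K = [:: i; j; k] -> (p < q)%N -> t != p -> t != q ->
  minor A (t |: [set p; q])%SET K != 0 ->
  det3 (A p i) (A p j) (A p k) (A q i) (A q j) (A q k) (A t i) (A t j) (A t k) != 0.
Proof.
move=> eK pq tp tq; apply: contra_neq => D0.
pose w x : @vec R := (A x i, A x j, A x k).
have {}D0 : tri (w p) (w q) (w t) = 0 by rewrite -det3E.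
have e (x y z : 'I_n) : enum (t |: [set p; q])%SET = [:: x; y; z] ->
   minor A (t |: [set p; q])%SET K = tri (w x) (w y) (w z).
  move=> eJ; rewrite (@minorE _ 3 _ _ _ _ _ p eJ eK) // -det3E /det3; congr (\det _).
  by apply/matrixP => -[[|[|[|//]]] ?] [[|[|[|//]]] ?]; rewrite !mxE.
case: (ltngtP t p) => h1; last by move/val_inj: h1 tp => ->; rewrite eqxx.
  rewrite (e t p q); first by rewrite triC tri_C opprK.
  by apply: enum_sorted; rewrite /= ?h1 ?pq // => x; rewrite !inE.
case: (ltngtP t q) => h2; last by move/val_inj: h2 tq => ->; rewrite eqxx.
  rewrite (e p t q); first by rewrite tri_C D0 oppr0.
  apply: enum_sorted; rewrite /= ?h1 ?h2 // => x; rewrite !inE.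
  by case: (x == t); case: (x == p).
rewrite (e p q t) //.
apply: enum_sorted; rewrite /= ?pq ?h2 // => x; rewrite !inE.
by case: (x == t); case: (x == p); case: (x == q).
Qed.
End minors.

(** * Good clipping conditions *)

Section good_clipping_stable.
Context {R : realType} {n : nat}.
Variables (a b c : 'I_n -> R) (r : @vec R).
Local Notation A := (coef_mx a b c).
Local Notation rr := (tnth [tuple r.1.1; r.1.2; r.2]).
Hypothesis clip : good_clipping A rr.
Implicit Types v : Rn R n.

Lemma clip_fun1 v : clip_fun A rr i1 v = affine a r.1.1 v.
Proof. by rewrite /clip_fun /affine; congr (_ + _); apply: eq_bigr => t _; rewrite mxE. Qed.
Lemma clip_fun2 v : clip_fun A rr i2 v = affine b r.1.2 v.
Proof. by rewrite /clip_fun /affine; congr (_ + _); apply: eq_bigr => t _; rewrite mxE. Qed.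
Lemma clip_fun3 v : clip_fun A rr i3 v = affine c r.2 v.
Proof. by rewrite /clip_fun /affine; congr (_ + _); apply: eq_bigr => t _; rewrite mxE. Qed.

Lemma HI_of_values (I : {set 'I_3}) v : (forall i, i \in I -> clip_fun A rr i v = 0) ->
  0 <= affine a r.1.1 v -> 0 <= affine b r.1.2 v -> 0 < affine c r.2 v -> HI A rr I v.
Proof.
move=> h ha hb hc; split; last by rewrite /hyperplane /= clip_fun3 => e; rewrite e ltxx in hc.
split; last by rewrite /halfspace /= clip_fun3 ltW.
split; last by rewrite /halfspace /= clip_fun2.
split; last by rewrite /halfspace /= clip_fun1.
by move=> i /= iI; exact: h.
Qed.

Lemma good_A (I : {set 'I_3}) (d : int) v : I \subset [set i1; i2]%SET -> d = #|I|%:Z - 1 ->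
  F d v -> HI A rr I v -> False.
Proof.
move=> sI -> Fv Hv; case: clip => + _ => /(_ I sI) e.
by have : (F (#|I|%:Z - 1) `&` HI A rr I) v by []; rewrite e.
Qed.

Lemma no_vertex_ab : no_vertex a b c r.1.1 r.1.2 r.2.
Proof.
move=> v Fv av bv cv; apply: (@good_A [set i1]%SET 0 v) => //.
- by rewrite finset.sub1set !inE eqxx.
- by rewrite cards1.
- apply: HI_of_values; rewrite ?av // => i; rewrite inE => /eqP ->; by rewrite clip_fun1.
Qed.

Lemma no_vertex_ba : no_vertex b a c r.1.2 r.1.1 r.2.
Proof.
move=> v Fv av bv cv; apply: (@good_A [set i2]%SET 0 v) => //.
- by rewrite finset.sub1set !inE eqxx orbT.
- by rewrite cards1.
- apply: HI_of_values; rewrite ?av // => i; rewrite inE => /eqP ->; by rewrite clip_fun2.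
Qed.

Lemma no_edge_ab : no_edge a b c r.1.1 r.1.2 r.2.
Proof.
move=> v Fv av bv cv; apply: (@good_A [set i1; i2]%SET 1 v) => //.
- by rewrite cards2.
- apply: HI_of_values; rewrite ?av ?bv // => i; rewrite !inE => /orP[]/eqP ->.
    by rewrite clip_fun1.
  by rewrite clip_fun2.
Qed.

Lemma no_edge_ba : no_edge b a c r.1.2 r.1.1 r.2.
Proof. by move=> v Fv bv av; apply: no_edge_ab. Qed.

Lemma good_B (I : {set 'I_3}) v : I \subset [set i1; i2]%SET -> F #|I|%:Z v -> HI A rr I v ->
  (forall t, t \in I -> minor A (star v) (i3 |: I :\ t)%SET != 0) /\
  (forall t, t \notin star v -> minor A (t |: star v)%SET (i3 |: I)%SET != 0).
Proof.
move=> sI Fv Hv; case: clip => _ /(_ I sI v (conj Fv Hv)).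
rewrite mulf_eq0 negb_or => /andP[/prodf_neq0 h1 /prodf_neq0 h2]; split => // t tv.
by apply: h2; rewrite !inE; move: tv; rewrite inE.
Qed.

Let A1 t : A t i1 = a t. Proof. by rewrite mxE. Qed.
Let A2 t : A t i2 = b t. Proof. by rewrite mxE. Qed.
Let A3 t : A t i3 = c t. Proof. by rewrite mxE. Qed.

Ltac enumK := apply: enum_sorted => // -[[|[|[|//]]] ?]; rewrite !inE.

Lemma vertex_clip eps : 0 < eps -> vertex_stable a b c (r.1, r.2 - eps).
Proof.
move=> eps0 B P x0 y0 z0.
have {}z0 : 0 < affine c r.2 (vtx B) by move: z0; rewrite /P /= /affine; lra.
have FB : F 0 (vtx B : Rn R n).
  apply/F_star; rewrite vtx_offset; split; first exact: offset_cube (vtx_proper B).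
  rewrite offset_star; last exact: vtx_proper.
  by apply/eqP; rewrite cards_eq0; apply/eqP/setP => t; rewrite !inE eqxx.
split.
- by rewrite lt_def x0 andbT; apply/eqP => e; exact: (no_vertex_ab FB e y0 z0).
- by rewrite lt_def y0 andbT; apply/eqP => e; exact: (no_vertex_ba FB e x0 z0).
move=> t; have [|||_ /(_ t)] := @good_B finset.set0 (vtx B).
- by rewrite finset.sub0set.
- by rewrite cards0.
- by apply: HI_of_values => // i; rewrite inE.
have -> : star (vtx B : Rn R n) = finset.set0.
  by case/F_star: FB => _ /eqP; rewrite cards_eq0 => /eqP.
by rewrite inE => /(_ isT); rewrite finset.setU0 (@minor1 _ _ _ _ _ _ i3) ?A3 //; enumK.
Qed.

Lemma edge_clip_a eps : 0 < eps -> edge_stable a b c r.1.1 r.1.2 (r.2 - eps).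
Proof.
apply: edge_clip; [exact: no_vertex_ab|exact: no_edge_ab|] => v p cv sv av bv z0.
have [|||h1 h2] := @good_B [set i1]%SET v.
- by rewrite finset.sub1set !inE eqxx.
- by rewrite cards1; apply/F_star; rewrite sv cards1.
- by apply: HI_of_values; rewrite ?av // => i; rewrite inE => /eqP ->; rewrite clip_fun1.
split.
  have := h1 i1; rewrite !inE eqxx sv => /(_ isT); rewrite (@minor1 _ _ _ _ _ _ i3) ?A3 //.
  by enumK.
move=> t tp; have := h2 t; rewrite sv !inE => /(_ tp).
move/(@minor2 _ _ _ _ _ _ _ i1 i3); rewrite !A1 !A3; apply => //.
by enumK.
Qed.

Lemma edge_clip_b eps : 0 < eps -> edge_stable b a c r.1.2 r.1.1 (r.2 - eps).
Proof.
apply: edge_clip; [exact: no_vertex_ba|exact: no_edge_ba|] => v p cv sv bv av z0.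
have [|||h1 h2] := @good_B [set i2]%SET v.
- by rewrite finset.sub1set !inE eqxx orbT.
- by rewrite cards1; apply/F_star; rewrite sv cards1.
- by apply: HI_of_values; rewrite ?bv // => i; rewrite inE => /eqP ->; rewrite clip_fun2.
split.
  have := h1 i2; rewrite !inE eqxx sv => /(_ isT); rewrite (@minor1 _ _ _ _ _ _ i3) ?A3 //.
  by enumK.
move=> t tp; have := h2 t; rewrite sv !inE => /(_ tp).
move/(@minor2 _ _ _ _ _ _ _ i2 i3); rewrite !A2 !A3; apply => //.
by enumK.
Qed.

Lemma face_clip_ab eps : 0 < eps -> face_stable a b c (r.1, r.2 - eps).
Proof.
apply: face_clip; [exact: no_vertex_ab|exact: no_edge_ab|] => v p q pq cv sv av bv z0.
have pnq : q != p by rewrite -val_eqE /= gtn_eqF.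
have sv' : star v = (q |: [set p])%SET by rewrite sv finset.setUC.
have [|||h1 h2] := @good_B [set i1; i2]%SET v.
- by [].
- by rewrite cards2; apply/F_star; rewrite sv cards2 eq_sym pnq.
- apply: HI_of_values; rewrite ?av ?bv // => i; rewrite !inE => /orP[]/eqP ->.
    by rewrite clip_fun1.
  by rewrite clip_fun2.
split.
- have := h1 i2; rewrite !inE eqxx orbT sv' => /(_ isT).
  move/(@minor2 _ _ _ _ _ _ _ i1 i3); rewrite !A1 !A3. by apply => //; enumK.
- have := h1 i1; rewrite !inE eqxx sv' => /(_ isT).
  move/(@minor2 _ _ _ _ _ _ _ i2 i3); rewrite !A2 !A3. by apply => //; enumK.
move=> t tp tq; have := h2 t; rewrite sv !inE negb_or tp tq => /(_ isT).
move/(@minor3 _ _ _ _ _ _ _ _ i1 i2 i3); rewrite !A1 !A2 !A3. by apply => //; enumK.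
Qed.
End good_clipping_stable.

(** * Perturbation of infeasible systems *)

Section infeasible.
Context {R : realType}.

Lemma near_out (C : set R) (u_ v_ w_ : nat -> R) (u v w : R) (y : R * R) : closed C ->
  u_ @ \oo --> u -> v_ @ \oo --> v -> w_ @ \oo --> w ->
  ~ C (u - y.1 * v - y.2 * w) ->
  \forall y' \near y & k \near \oo, ~ C (u_ k - y'.1 * v_ k - y'.2 * w_ k).
Proof.
move=> cC cu cv cw nC.
have oC : open (~` C) by exact: closed_openC.
have cf : (fun z : (R * R) * nat => u_ z.2 - z.1.1 * v_ z.2 - z.1.2 * w_ z.2) @
     filter_prod (nbhs y) \oo --> u - y.1 * v - y.2 * w.
  have c2 (f : nat -> R) g : f @ \oo --> g -> (fun z : (R * R) * nat => f z.2) @ filter_prod (nbhs y) \oo --> g.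
    by move=> cfg; apply: (cvg_comp _ _ (@cvg_snd _ _ _ _ _) cfg).
  apply: cvgB; first apply: cvgB; first exact: c2.
    apply: cvgM; last exact: c2.
    apply: (cvg_comp _ _ (@cvg_fst _ _ _ _ _) _); exact: cvg_fst.
  apply: cvgM; last exact: c2.
  apply: (cvg_comp _ _ (@cvg_fst _ _ _ _ _) _); exact: cvg_snd.
exact: cf (open_nbhs_nbhs (conj oC nC)).
Qed.

(** A closed system fails on a neighbourhood of each (l, m) for all large k, and the
    unit square is compact. *)
Lemma near_infeasible (C1 C2 C3 : set R) (u_ v_ w_ : 'I_3 -> nat -> R) (u v w : 'I_3 -> R) :
  closed C1 -> closed C2 -> closed C3 ->
  (forall i, u_ i @ \oo --> u i) -> (forall i, v_ i @ \oo --> v i) -> (forall i, w_ i @ \oo --> w i) ->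
  (forall l m : R, 0 <= l <= 1 -> 0 <= m <= 1 ->
    ~ [/\ C1 (u i1 - l * v i1 - m * w i1), C2 (u i2 - l * v i2 - m * w i2) &
       C3 (u i3 - l * v i3 - m * w i3)]) ->
  \forall k \near \oo, forall l m : R, 0 <= l <= 1 -> 0 <= m <= 1 ->
    ~ [/\ C1 (u_ i1 k - l * v_ i1 k - m * w_ i1 k), C2 (u_ i2 k - l * v_ i2 k - m * w_ i2 k) &
       C3 (u_ i3 k - l * v_ i3 k - m * w_ i3 k)].
Proof.
move=> c1 c2 c3 cu cv cw none.
have cK : compact ([set` `[0, 1]%R] `*` [set` `[0, 1]%R] : set (R * R)).
  by apply: compact_setX; exact: segment_compact.
have H : \forall k \near \oo, ([set` `[0, 1]%R] `*` [set` `[0, 1]%R] : set (R * R)) `<=` (fun y =>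
  ~ [/\ C1 (u_ i1 k - y.1 * v_ i1 k - y.2 * w_ i1 k), C2 (u_ i2 k - y.1 * v_ i2 k - y.2 * w_ i2 k) &
       C3 (u_ i3 k - y.1 * v_ i3 k - y.2 * w_ i3 k)]).
  apply: ((compact_near_coveringP _).1 cK) => y [/= y1 y2].
  rewrite !in_itv /= in y1 y2.
  have : ~ C1 (u i1 - y.1 * v i1 - y.2 * w i1) \/ ~ C2 (u i2 - y.1 * v i2 - y.2 * w i2) \/
         ~ C3 (u i3 - y.1 * v i3 - y.2 * w i3).
    have nn := none _ _ y1 y2.
    have [h1|] := pselect (C1 (u i1 - y.1 * v i1 - y.2 * w i1)); last by left.
    have [h2|] := pselect (C2 (u i2 - y.1 * v i2 - y.2 * w i2)); last by right; left.
    by right; right => h3; apply: nn.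
  move=> [h|[h|h]].
  - by apply: filterS (near_out c1 (cu i1) (cv i1) (cw i1) h) => z nz [].
  - by apply: filterS (near_out c2 (cu i2) (cv i2) (cw i2) h) => z nz [].
  - by apply: filterS (near_out c3 (cu i3) (cv i3) (cw i3) h) => z nz [].
apply: filterS H => k H l m l01 m01; apply: (H (l, m)); split; rewrite /= in_itv /=; exact.
Qed.
End infeasible.

(** * Limits of the terms of the formula *)

Section term_limits.
Context {R : realType} {n : nat}.
Hypothesis n0 : (0 < n)%N.
Implicit Types (p q t : 'I_n).

Lemma cvg_prod_in (A : {set 'I_n}) (f_ : nat -> 'I_n -> R) (f : 'I_n -> R) :
  (forall t, t \in A -> f_ k t @[k --> \oo] --> f t) ->
  \prod_(t in A) f_ k t @[k --> \oo] --> \prod_(t in A) f t.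
Proof. by move=> cf; apply: cvg_big => //; exact: mul_continuous. Qed.

Lemma cvg_exprn (u_ : nat -> R) (u : R) m : u_ @ \oo --> u -> u_ k ^+ m @[k --> \oo] --> u ^+ m.
Proof.
move=> cu; elim: m => [|m IH]; first exact: cvg_cst.
rewrite exprS (_ : (fun k => _) = (fun k => u_ k * u_ k ^+ m)); first exact: cvgM.
by apply/funext => k; rewrite exprS.
Qed.

Lemma cvg_invr (u_ : nat -> R) (u : R) : u != 0 -> u_ @ \oo --> u -> (u_ k)^-1 @[k --> \oo] --> u^-1.
Proof. exact: cvgV. Qed.

Lemma cvg_sgr (u_ : nat -> R) (u : R) : u != 0 -> u_ @ \oo --> u -> Num.sg (u_ k) @[k --> \oo] --> Num.sg u.
Proof.
move=> u0 cu; apply: cvg_near_cst; case: (ltgtP u 0) u0 => // hu _.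
- by apply: filterS (cvgr_lt _ cu _ hu) => k /ltr0_sg ->; rewrite ltr0_sg.
- by apply: filterS (cvgr_gt _ cu _ hu) => k /gtr0_sg ->; rewrite gtr0_sg.
Qed.

Lemma cvg_tpow (u_ : nat -> R) (u : R) : u_ @ \oo --> u -> tpow n (u_ k) @[k --> \oo] --> tpow n u.
Proof.
move=> cu; rewrite -(prednK n0); exact: (cvg_comp _ _ cu (@continuous_tpow R n.-1 u)).
Qed.

Lemma near_pos (u_ : nat -> R) (u : R) : u_ @ \oo --> u -> 0 < u -> \forall k \near \oo, 0 < u_ k.
Proof. by move=> cu u0; apply: (cvgr_gt _ cu). Qed.

Lemma near_unit (u_ : nat -> R) (u : R) : u_ @ \oo --> u -> 0 < u < 1 -> \forall k \near \oo, 0 < u_ k < 1.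
Proof.
move=> cu /andP[u0 u1]; apply: filterS2 (cvgr_gt _ cu _ u0) (cvgr_lt _ cu _ u1) => k.
by move=> -> ->.
Qed.

Lemma cvg_det2 (x_ y_ z_ w_ : nat -> R) (x y z w : R) :
  x_ @ \oo --> x -> y_ @ \oo --> y -> z_ @ \oo --> z -> w_ @ \oo --> w ->
  det2 (x_ k) (y_ k) (z_ k) (w_ k) @[k --> \oo] --> det2 x y z w.
Proof.
move=> cx cy cz cw; rewrite det2E (_ : (fun k => _) = (fun k => x_ k * w_ k - y_ k * z_ k)).
  by apply: cvgB; apply: cvgM.
by apply/funext => k; rewrite det2E.
Qed.

Variables (a_ b_ c_ : nat -> 'I_n -> R) (a b c : 'I_n -> R).
Hypothesis ca : forall t, a_ k t @[k --> \oo] --> a t.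
Hypothesis cb : forall t, b_ k t @[k --> \oo] --> b t.
Hypothesis cc : forall t, c_ k t @[k --> \oo] --> c t.

Lemma cvg_det3 p q t :
  det3 (a_ k p) (b_ k p) (c_ k p) (a_ k q) (b_ k q) (c_ k q) (a_ k t) (b_ k t) (c_ k t)
    @[k --> \oo] -->
  det3 (a p) (b p) (c p) (a q) (b q) (c q) (a t) (b t) (c t).
Proof.
rewrite det3_row (_ : (fun k => _) = (fun k => c_ k p * (a_ k q * b_ k t - b_ k q * a_ k t)
   - c_ k q * (a_ k p * b_ k t - b_ k p * a_ k t) + c_ k t * (a_ k p * b_ k q - b_ k p * a_ k q))).
  by rewrite /tri /wedge /=; apply: cvgD; [apply: cvgB|]; apply: cvgM => //; apply: cvgB; apply: cvgM.
by apply/funext => k; rewrite det3_row.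
Qed.

(** If some weak inequality fails in the limit, the term is eventually 0; otherwise
    stability makes the inequalities strict and the denominator nonzero. *)
Lemma vertex_term_cvg (P_ : nat -> @vec R) (P : @vec R) :
  (P_ k).1.1 @[k --> \oo] --> P.1.1 -> (P_ k).1.2 @[k --> \oo] --> P.1.2 ->
  (P_ k).2 @[k --> \oo] --> P.2 ->
  (0 <= P.1.1 -> 0 <= P.1.2 -> 0 <= P.2 -> [/\ 0 < P.1.1, 0 < P.1.2 & forall t, c t != 0]) ->
  vertex_term (c_ k) (P_ k) @[k --> \oo] --> vertex_term c P.
Proof.
move=> cx cy cz H.
have zero (u_ : nat -> R) (u : R) : u_ @ \oo --> u -> u < 0 -> \forall k \near \oo, (0 <= u_ k) = false.
  by move=> cu u0; apply: filterS (cvgr_lt _ cu _ u0) => k; rewrite ltNge => /negbTE.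
rewrite {2}/vertex_term; have [x0|x0] := leP 0 P.1.1; last first.
  by apply: cvg_near_cst; apply: filterS (zero _ _ cx x0) => k; rewrite /vertex_term => ->.
have [y0|y0] := leP 0 P.1.2; last first.
  by apply: cvg_near_cst; apply: filterS (zero _ _ cy y0) => k; rewrite /vertex_term => ->; rewrite andbF.
have [z0|z0] := leP 0 P.2; last first.
  rewrite /= /tpow leNgt z0 /= mul0r.
  apply: cvg_near_cst; apply: filterS (zero _ _ cz z0) => k; rewrite /vertex_term /tpow => ->.
  by rewrite mul0r; case: ifP.
have [x1 y1 c0] := H x0 y0 z0 => /=.
have : (fun k => tpow n (P_ k).2 * vertex_coef (c_ k)) @ \oo --> tpow n P.2 * vertex_coef c.
  apply: cvgM; first exact: cvg_tpow.
  apply: cvg_invr.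
    by rewrite mulf_neq0 ?fact_neq0 //; apply/prodf_neq0 => t _.
  apply: cvgM; first exact: cvg_cst.
  by apply: cvg_big => //; exact: mul_continuous.
apply: cvg_trans; apply: near_eq_cvg.
apply: filterS2 (near_pos cx x1) (near_pos cy y1) => k xk yk.
by rewrite /vertex_term !ltW.
Qed.
End term_limits.

Section edge_limit.
Context {R : realType} {n : nat}.
Hypothesis n0 : (0 < n)%N.
Variables (d_ e_ c_ : nat -> 'I_n -> R) (d e c : 'I_n -> R) (x_ y_ z_ : nat -> R) (x y z : R) (p : 'I_n).
Hypothesis cd : forall t, d_ k t @[k --> \oo] --> d t.
Hypothesis ce : forall t, e_ k t @[k --> \oo] --> e t.
Hypothesis cc : forall t, c_ k t @[k --> \oo] --> c t.
Hypotheses (cx : x_ @ \oo --> x) (cy : y_ @ \oo --> y) (cz : z_ @ \oo --> z).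

(** If the limit edge contains a point satisfying the weak inequalities, stability
    makes the term continuous there; otherwise [near_infeasible], with a zero
    second direction, shows that the terms vanish eventually. *)
Lemma edge_term_cvg :
  (forall l, 0 <= l <= 1 -> x = l * d p -> 0 <= y - l * e p -> 0 <= z - l * c p ->
   [/\ 0 < l < 1, d p != 0, 0 < y - l * e p, c p != 0 &
    forall t, t != p -> det2 (d p) (c p) (d t) (c t) != 0]) ->
  edge_term (c_ k) (d_ k) (e_ k) p (x_ k) (y_ k) (z_ k) @[k --> \oo] --> edge_term c d e p x y z.
Proof.
move=> H; have [[l [l01 xl yl zl]]|none] := pselect (exists l, [/\ 0 <= l <= 1, x = l * d p,
    0 <= y - l * e p & 0 <= z - l * c p]).
  have [l01' d0 y1 c0 dets] := H l l01 xl yl zl.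
  have lE : x / d p = l by rewrite xl mulfK.
  have cl : x_ k / d_ k p @[k --> \oo] --> x / d p.
    by apply: cvgM => //; apply: cvg_invr.
  rewrite {2}/edge_term lE l01' yl /= -lE.
  have cyl : y_ k - x_ k / d_ k p * e_ k p @[k --> \oo] --> y - x / d p * e p.
    by apply: cvgB => //; apply: cvgM.
  have : (fun k => tpow n (z_ k - x_ k / d_ k p * c_ k p) * edge_coef (c_ k) (d_ k) p) @ \oo -->
      tpow n (z - x / d p * c p) * edge_coef c d p.
    apply: cvgM.
      by apply: cvg_tpow => //; apply: cvgB => //; apply: cvgM.
    apply: cvgM; first by apply: cvgM; [exact: cvg_sgr|exact: cvg_exprn].
    apply: cvg_invr.
      rewrite !mulf_neq0 ?fact_neq0 //; apply/prodf_neq0 => t; rewrite !inE; exact: dets.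
    apply: cvgM; first by apply: cvgM => //; exact: cvg_cst.
    by apply: cvg_prod_in => t _; exact: cvg_det2.
  apply: cvg_trans; apply: near_eq_cvg.
  rewrite -lE in l01' y1.
  apply: filterS2 (near_unit cl l01') (near_pos cyl y1) => k lk yk.
  by rewrite /edge_term lk ltW.
have zero (d' e' c' : 'I_n -> R) (x' y' z' : R) : (forall l m : R, 0 <= l <= 1 -> 0 <= m <= 1 ->
    ~ [/\ x' - l * d' p - m * 0 = 0, 0 <= y' - l * e' p - m * 0 & 0 <= z' - l * c' p - m * 0]) ->
    edge_term c' d' e' p x' y' z' = 0.
  move=> none'; rewrite /edge_term; case: ifP => // /andP[l01 yl].
  rewrite /tpow; case: ifP => [zl|]; last by rewrite mul0r.
  case: (none' (x' / d' p) 0); rewrite ?lexx ?ler01 //.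
    by move: l01 => /andP[? ?]; rewrite !ltW.
  rewrite mul0r !subr0 divfK ?subrr //.
  by apply: contraTneq l01 => ->; rewrite invr0 mulr0 ltxx.
have none' l m : 0 <= l <= 1 -> 0 <= m <= 1 ->
    ~ [/\ x - l * d p - m * 0 = 0, 0 <= y - l * e p - m * 0 & 0 <= z - l * c p - m * 0].
  rewrite mulr0 !subr0 => l01 _ [xl yl zl]; apply: none; exists l; split => //.
  by apply/eqP; rewrite -subr_eq0 xl.
rewrite (zero d e c) //; apply: cvg_near_cst.
pose f3 T (u1 u2 u3 : T) (i : 'I_3) := if i == i1 then u1 else if i == i2 then u2 else u3.
have cf3 (u1 u2 u3 : nat -> R) (v1 v2 v3 : R) : u1 @ \oo --> v1 -> u2 @ \oo --> v2 -> u3 @ \oo --> v3 ->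
    forall i, f3 _ u1 u2 u3 i @ \oo --> f3 _ v1 v2 v3 i.
  by move=> h1 h2 h3 i; rewrite /f3; case: ifP => // _; case: ifP.
have c0 : closed [set (0 : R)] by exact: closed_eq.
have c1 : closed [set t : R | 0 <= t] by exact: closed_ge.
have := @near_infeasible R [set 0] [set t | 0 <= t] [set t | 0 <= t]
  (f3 _ x_ y_ z_) (f3 _ (d_^~ p) (e_^~ p) (c_^~ p)) (f3 _ (cst 0) (cst 0) (cst 0))
  (f3 _ x y z) (f3 _ (d p) (e p) (c p)) (f3 _ 0 0 0) c0 c1 c1
  (cf3 _ _ _ _ _ _ cx cy cz) (cf3 _ _ _ _ _ _ (@cd p) (@ce p) (@cc p))
  (cf3 _ _ _ _ _ _ (cvg_cst _) (cvg_cst _) (cvg_cst _)) none'.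
move=> nn; apply: filterS (nn _ _ _) => k h; exact: zero h.
Qed.
End edge_limit.

Section face_limit.
Context {R : realType} {n : nat}.
Hypothesis n0 : (0 < n)%N.
Variables (a_ b_ c_ : nat -> 'I_n -> R) (a b c : 'I_n -> R) (P_ : nat -> @vec R) (P : @vec R).
Variables (p q : 'I_n).
Hypothesis ca : forall t, a_ k t @[k --> \oo] --> a t.
Hypothesis cb : forall t, b_ k t @[k --> \oo] --> b t.
Hypothesis cc : forall t, c_ k t @[k --> \oo] --> c t.
Hypotheses (cx : (P_ k).1.1 @[k --> \oo] --> P.1.1) (cy : (P_ k).1.2 @[k --> \oo] --> P.1.2)
  (cz : (P_ k).2 @[k --> \oo] --> P.2).

Lemma face_term_cvg :
  (forall l m, 0 <= l <= 1 -> 0 <= m <= 1 ->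
   P.1.1 = l * a p + m * a q -> P.1.2 = l * b p + m * b q ->
   0 <= P.2 - l * c p - m * c q ->
  [/\ 0 < l < 1, 0 < m < 1, det2 (a p) (b p) (a q) (b q) != 0 &
   [/\ det2 (a p) (c p) (a q) (c q) != 0, det2 (b p) (c p) (b q) (c q) != 0 &
    forall t, t != p -> t != q ->
     det3 (a p) (b p) (c p) (a q) (b q) (c q) (a t) (b t) (c t) != 0]]) ->
  face_term (a_ k) (b_ k) (c_ k) p q (P_ k) @[k --> \oo] --> face_term a b c p q P.
Proof.
move=> H; have [[l [m [l01 m01 xl yl zl]]]|none] := pselect (exists l m, [/\ 0 <= l <= 1, 0 <= m <= 1,
    P.1.1 = l * a p + m * a q, P.1.2 = l * b p + m * b q & 0 <= P.2 - l * c p - m * c q]).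
  have [l01' m01' D0 [ac0 bc0 dets]] := H l m l01 m01 xl yl zl.
  have D0' : wedge (coefrow a b c p) (coefrow a b c q) != 0 by rewrite -det2_row.
  have cw (u_ v_ : nat -> @vec R) (u v : @vec R) : (u_ k).1.1 @[k --> \oo] --> u.1.1 ->
      (u_ k).1.2 @[k --> \oo] --> u.1.2 -> (v_ k).1.1 @[k --> \oo] --> v.1.1 ->
      (v_ k).1.2 @[k --> \oo] --> v.1.2 -> wedge (u_ k) (v_ k) @[k --> \oo] --> wedge u v.
    by move=> h1 h2 h3 h4; apply: cvgB; apply: cvgM.
  have cD := cw (fun k => coefrow (a_ k) (b_ k) (c_ k) p) (fun k => coefrow (a_ k) (b_ k) (c_ k) q)
    (coefrow a b c p) (coefrow a b c q) (@ca p) (@cb p) (@ca q) (@cb q).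
  have cl : wedge (P_ k) (coefrow (a_ k) (b_ k) (c_ k) q) /
      wedge (coefrow (a_ k) (b_ k) (c_ k) p) (coefrow (a_ k) (b_ k) (c_ k) q) @[k --> \oo] --> l.
    have -> : l = wedge P (coefrow a b c q) / wedge (coefrow a b c p) (coefrow a b c q).
      by apply: (mulIf D0'); rewrite divfK // /wedge xl yl /=; ring.
    apply: cvgM; last exact: cvg_invr.
    exact: (cw P_ (fun k => coefrow (a_ k) (b_ k) (c_ k) q) P (coefrow a b c q) cx cy (@ca q) (@cb q)).
  have cm : wedge (coefrow (a_ k) (b_ k) (c_ k) p) (P_ k) /
      wedge (coefrow (a_ k) (b_ k) (c_ k) p) (coefrow (a_ k) (b_ k) (c_ k) q) @[k --> \oo] --> m.
    have -> : m = wedge (coefrow a b c p) P / wedge (coefrow a b c p) (coefrow a b c q).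
      by apply: (mulIf D0'); rewrite divfK // /wedge xl yl /=; ring.
    apply: cvgM; last exact: cvg_invr.
    exact: (cw (fun k => coefrow (a_ k) (b_ k) (c_ k) p) P_ (coefrow a b c p) P (@ca p) (@cb p) cx cy).
  have -> : face_term a b c p q P = tpow n (P.2 - l * c p - m * c q) * face_coef a b c p q.
    have lE : wedge P (coefrow a b c q) / wedge (coefrow a b c p) (coefrow a b c q) = l.
      by apply: (mulIf D0'); rewrite divfK // /wedge xl yl /=; ring.
    have mE : wedge (coefrow a b c p) P / wedge (coefrow a b c p) (coefrow a b c q) = m.
      by apply: (mulIf D0'); rewrite divfK // /wedge xl yl /=; ring.
    by rewrite /face_term lE mE l01' m01'.
  apply: (@cvg_trans _ ((fun k => tpow n ((P_ k).2 -
      wedge (P_ k) (coefrow (a_ k) (b_ k) (c_ k) q) /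
      wedge (coefrow (a_ k) (b_ k) (c_ k) p) (coefrow (a_ k) (b_ k) (c_ k) q) * c_ k p -
      wedge (coefrow (a_ k) (b_ k) (c_ k) p) (P_ k) /
      wedge (coefrow (a_ k) (b_ k) (c_ k) p) (coefrow (a_ k) (b_ k) (c_ k) q) * c_ k q) *
      face_coef (a_ k) (b_ k) (c_ k) p q) @ \oo)).
    apply: near_eq_cvg; apply: filterS2 (near_unit cl l01') (near_unit cm m01') => k lk mk.
    by rewrite /face_term lk mk.
  apply: cvgM.
    by apply: cvg_tpow => //; apply: cvgB; [apply: cvgB => //|]; apply: cvgM.
  have cD2 : det2 (a_ k p) (b_ k p) (a_ k q) (b_ k q) @[k --> \oo] --> det2 (a p) (b p) (a q) (b q).
    exact: cvg_det2.
  apply: cvgM; first by apply: cvgM; [exact: cvg_sgr|exact: cvg_exprn].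
  apply: cvg_invr.
    rewrite !mulf_neq0 ?fact_neq0 //; apply/prodf_neq0 => t; rewrite !inE negb_or => /andP[? ?].
    exact: dets.
  apply: cvgM; last by apply: cvg_prod_in => t _; exact: cvg_det3.
  apply: cvgM; last exact: cvg_det2.
  by apply: cvgM; [exact: cvg_cst|exact: cvg_det2].
have zero (a' b' c' : 'I_n -> R) (P' : @vec R) : (forall l m : R, 0 <= l <= 1 -> 0 <= m <= 1 ->
    ~ [/\ P'.1.1 - l * a' p - m * a' q = 0, P'.1.2 - l * b' p - m * b' q = 0 &
      0 <= P'.2 - l * c' p - m * c' q]) -> face_term a' b' c' p q P' = 0.
  move=> none'; rewrite /face_term; case: ifP => // /andP[l01 m01].
  rewrite /tpow; case: ifP => [zl|]; last by rewrite mul0r.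
  have D0 : wedge (coefrow a' b' c' p) (coefrow a' b' c' q) != 0.
    by apply: contraTneq l01 => ->; rewrite invr0 mulr0 ltxx.
  exfalso; apply: (none' _ _ _ _ (And3 _ _ zl)).
  - by move: l01 => /andP[? ?]; rewrite !ltW.
  - by move: m01 => /andP[? ?]; rewrite !ltW.
  - by apply: (mulIf D0); rewrite mul0r /wedge /= in D0 *; field.
  - by apply: (mulIf D0); rewrite mul0r /wedge /= in D0 *; field.
have none' l m : 0 <= l <= 1 -> 0 <= m <= 1 ->
    ~ [/\ P.1.1 - l * a p - m * a q = 0, P.1.2 - l * b p - m * b q = 0 &
      0 <= P.2 - l * c p - m * c q].
  by move=> l01 m01 [xl yl zl]; apply: none; exists l, m; split => //; lra.
rewrite (zero a b c) //; apply: cvg_near_cst.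
pose f3 T (u1 u2 u3 : T) (i : 'I_3) := if i == i1 then u1 else if i == i2 then u2 else u3.
have cf3 (u1 u2 u3 : nat -> R) (v1 v2 v3 : R) : u1 @ \oo --> v1 -> u2 @ \oo --> v2 -> u3 @ \oo --> v3 ->
    forall i, f3 _ u1 u2 u3 i @ \oo --> f3 _ v1 v2 v3 i.
  by move=> h1 h2 h3 i; rewrite /f3; case: ifP => // _; case: ifP.
have c0 : closed [set (0 : R)] by exact: closed_eq.
have c1 : closed [set t : R | 0 <= t] by exact: closed_ge.
have := @near_infeasible R [set 0] [set 0] [set t | 0 <= t]
  (f3 _ (fun k => (P_ k).1.1) (fun k => (P_ k).1.2) (fun k => (P_ k).2))
  (f3 _ (a_^~ p) (b_^~ p) (c_^~ p)) (f3 _ (a_^~ q) (b_^~ q) (c_^~ q))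
  (f3 _ P.1.1 P.1.2 P.2) (f3 _ (a p) (b p) (c p)) (f3 _ (a q) (b q) (c q)) c0 c0 c1
  (cf3 _ _ _ _ _ _ cx cy cz) (cf3 _ _ _ _ _ _ (@ca p) (@cb p) (@cc p))
  (cf3 _ _ _ _ _ _ (@ca q) (@cb q) (@cc q)) none'.
move=> nn; apply: filterS nn => k h; exact: zero h.
Qed.
End face_limit.

Section index_limit.
Context {R : realType} {n : nat}.
Hypothesis n0 : (0 < n)%N.

Lemma index_sum_cvg (a_ b_ c_ : nat -> 'I_n -> R) (a b c : 'I_n -> R) (r_ : nat -> @vec R) (r : @vec R) :
  (forall t, a_ k t @[k --> \oo] --> a t) -> (forall t, b_ k t @[k --> \oo] --> b t) ->
  (forall t, c_ k t @[k --> \oo] --> c t) ->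
  (r_ k).1.1 @[k --> \oo] --> r.1.1 -> (r_ k).1.2 @[k --> \oo] --> r.1.2 ->
  (r_ k).2 @[k --> \oo] --> r.2 ->
  vertex_stable a b c r -> edge_stable a b c r.1.1 r.1.2 r.2 ->
  edge_stable b a c r.1.2 r.1.1 r.2 -> face_stable a b c r ->
  index_sum (a_ k) (b_ k) (c_ k) (r_ k) @[k --> \oo] --> index_sum a b c r.
Proof.
move=> ca cb cc cx cy cz s0 s1 s1' s2.
have addc : continuous (fun u : R * R => u.1 + u.2) by exact: add_continuous.
have gx B : affine (a_ k) (r_ k).1.1 (vtx B) @[k --> \oo] --> affine a r.1.1 (vtx B).
  exact: cvg_affine.
have gy B : affine (b_ k) (r_ k).1.2 (vtx B) @[k --> \oo] --> affine b r.1.2 (vtx B).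
  exact: cvg_affine.
have gz B : affine (c_ k) (r_ k).2 (vtx B) @[k --> \oo] --> affine c r.2 (vtx B).
  exact: cvg_affine.
apply: cvgB; first apply: cvgB; first apply: cvgB.
- apply: cvg_big => // B _; apply: cvgM; first exact: cvg_cst.
  by apply: vertex_term_cvg => //; [exact: gx|exact: gy|exact: gz|exact: (s0 B)].
- apply: cvg_big => // p _; apply: cvg_big => // B Bp; apply: cvgM; first exact: cvg_cst.
  apply: edge_term_cvg => //; [exact: gx|exact: gy|exact: gz|by move=> l; exact: s1].
- apply: cvg_big => // p _; apply: cvg_big => // B Bp; apply: cvgM; first exact: cvg_cst.
  apply: edge_term_cvg => //; [exact: gy|exact: gx|exact: gz|by move=> l; exact: s1'].
- apply: cvg_big => // p _; apply: cvg_big => // q pq; apply: cvg_big => // B /andP[Bp Bq].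
  apply: cvgM; first exact: cvg_cst.
  apply: face_term_cvg => //; [exact: gx|exact: gy|exact: gz|by move=> l m; exact: s2].
Qed.
End index_limit.

(** * Perturbation to general position *)

Section perturbation.
Context {R : realType} {n : nat}.
Implicit Types (p q t : 'I_n).
Local Notation h := (fun k : nat => harmonic k : R).

Lemma near_finType (I : finType) (P : I -> nat -> Prop) :
  (forall i, \forall k \near \oo, P i k) -> \forall k \near \oo, forall i, P i k.
Proof.
move=> nP; suff : forall s : seq I, \forall k \near \oo, forall i, i \in s -> P i k.
  move=> /(_ (enum I)); apply: filterS => k H i; apply: H; exact: mem_enum.
elim=> [|i s IH]; first by apply: nearW.
by apply: filterS2 (nP i) IH => k Pi Ps j; rewrite inE => /predU1P[->//|]; exact: Ps.
Qed.

(** The largest power of the variable is factored out; the cofactor is nonzero at 0,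
    hence near 0. *)
Lemma near_poly (s : seq R) i : s`_i != 0 -> \forall k \near \oo, (Poly s).[h k] != 0.
Proof.
move=> si; have P0 : Poly s != 0.
  by apply: contraNneq si => e; rewrite -coef_Poly e coef0.
have [m [q + ->]] := multiplicity_XsubC (Poly s) 0.
rewrite P0 /= => q0.
have cq : q.[h k] @[k --> \oo] --> q.[0].
  exact: (cvg_comp _ _ cvg_harmonic (@continuous_horner R q 0)).
apply: filterS (cvgr_neq0 _ cq q0) => k qk.
by rewrite hornerM horner_exp hornerXsubC subr0 mulf_neq0 // expf_neq0 // gt_eqF // harmonic_gt0.
Qed.

Lemma near_cubic (f : R -> R) (u0 u1 u2 u3 : R) :
  [|| u1 != 0, u2 != 0 | u3 != 0] ->
  (forall x, f x = u0 + u1 * x + u2 * x ^+ 2 + u3 * x ^+ 3) ->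
  \forall k \near \oo, f (h k) != 0.
Proof.
move=> u fE; have [i si] : exists i, [:: u0; u1; u2; u3]`_i != 0.
  by case/or3P: u => ?; [exists 1%N|exists 2%N|exists 3%N].
apply: filterS (near_poly si) => k; rewrite horner_Poly /= fE.
by congr (~~ (_ == _)); ring.
Qed.

Variables (a b c : 'I_n -> R) (r : @vec R).

(** The rows move along the moment curve (1, t+1, (t+1)^2), so that the leading
    coefficients of their minors as polynomials in the parameter are Vandermonde
    determinants, up to positive factors.  The constants 1 and 1/2 added to r1 and
    r2 do the same for the values at the vertices. *)
Definition tilt_a (k : nat) t : R := a t + h k.
Definition tilt_b (k : nat) t : R := b t + h k * t.+1%:R.
Definition tilt_c (k : nat) t : R := c t + h k * t.+1%:R ^+ 2.
Definition tilt_r (k : nat) : @vec R := (r.1.1 + h k, r.1.2 + h k * 2^-1, r.2).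

Let ordR_inj p q : p != q -> q.+1%:R - p.+1%:R != 0 :> R.
Proof. by move=> pq; rewrite subr_eq0 eqr_nat eqSS eq_sym. Qed.

Lemma tilt_generic : \forall k \near \oo, index_generic (tilt_a k) (tilt_b k) (tilt_c k).
Proof.
have N0 t : t.+1%:R != 0 :> R by rewrite pnatr_eq0.
have n1 : \forall k \near \oo, forall p, [&& tilt_a k p != 0, tilt_b k p != 0 & tilt_c k p != 0].
  apply: near_finType => p.
  have na : \forall k \near \oo, tilt_a k p != 0.
    by apply: (@near_cubic (fun x => a p + x) (a p) 1 0 0); rewrite ?oner_neq0 // => x; ring.
  have nb : \forall k \near \oo, tilt_b k p != 0.
    by apply: (@near_cubic (fun x => b p + x * p.+1%:R) (b p) p.+1%:R 0 0); rewrite ?N0 // => x; ring.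
  have nc : \forall k \near \oo, tilt_c k p != 0.
    apply: (@near_cubic (fun x => c p + x * p.+1%:R ^+ 2) (c p) (p.+1%:R ^+ 2) 0 0).
      by rewrite expf_neq0.
    by move=> x; ring.
  by apply: filterS3 na nb nc => k -> -> ->.
have n2 : \forall k \near \oo, forall p q, p != q ->
    [&& wedge (coefrow (tilt_a k) (tilt_b k) (tilt_c k) p) (coefrow (tilt_a k) (tilt_b k) (tilt_c k) q) != 0,
        det2 (tilt_a k p) (tilt_c k p) (tilt_a k q) (tilt_c k q) != 0 &
        det2 (tilt_b k p) (tilt_c k p) (tilt_b k q) (tilt_c k q) != 0].
  apply: near_finType => p; apply: near_finType => q.
  have [->|pq] := eqVneq p q; first by apply: nearW.
  have D := ordR_inj pq; set P := p.+1%:R in D; set Q := q.+1%:R in D.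
  have P0 : 0 < P by rewrite ltr0n. have Q0 : 0 < Q by rewrite ltr0n.
  have nab : \forall k \near \oo, det2 (tilt_a k p) (tilt_b k p) (tilt_a k q) (tilt_b k q) != 0.
    apply: (@near_cubic (fun x => det2 (a p + x) (b p + x * P) (a q + x) (b q + x * Q))
      (a p * b q - b p * a q) (b q + a p * Q - P * a q - b p) (Q - P) 0); rewrite ?D ?orbT // => x.
    by rewrite det2E; ring.
  have nac : \forall k \near \oo, det2 (tilt_a k p) (tilt_c k p) (tilt_a k q) (tilt_c k q) != 0.
    apply: (@near_cubic (fun x => det2 (a p + x) (c p + x * P ^+ 2) (a q + x) (c q + x * Q ^+ 2))
      (a p * c q - c p * a q) (c q + a p * Q ^+ 2 - P ^+ 2 * a q - c p) ((Q - P) * (Q + P)) 0).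
      by rewrite (mulf_neq0 D) ?orbT // gt_eqF // addr_gt0.
    by move=> x; rewrite det2E; ring.
  have nbc : \forall k \near \oo, det2 (tilt_b k p) (tilt_c k p) (tilt_b k q) (tilt_c k q) != 0.
    apply: (@near_cubic (fun x => det2 (b p + x * P) (c p + x * P ^+ 2) (b q + x * Q) (c q + x * Q ^+ 2))
      (b p * c q - c p * b q) (P * c q + b p * Q ^+ 2 - P ^+ 2 * b q - c p * Q) ((Q - P) * (P * Q)) 0).
      by rewrite (mulf_neq0 D) ?orbT // gt_eqF // mulr_gt0.
    by move=> x; rewrite det2E; ring.
  by apply: filterS3 nab nac nbc => k; rewrite (det2_row (tilt_a k) (tilt_b k) (tilt_c k)) => -> -> ->.
have n3 : \forall k \near \oo, forall p q t, p != q -> p != t -> q != t ->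
    tri (coefrow (tilt_a k) (tilt_b k) (tilt_c k) p) (coefrow (tilt_a k) (tilt_b k) (tilt_c k) q)
      (coefrow (tilt_a k) (tilt_b k) (tilt_c k) t) != 0.
  apply: near_finType => p; apply: near_finType => q; apply: near_finType => t.
  have [->|pq] := eqVneq p q; first by apply: nearW.
  have [->|pt] := eqVneq p t; first by apply: nearW.
  have [->|qt] := eqVneq q t; first by apply: nearW.
  have D1 := ordR_inj pq; have D2 := ordR_inj pt; have D3 := ordR_inj qt.
  set P := p.+1%:R in D1 D2; set Q := q.+1%:R in D1 D3; set T := t.+1%:R in D2 D3.
  have : \forall k \near \oo,
     tri (coefrow (tilt_a k) (tilt_b k) (tilt_c k) p) (coefrow (tilt_a k) (tilt_b k) (tilt_c k) q)
      (coefrow (tilt_a k) (tilt_b k) (tilt_c k) t) != 0.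
    pose V u x : @vec R := (a u + x, b u + x * u.+1%:R, c u + x * u.+1%:R ^+ 2).
    pose X u : @vec R := (a u, b u, c u).
    pose Y u : @vec R := (1, u.+1%:R, u.+1%:R ^+ 2) : R * R * R.
    apply: (@near_cubic (fun x => tri (V p x) (V q x) (V t x)) (tri (X p) (X q) (X t))
      (tri (Y p) (X q) (X t) + tri (X p) (Y q) (X t) + tri (X p) (X q) (Y t))
      (tri (X p) (Y q) (Y t) + tri (Y p) (X q) (Y t) + tri (Y p) (Y q) (X t))
      ((Q - P) * (T - P) * (T - Q))).
      by rewrite !mulf_neq0 ?orbT.
    by move=> x; rewrite /tri /wedge /=; ring.
  by apply: filterS => k.
by apply: filterS3 n1 n2 n3.
Qed.

Lemma affine_tilt (d : 'I_n -> R) rd (w : 'I_n -> R) (s : R) x B :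
  affine (fun t => d t + x * w t) (rd + x * s) (vtx B) = affine d rd (vtx B) + x * affine w s (vtx B).
Proof.
rewrite /affine mulrDr addrACA; congr (_ + _); rewrite mulr_sumr -big_split /=.
by apply: eq_bigr => t _; ring.
Qed.

Lemma tilt_vertices : \forall k \near \oo, forall B j,
  j \in coefrows (tilt_a k) (tilt_b k) (tilt_c k) ++ [:: e1; e2] ->
  wedge (corner_values (tilt_a k) (tilt_b k) (tilt_c k) (tilt_r k) B) j != 0.
Proof.
apply: near_finType => B.
pose x := affine a r.1.1 (vtx B); pose y := affine b r.1.2 (vtx B).
pose x1 : R := affine (fun=> 1) 1 (vtx B); pose y1 : R := affine (fun t : 'I_n => t.+1%:R) 2^-1 (vtx B).
have x1E : x1 = (\sum_(t < n) tnth B t)%N.+1%:R.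
  rewrite /x1 /affine -natr1 natr_sum; congr (_ + _); apply: eq_bigr => t _.
  by rewrite mul1r tnth_mktuple.
have y1E : y1 = (\sum_(t < n) t.+1 * tnth B t)%N%:R + 2^-1.
  by rewrite /y1 /affine natr_sum; congr (_ + _); apply: eq_bigr => t _; rewrite natrM tnth_mktuple.
have x10 : x1 != 0 by rewrite x1E pnatr_eq0.
have y10 : y1 != 0 by rewrite y1E gt_eqF // ltr_wpDl ?ler0n ?invr_gt0 ?ltr0n.
have xE k : affine (tilt_a k) (tilt_r k).1.1 (vtx B) = x + h k * x1.
  have ta : (fun t => a t + h k * 1) = tilt_a k by apply/funext => t; rewrite mulr1.
  by rewrite /x /x1 -affine_tilt ta mulr1.
have yE k : affine (tilt_b k) (tilt_r k).1.2 (vtx B) = y + h k * y1.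
  by rewrite /y /y1 -affine_tilt.
have nx : \forall k \near \oo, affine (tilt_a k) (tilt_r k).1.1 (vtx B) != 0.
  under eq_near => k do rewrite xE.
  by apply: (@near_cubic (fun s => x + s * x1) x x1 0 0); rewrite ?x10 // => s; ring.
have ny : \forall k \near \oo, affine (tilt_b k) (tilt_r k).1.2 (vtx B) != 0.
  under eq_near => k do rewrite yE.
  by apply: (@near_cubic (fun s => y + s * y1) y y1 0 0); rewrite ?y10 // => s; ring.
have nw : \forall k \near \oo, forall p, (affine (tilt_a k) (tilt_r k).1.1 (vtx B)) * tilt_b k p -
     (affine (tilt_b k) (tilt_r k).1.2 (vtx B)) * tilt_a k p != 0.
  apply: near_finType => p; under eq_near => k do rewrite xE yE.
  apply: (@near_cubic (fun s => (x + s * x1) * (b p + s * p.+1%:R) - (y + s * y1) * (a p + s))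
     (x * b p - y * a p) (x1 * b p + x * p.+1%:R - y1 * a p - y) (x1 * p.+1%:R - y1) 0); last by move=> s; ring.
  (* The coefficient of the square is an integer minus a half-integer. *)
  suff -> : x1 * p.+1%:R - y1 != 0 by rewrite orbT.
  rewrite x1E y1E -natrM; apply/eqP => e.
  have : ((\sum_(t < n) tnth B t)%N.+1 * p.+1 * 2)%N%:R = ((\sum_(t < n) t.+1 * tnth B t) * 2 + 1)%N%:R :> R.
    rewrite natrM natrD natrM; move: e; set u := _%:R; set v := _%:R.
    by move=> e; lra.
  move/eqP; rewrite eqr_nat => /eqP /(congr1 odd).
  by rewrite oddD !oddM !andbF.
apply: filterS3 nx ny nw => k xk yk wk j.
rewrite mem_cat !inE => /or3P[/mapP[p _ ->]|/eqP->|/eqP->].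
- by have := wk p; rewrite /wedge /=; congr (~~ (_ == _)); ring.
- by rewrite wedge_e1 oppr_eq0.
- by rewrite wedge_e2.
Qed.

End perturbation.

(** * The volume under good clipping *)

Section volume_formula.
Context {R : realType} {n : nat}.
Hypothesis n0 : (0 < n)%N.
Implicit Types (a b c : 'I_n -> R) (r : @vec R).
Local Notation h := (fun k : nat => harmonic k : R).

Lemma cvg_shift (u w : R) : u + h k * w @[k --> \oo] --> u.
Proof.
rewrite -[X in _ --> X]addr0 -[X in _ + X](mul0r w).
by apply: cvgD; [exact: cvg_cst|apply: cvgM; [exact: cvg_harmonic|exact: cvg_cst]].
Qed.

Lemma cvg_EFin_seq (u_ : nat -> R) (u : R) : u_ @ \oo --> u -> (u_ k)%:E @[k --> \oo] --> u%:E.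
Proof. by move=> cu; apply: cvg_EFin; [exact: nearW|exact: cu]. Qed.

(** Both sides are continuous along the tilt, and they agree in general position. *)
Lemma stable_volume a b c r :
  (exists t, a t != 0) -> (exists t, b t != 0) -> (exists t, c t != 0) ->
  vertex_stable a b c r -> edge_stable a b c r.1.1 r.1.2 r.2 ->
  edge_stable b a c r.1.2 r.1.1 r.2 -> face_stable a b c r ->
  vol (cube `&` halfspace (affine a r.1.1) `&` halfspace (affine b r.1.2)
        `&` halfspace (affine c r.2)) = (index_sum a b c r)%:E.
Proof.
move=> a0 b0 c0 s0 s1 s1' s2.
have ca t : tilt_a a k t @[k --> \oo] --> a t.
  rewrite (_ : (fun k => _) = (fun k => a t + h k * 1)); first exact: cvg_shift.
  by apply/funext => k; rewrite mulr1.
have cb t : tilt_b b k t @[k --> \oo] --> b t by exact: cvg_shift.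
have cc t : tilt_c c k t @[k --> \oo] --> c t by exact: cvg_shift.
have cx : (tilt_r r k).1.1 @[k --> \oo] --> r.1.1.
  rewrite (_ : (fun k => _) = (fun k => r.1.1 + h k * 1)); first exact: cvg_shift.
  by apply/funext => k; rewrite mulr1.
have cy : (tilt_r r k).1.2 @[k --> \oo] --> r.1.2 by exact: cvg_shift.
have cz : (tilt_r r k).2 @[k --> \oo] --> r.2 by exact: cvg_cst.
have cv := vol_cvg ca cb cc cx cy cz a0 b0 c0.
have ci := index_sum_cvg n0 ca cb cc cx cy cz s0 s1 s1' s2.
apply: (@cvg_unique _ _ _ _ _ _ cv).
  exact: ereal_hausdorff.
apply: cvg_trans (cvg_EFin_seq ci).
apply: near_eq_cvg; apply: filterS2 (tilt_generic a b c) (tilt_vertices a b c r) => k g ok.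
by rewrite vol_coefrows ?alternating_sum_index //; exact: generic_ext.
Qed.

Lemma index_sum_shift a b c r :
  index_sum a b c (r.1, r.2 - h k) @[k --> \oo] --> index_sum a b c r.
Proof.
have addc : continuous (fun u : R * R => u.1 + u.2) by exact: add_continuous.
have cz B : affine c (r.2 - h k) (vtx B) @[k --> \oo] --> affine c r.2 (vtx B).
  rewrite (_ : (fun k => _) = (fun k => affine c r.2 (vtx B) + h k * -1)); first exact: cvg_shift.
  by apply/funext => k; rewrite /affine; ring.
have ct u B : tpow n (affine c (r.2 - h k) (vtx B) - u) @[k --> \oo] --> tpow n (affine c r.2 (vtx B) - u).
  by apply: cvg_tpow => //; apply: cvgB => //; exact: cvg_cst.
apply: cvgB; first apply: cvgB; first apply: cvgB.
- apply: cvg_big => // B _; apply: cvgM; first exact: cvg_cst.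
  rewrite /vertex_term /=; case: ifP => _; last exact: cvg_cst.
  apply: cvgM; last exact: cvg_cst.
  by apply: cvg_tpow.
- apply: cvg_big => // p _; apply: cvg_big => // B Bp; apply: cvgM; first exact: cvg_cst.
  rewrite /edge_term /=; case: ifP => _; last exact: cvg_cst.
  by apply: cvgM; [exact: ct|exact: cvg_cst].
- apply: cvg_big => // p _; apply: cvg_big => // B Bp; apply: cvgM; first exact: cvg_cst.
  rewrite /edge_term /=; case: ifP => _; last exact: cvg_cst.
  by apply: cvgM; [exact: ct|exact: cvg_cst].
- apply: cvg_big => // p _; apply: cvg_big => // q pq; apply: cvg_big => // B /andP[Bp Bq].
  apply: cvgM; first exact: cvg_cst.
  rewrite /face_term /=; case: ifP => _; last exact: cvg_cst.
  apply: cvgM; last exact: cvg_cst.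
  rewrite -addrA -opprD (_ : (fun k => _) = (fun k => tpow n (affine c (r.2 - h k) (vtx B) -
     (wedge (corner_values a b c r B) (coefrow a b c q) / wedge (coefrow a b c p) (coefrow a b c q) * c p +
     wedge (coefrow a b c p) (corner_values a b c r B) / wedge (coefrow a b c p) (coefrow a b c q) * c q)))).
    exact: ct.
  by apply/funext => k; rewrite opprD addrA.
Qed.

(** Good clipping gives stability once g3 is lowered by a positive constant; both
    sides are continuous as that constant tends to 0, for the right-hand side
    because the positive part of g3 enters with a power n > 0. *)
Lemma clipped_volume a b c r :
  (exists t, a t != 0) -> (exists t, b t != 0) -> (exists t, c t != 0) ->
  good_clipping (coef_mx a b c) (tnth [tuple r.1.1; r.1.2; r.2]) ->
  vol (cube `&` halfspace (affine a r.1.1) `&` halfspace (affine b r.1.2)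
        `&` halfspace (affine c r.2)) = (index_sum a b c r)%:E.
Proof.
move=> a0 b0 c0 clip.
have cz : r.2 - h k @[k --> \oo] --> r.2.
  rewrite (_ : (fun k => _) = (fun k => r.2 + h k * -1)); first exact: cvg_shift.
  by apply/funext => k; rewrite mulrN1.
have cv : vol (cube `&` halfspace (affine a r.1.1) `&` halfspace (affine b r.1.2)
     `&` halfspace (affine c (r.2 - h k))) @[k --> \oo] -->
    vol (cube `&` halfspace (affine a r.1.1) `&` halfspace (affine b r.1.2)
     `&` halfspace (affine c r.2)).
  by apply: vol_cvg => // t; exact: cvg_cst.
have ci : index_sum a b c (r.1, r.2 - h k) @[k --> \oo] --> index_sum a b c r.
  exact: index_sum_shift.
apply: (@cvg_unique _ _ _ _ _ _ cv).
  exact: ereal_hausdorff.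
apply: cvg_trans (cvg_EFin_seq ci).
apply: near_eq_cvg; apply: nearW => k.
have hk : 0 < h k by exact: harmonic_gt0.
have -> := @stable_volume a b c (r.1, r.2 - h k) a0 b0 c0 (vertex_clip clip hk)
  (edge_clip_a clip hk) (edge_clip_b clip hk) (face_clip_ab clip hk).
by [].
Qed.

Lemma nonconstant_coef (a : 'I_n -> R) (r : R) :
  (exists x y, affine a r x <> affine a r y) -> exists t, a t != 0.
Proof.
move=> [x [y xy]]; apply: contrapT => none; apply: xy.
have az t : a t = 0 by apply/eqP; apply: contra_notT none => at0; exists t.
by rewrite /affine !big1 // => t _; rewrite az mul0r.
Qed.

End volume_formula.

Unset Implicit Arguments.

Theorem corollary5p1 (R : realType) (n : nat) (a b c : 'I_n -> R)
    (r1 r2 r3 : R) (g1 g2 g3 : n.-tuple (measurableTypeR R) -> R)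
    (g1E : g1 = affine a r1) (g2E : g2 = affine b r2) (g3E : g3 = affine c r3)
    (g1_nonconst : exists x y, g1 x <> g1 y)
    (g2_nonconst : exists x y, g2 x <> g2 y)
    (g3_nonconst : exists x y, g3 x <> g3 y)
    (clip : good_clipping (coef_mx a b c) (tnth [tuple r1; r2; r3])) :
  vol (cube `&` halfspace g1 `&` halfspace g2 `&` halfspace g3) =
  (\sum_(v \in (F 0 `&` halfspace g1 `&` halfspace g2 `&` halfspace g3)
               `\` hyperplane g3) term0 c g3 v
   - \sum_(v \in (F 1 `&` hyperplane g1 `&` halfspace g2 `&` halfspace g3)
                 `\` hyperplane g3) term1 a c g3 v
   - \sum_(v \in (F 1 `&` halfspace g1 `&` hyperplane g2 `&` halfspace g3)
                 `\` hyperplane g3) term1 b c g3 v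
   - \sum_(v \in (F 2 `&` hyperplane g1 `&` hyperplane g2 `&` halfspace g3)
                 `\` hyperplane g3) term2 a b c g3 v)%:E.
Proof.
subst g1 g2 g3; pose r : @vec R := (r1, r2, r3).
have a0 := nonconstant_coef g1_nonconst.
have b0 := nonconstant_coef g2_nonconst.
have c0 := nonconstant_coef g3_nonconst.
have n0 : (0 < n)%N by case: a0 => t _; exact: leq_ltn_trans (ltn_ord t).
rewrite (@clipped_volume _ _ n0 a b c r a0 b0 c0 clip) /index_sum.
rewrite -(vertex_sum n0) -(edge_sum n0) -(edge_sum n0) -(face_sum n0).
by rewrite (setIAC (F 1) (halfspace (affine a r1))).
Qed.
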